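(* Let $(M,g)$ be a compact Riemannian manifold. When $n>2$, any stable $p(\cdot)$-harmonic map $\varphi:(M,g)\to\mathbb{S}^n$, where $\mathbb{S}^n$ is the standard sphere, must be constant, where $p$ is a smooth positive function on $M$ such that $2\leq p(x)<n$ for all $x\in M$.
   Context: Let $p$ be a smooth positive function on $M$ with $p(x)\geq2$ for all $x\in M$. The $p(\cdot)$-energy of a smooth map $\varphi:(M,g)\to(N,h)$ between Riemannian manifolds over a compact domain $D\subset M$ is $E_{p(\cdot)}(\varphi;D)=\int_D\frac{|d\varphi|^{p(x)}}{p(x)}\,v_g$, where $|d\varphi|$ is the Hilbert-Schmidt norm of $d\varphi$ and $v_g$ the volume element of $(M,g)$. A smooth map is $p(\cdot)$-harmonic if it is a critical point of $E_{p(\cdot)}(\cdot;D)$ (with respect to smooth variations supported in $D$) for every compact $D\subset M$. For $M$ compact, a $p(\cdot)$-harmonic map $\varphi:(M,g)\to(N,h)$ is called stable if for every vector field $v$ along $\varphi$ (section of $\varphi^{-1}TN$) $$I^\varphi_{p(\cdot)}(v,v)=\int_Mh\big(v,J^\varphi_{p(\cdot)}(v)\big)\,v_g\geq0,$$ where $$J^\varphi_{p(\cdot)}(v)=-|d\varphi|^{p(x)-2}\operatorname{trace}_gR^N(v,d\varphi)d\varphi-\operatorname{trace}_g\nabla^\varphi\big(|d\varphi|^{p(x)-2}\nabla^\varphi v\big)-\operatorname{trace}_g\nabla\big((p(x)-2)|d\varphi|^{p(x)-4}\langle\nabla^\varphi v,d\varphi\rangle d\varphi\big).$$ Here $\nabla^M$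 is the Levi-Civita connection of $(M,g)$, $\nabla^N$ that of $(N,h)$, $\nabla^\varphi$ the pull-back connection on $\varphi^{-1}TN$, $R^N$ the curvature tensor of $(N,h)$ with $R^N(X,Y)Z=\nabla^N_X\nabla^N_YZ-\nabla^N_Y\nabla^N_XZ-\nabla^N_{[X,Y]}Z$, and $\langle\,,\rangle$ the inner product on $T^*M\otimes\varphi^{-1}TN$. For a local orthonormal frame $\{e_i\}_{i=1}^m$ on $(M,g)$: $\operatorname{trace}_gR^N(v,d\varphi)d\varphi=\sum_iR^N(v,d\varphi(e_i))d\varphi(e_i)$; $\langle\nabla^\varphi v,d\varphi\rangle=\sum_ih(\nabla^\varphi_{e_i}v,d\varphi(e_i))$; and for a section $\sigma$ of $T^*M\otimes\varphi^{-1}TN$, $\operatorname{trace}_g\nabla\sigma=\sum_i\{\nabla^\varphi_{e_i}(\sigma(e_i))-\sigma(\nabla^M_{e_i}e_i)\}$ (also written $\operatorname{trace}_g\nabla^\varphi\sigma$).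
   Formalization: The manifold M is additionally assumed connected (and nonempty); on a disconnected M a map that is constant on each component with different values is stable p(·)-harmonic but not constant. *)

(* Defs.v *)
From mathcomp Require Import all_boot all_order all_algebra.
From mathcomp Require Import all_classical all_reals all_analysis.
From mathcomp Require Import ring.

Set Implicit Arguments.
Unset Strict Implicit.
Unset Printing Implicit Defensive.
Import Order.TTheory GRing.Theory Num.Theory.
Import numFieldNormedType.Exports.
Local Open Scope classical_set_scope.
Local Open Scope ring_scope.

Fixpoint Ck (R : realType) (V W : normedModType R) (U : set V) (k : nat)
    (f : V -> W) : Prop :=
  if k is k'.+1 then
    (forall x, U x -> differentiable f x) /\ (forall v, Ck U k' ('D_v f))
  else forall x, U x -> {for x, continuous f}.

(* C^infinity on [U], which is open in all uses. *)
Definition smooth_on (R : realType) (V W : normedModType R) (U : set V)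
    (f : V -> W) : Prop := forall k, Ck U k f.

(* In a chart, tangent vectors are row vectors of components with respect to the
   coordinate frame; vector fields and metrics are functions of the coordinate
   point [y]. *)

Definition ip (R : realType) (n : nat) (A : 'M[R]_n) (X Y : 'rV[R]_n) : R :=
  (X *m A *m Y^T) 0 0.

Section LeviCivita.
Context (R : realType) (m : nat) (G : 'rV[R]_m -> 'M[R]_m).
Implicit Types (y : 'rV[R]_m).

(* The vector Gamma(X, Y) with components Gamma^c_ab X^a Y^b, obtained from the
   Koszul formula for fields with constant components (whose brackets vanish),
     2 <Gamma(X, Y), Z> = X<Y, Z> + Y<X, Z> - Z<X, Y>,
   by raising the index. *)
Definition christoffel y (X Y : 'rV[R]_m) : 'rV[R]_m :=
  (\row_d (2^-1 * ('D_X (fun z => ip (G z) Y (delta_mx 0 d)) y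
                 + 'D_Y (fun z => ip (G z) X (delta_mx 0 d)) y
                 - 'D_(delta_mx 0 d) (fun z => ip (G z) X Y) y)))
  *m invmx (G y).

Definition nabla (X Y : 'rV[R]_m -> 'rV[R]_m) y : 'rV[R]_m :=
  'D_(X y) Y y + christoffel y (X y) (Y y).

Definition lie_bracket (X Y : 'rV[R]_m -> 'rV[R]_m) y : 'rV[R]_m :=
  'D_(X y) Y y - 'D_(Y y) X y.

(* The curvature is tensorial: tangent vectors at [y] are extended to fields
   with constant components. *)
Definition curvature y (X Y Z : 'rV[R]_m) : 'rV[R]_m :=
  nabla (cst X) (nabla (cst Y) (cst Z)) y
  - nabla (cst Y) (nabla (cst X) (cst Z)) y
  - nabla (lie_bracket (cst X) (cst Y)) (cst Z) y.

(* Metric trace; equals \sum_i B e_i e_i for an orthonormal basis (e_i) of the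
   tangent space. *)
Definition trace_g (W : lmodType R) y (B : 'rV[R]_m -> 'rV[R]_m -> W) : W :=
  \sum_(a < m) \sum_(b < m)
    (invmx (G y)) a b *: B (delta_mx 0 a) (delta_mx 0 b).

End LeviCivita.

Section PullBack.
(* [f] is a map between charts with metrics [G] and [H]. A section of f^-1 TN is
   a function [w] of the point; a section of T*M (x) f^-1 TN is a function
   [sigma y X] of the point [y] and of the tangent vector [X] at [y]. *)
Context (R : realType) (m n : nat).
Context (G : 'rV[R]_m -> 'M[R]_m) (H : 'rV[R]_n -> 'M[R]_n).
Context (f : 'rV[R]_m -> 'rV[R]_n).
Implicit Types (y : 'rV[R]_m) (X : 'rV[R]_m).
Implicit Types (w : 'rV[R]_m -> 'rV[R]_n).
Implicit Types (sigma tau : 'rV[R]_m -> 'rV[R]_m -> 'rV[R]_n).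

Definition differential y X : 'rV[R]_n := 'D_X f y.

Definition nabla_pb w y X : 'rV[R]_n :=
  'D_X w y + christoffel H (f y) ('D_X f y) (w y).

Definition trace_nabla sigma y : 'rV[R]_n :=
  trace_g G y (fun X Y =>
    nabla_pb (sigma^~ Y) y X - sigma y (nabla G (cst X) (cst Y) y)).

Definition hs_inner sigma tau y : R :=
  trace_g G y (W := R^o) (fun X Y => ip (H (f y)) (sigma y X) (tau y Y)).

Definition hs_norm_diff y : R := Num.sqrt (hs_inner differential differential y).

(* The operator J, where [q] is the exponent p read in the chart. Real powers
   are [powR], with 0 `^ 0 = 1 and 0 `^ a = 0 for a != 0; the latter is
   the convention that the last term vanishes at the zeros of d(phi). *)
Definition jacobi (q : 'rV[R]_m -> R) w y : 'rV[R]_n :=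
  - ((hs_norm_diff y `^ (q y - 2)) *:
       trace_g G y (fun X Y =>
         curvature H (f y) (w y) (differential y X) (differential y Y)))
  - trace_nabla (fun z X => (hs_norm_diff z `^ (q z - 2)) *: nabla_pb w z X) y
  - trace_nabla (fun z X =>
      ((q z - 2) * hs_norm_diff z `^ (q z - 4)
        * hs_inner (nabla_pb w) differential z) *: differential z X) y.

End PullBack.

(* Bare data; the axioms are in [riemannian_manifold]. *)
Record riem_atlas (R : realType) (T : Type) (m : nat) := RiemAtlas {
  chart_index : Type;
  dom : chart_index -> set T;
  coord : chart_index -> T -> 'rV[R]_m;
  param : chart_index -> 'rV[R]_m -> T;       (* inverse of [coord] *)
  chart_at : T -> chart_index;                (* a chart around each point *)
  metric : chart_index -> 'rV[R]_m -> 'M[R]_m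
}.

Definition codom_chart (R : realType) (T : Type) (m : nat)
  (g : riem_atlas R T m) (i : chart_index g) : set 'rV[R]_m := coord i @` dom i.

Definition transition (R : realType) (T : Type) (m : nat)
  (g : riem_atlas R T m) (i j : chart_index g) : 'rV[R]_m -> 'rV[R]_m :=
  coord j \o param i.

Record riemannian_manifold (R : realType) (M : topologicalType) (m : nat)
    (g : riem_atlas R M m) : Prop := RiemannianManifold {
  rm_hausdorff : hausdorff_space M;
  rm_second_countable : @second_countable M;
  rm_chart_at : forall x : M, dom (chart_at g x) x;
  rm_open_dom : forall i : chart_index g, open (dom i);
  rm_open_codom : forall i : chart_index g, open (codom_chart i);
  rm_coordK : forall (i : chart_index g) x, dom i x -> param i (coord i x) = x;
  rm_coord_continuous : forall i : chart_index g,
    {within dom i, continuous (coord i)};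
  rm_param_continuous : forall i : chart_index g,
    {within codom_chart i, continuous (param i)};
  rm_transition : forall i j : chart_index g,
    smooth_on (coord i @` (dom i `&` dom j)) (transition i j);
  rm_metric_smooth : forall i : chart_index g,
    smooth_on (codom_chart i) (@metric R M m g i);
  rm_metric_sym : forall (i : chart_index g) y, codom_chart i y ->
    (metric i y)^T = metric i y;
  rm_metric_pos : forall (i : chart_index g) y X, codom_chart i y ->
    X != 0 -> 0 < ip (metric i y) X X;
  rm_metric_transition : forall (i j : chart_index g) x X Y,
    dom i x -> dom j x ->
    ip (metric j (coord j x))
       ('D_X (transition i j) (coord i x)) ('D_Y (transition i j) (coord i x))
    = ip (metric i (coord i x)) X Y
}.

(* Lebesgue integral over R^m of a nonnegative Borel function, as an iterated
   integral (Tonelli). *)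
Fixpoint lebesgue_int (R : realType) (m : nat) :
    ('rV[R]_m -> \bar R) -> \bar R :=
  if m is m'.+1 then fun F : 'rV[R]_(1 + m') -> \bar R =>
    (\int[@lebesgue_measure R]_t lebesgue_int (fun y => F (row_mx t%:M y)))%E
  else fun F => F 0.

Definition borel (M : ptopologicalType) := g_sigma_algebraType (@open M).

(* v_g is determined by dv_g = sqrt(det g_ab) dy in every chart. *)
Definition volume_measure (R : realType) (M : ptopologicalType) (m : nat)
    (g : riem_atlas R M m) (mu : {measure set (borel M) -> \bar R}) : Prop :=
  forall (i : chart_index g) (A : set (borel M)),
    measurable A -> A `<=` dom i ->
    mu A = lebesgue_int (fun y =>
      (\1_(coord i @` A) y * Num.sqrt (\det (metric i y)))%:E).

Definition smooth_function (R : realType) (M : Type) (m : nat)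
    (g : riem_atlas R M m) (p : M -> R) : Prop :=
  forall i : chart_index g, smooth_on (codom_chart i) (p \o param i).

Section Maps.
Context (R : realType) (M : ptopologicalType) (N : Type) (m n : nat).
Context (g : riem_atlas R M m) (h : riem_atlas R N n).
Implicit Types (phi : M -> N) (i : chart_index g) (j : chart_index h).
Implicit Types (v : chart_index h -> M -> 'rV[R]_n).

Definition local_dom phi i j : set 'rV[R]_m :=
  coord i @` (dom i `&` phi @^-1` dom j).

Definition local_map phi i j : 'rV[R]_m -> 'rV[R]_n := coord j \o phi \o param i.

(* Openness of the local domains is the continuity of [phi]. *)
Definition smooth_map phi : Prop := forall i j,
  open (local_dom phi i j) /\ smooth_on (local_dom phi i j) (local_map phi i j).

(* Smoothness of (t, x) |-> Phi t x on ]-eps, eps[ x M; the charts of the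
   product are read in 'rV_(1 + m), with time as first coordinate. *)
Definition smooth_family (eps : R) (Phi : R -> M -> N) : Prop := forall i j,
  let U := [set z : 'rV[R]_(1 + m) | `|lsubmx z 0 0| < eps /\
              local_dom (Phi (lsubmx z 0 0)) i j (rsubmx z)] in
  open U /\
  smooth_on U (fun z => local_map (Phi (lsubmx z 0 0)) i j (rsubmx z)).

(* A vector field along [phi]: [v j x] lists the components in the chart [j] of
   a tangent vector at [phi x]; it is meaningful when [dom j (phi x)], and the
   components in two charts are related by the Jacobian of the transition. *)
Definition field_along phi v : Prop :=
  (forall i j, smooth_on (local_dom phi i j) (v j \o param i)) /\
  (forall x j k, dom j (phi x) -> dom k (phi x) ->
     v k x = 'D_(v j x) (transition j k) (coord j (phi x))).

(* |d phi| at x; any charts around x and phi x give the same value. *)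
Definition diff_norm phi (x : M) : R :=
  let i := chart_at g x in let j := chart_at h (phi x) in
  hs_norm_diff (metric i) (metric j) (local_map phi i j) (coord i x).

(* h(v, J v) at x; any charts around x and phi x give the same value. *)
Definition jacobi_density (p : M -> R) phi v (x : M) : R :=
  let i := chart_at g x in let j := chart_at h (phi x) in
  ip (metric j (coord j (phi x))) (v j x)
     (jacobi (metric i) (metric j) (local_map phi i j) (p \o param i)
             (v j \o param i) (coord i x)).

Context (mu : {measure set (borel M) -> \bar R}) (p : M -> R).

Definition p_energy phi (D : set M) : R :=
  \int[mu]_(x in D) (diff_norm phi x `^ p x / p x).

Definition p_harmonic phi : Prop :=
  smooth_map phi /\
  forall (D : set M) (eps : R) (Phi : R -> M -> N),
    compact D -> 0 < eps -> smooth_family eps Phi ->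
    Phi 0 = phi ->
    (forall t x, `|t| < eps -> ~ D x -> Phi t x = phi x) ->
    is_derive (0 : R^o) 1 (fun t => p_energy (Phi t) D : R^o) 0.

(* As for [p_energy], the integral is the real-valued [Rintegral], which is 0
   when the integrand has no finite integral: the sign condition in
   [stable_p_harmonic] thus bears on the [v] for which I(v, v) is finite. *)
Definition index_form phi v : R := \int[mu]_x jacobi_density p phi v x.

Definition stable_p_harmonic phi : Prop :=
  p_harmonic phi /\ forall v, field_along phi v -> 0 <= index_form phi v.

End Maps.

(* The metric is induced by the Euclidean inner product; the atlas consists of
   the stereographic projections from the poles (1, 0, ..., 0) (index [true]) and
   (-1, 0, ..., 0) (index [false]). *)

Section Sphere.
Context (R : realType) (n : nat).

Definition sphere : Type :=
  set_type [set x : 'rV[R]_n.+1 | \sum_k x 0 k ^+ 2 = 1].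

Definition pole (b : bool) : R := if b then 1 else -1.

Definition stereo_fun (b : bool) (y : 'rV[R]_n) : 'rV[R]_n.+1 :=
  let r := \sum_k y 0 k ^+ 2 in
  \row_k (if unlift ord0 k is Some l then 2 * y 0 l / (1 + r)
          else pole b * (r - 1) / (1 + r)).

Lemma stereo_funP b y :
  stereo_fun b y \in [set x : 'rV[R]_n.+1 | \sum_k x 0 k ^+ 2 = 1].
Proof.
rewrite inE /= /stereo_fun; set r := \sum_k y 0 k ^+ 2.
rewrite big_ord_recl mxE unlift_none.
under eq_bigr do rewrite mxE liftK expr_div_n exprMn.
rewrite -mulr_suml -mulr_sumr -/r.
have r1 : 1 + r != 0.
  by rewrite gt_eqF// ltr_pwDl// sumr_ge0// => k _; rewrite sqr_ge0.
have pb : pole b ^+ 2 = 1 by case: b; rewrite /pole ?sqrrN expr1n.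
by rewrite expr_div_n exprMn pb; field.
Qed.

Definition sphere_atlas : riem_atlas R sphere n := {|
  chart_index := bool;
  dom := fun b => [set x : sphere | (val x : 'rV[R]_n.+1) 0 ord0 != pole b];
  coord := fun b x => \row_k ((val x : 'rV[R]_n.+1) 0 (lift ord0 k)
             / (1 - pole b * (val x : 'rV[R]_n.+1) 0 ord0));
  param := fun b y => SigSub (stereo_funP b y);
  chart_at := fun x => (val x : 'rV[R]_n.+1) 0 ord0 != pole true;
  metric := fun b y => \matrix_(i, j) \sum_k
    ('D_(delta_mx 0 i) (stereo_fun b) y) 0 k
      * ('D_(delta_mx 0 j) (stereo_fun b) y) 0 k
|}.

End Sphere.

(* Main.v *)
Require Import Defs.
From mathcomp Require Import all_boot all_order all_algebra.
From mathcomp Require Import all_classical all_reals all_analysis.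
From mathcomp Require Import measurable_realfun.
From mathcomp Require Import ring lra.

(** Let x_0, ..., x_n be the coordinates of the Euclidean space around the sphere,
    V_c the gradient of x_c on the sphere, that is the tangential part of the
    c-th basis vector, and u_c = x_c o phi. Stability is tested with the n + 1
    fields V_c along phi, and the resulting inequalities are added.

    The field V_c is conformal: nabla_X V_c = - x_c X ([nabla_conformal_field]).
    So every derivative of V_c along phi is a multiple of d(phi), and
    h(V_c, J V_c) becomes an expression [density] in the exponent p, in
    S = |d phi|^2, in u_c and in the scalars |du_c|^2, <dp, du_c>, <dS, du_c> and
    Laplacian of u_c ([jacobi_densityE], [jacobi_density_test_field]). The
    equation sum_c u_c^2 = 1 and its derivatives give sum_c u_c du_c = 0 and
    sum_c u_c Laplacian(u_c) = - S; moreover sum_c |du_c|^2 = S. In the sum over c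
    the derivatives of p and of S therefore disappear, and
      sum_c h(V_c, J V_c) = (p - n) |d phi|^p        ([sum_density]).
    As p < n and each integral is nonnegative, |d phi|^p has integral zero. Nonempty
    open sets have positive volume ([volume_small_cube]), so the continuous function
    S vanishes everywhere ([energy_eq0]); then each u_c is locally constant, and
    phi is constant because M is connected.

    Three points need care.

    - Zeros of d(phi). The operator J differentiates |d phi|^(p - 2) times a
      section, and that power need not be differentiable where d(phi) vanishes.
      The section is O(|d phi|) there, and the product is differentiable with the
      expected derivative ([is_derive_powR_mul_at_zero], [is_derive_weighted]).

    - Integrability. Stability says something about V_c, and integrals may be
      added, only if the densities are integrable. They contain <dp, du_c> ln S
      and <dS, du_c> / S, which look singular at the zeros of S. But
      |du_c| <= sqrt S, and |dS| = O(sqrt S) because S is a sum of squares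
      ([dominated_grad_energy]); so the densities are bounded on the compact
      manifold M ([bdd_density]), whose volume is finite.

    - Charts. The density at a point is computed in charts chosen at that point.
      The scalars <da, db> and Laplacian(u) do not depend on the chart, by the
      transformation law of the Christoffel symbols ([christoffel_change]); they
      are thus smooth on M, and the densities are measurable. *)

Set Implicit Arguments.
Unset Strict Implicit.
Unset Printing Implicit Defensive.
Import Order.TTheory GRing.Theory Num.Theory.
Import numFieldNormedType.Exports.
Local Open Scope classical_set_scope.
Local Open Scope ring_scope.

(** * Directional derivatives *)

Section DirectionalDerivatives.
Context {R : realType} {V W : normedModType R}.
Implicit Types (f g : V -> R) (x v : V).

Lemma is_derive_add (F G : V -> W) x v (a b : W) :
  is_derive x v F a -> is_derive x v G b ->
  is_derive x v (fun z => F z + G z) (a + b).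
Proof. by move=> Fa Gb; exact: is_deriveD. Qed.

Lemma is_derive_opp (F : V -> W) x v (a : W) :
  is_derive x v F a -> is_derive x v (fun z => - F z) (- a).
Proof. by move=> Fa; exact: is_deriveN. Qed.

Lemma is_derive_mul f g x v (a b : R) :
  is_derive x v f a -> is_derive x v g b ->
  is_derive x v (fun z => f z * g z) (a * g x + f x * b).
Proof.
move=> fa gb; apply: (is_derive_eq (is_deriveM fa gb)).
by rewrite addrC ![_ *: _]/(_ * _) [a * _]mulrC.
Qed.

Lemma is_derive_bigsum (I : Type) (r : seq I) (P : pred I) (F : I -> V -> W)
    x v (a : I -> W) :
  (forall i, P i -> is_derive x v (F i) (a i)) ->
  is_derive x v (fun z => \sum_(i <- r | P i) F i z) (\sum_(i <- r | P i) a i).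
Proof.
move=> Fa; elim: r => [|i r IH].
  rewrite big_nil (_ : (fun z => _) = cst 0) ?funeqE; first exact: is_derive_cst.
  by move=> z; rewrite big_nil.
rewrite big_cons (_ : (fun z => _) = fun z => if P i then
  F i z + \sum_(j <- r | P j) F j z else \sum_(j <- r | P j) F j z); last first.
  by apply/funext => z; rewrite big_cons.
by case: ifP => // Pi; apply: is_derive_add => //; exact: Fa.
Qed.

Lemma is_derive_inv f x v (a : R) : f x != 0 ->
  is_derive x v f a -> is_derive x v (fun z => (f z)^-1) (- a / f x ^+ 2).
Proof.
move=> fx0 [fa <-]; apply: DeriveDef; first exact: derivableV.
by rewrite deriveV//= -exprVn scaleNr [_ *: _]mulrC mulNr exprVn.
Qed.

(** Reduces derivatives in a direction to functions of one real variable, where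
    the mean value theorem applies. *)
Lemma is_derive_line (F : V -> W) x v (t : R) (a : W) :
  is_derive (x + t *: v) v F a <-> is_derive t 1 (fun s : R => F (x + s *: v)) a.
Proof.
have E : (fun h : R => h^-1 *: ((F \o shift (x + t *: v)) (h *: v) - F (x + t *: v)))
  = (fun h : R => h^-1 *: (((fun s : R => F (x + s *: v)) \o shift t) (h *: 1)
                      - F (x + t *: v))).
  by apply/funext => h /=; rewrite [h *: 1]mulr1 scalerDl addrCA.
by split=> -[d e]; split; move: d e; rewrite /derivable /derive E.
Qed.

End DirectionalDerivatives.

Section OuterComposition.
Context {R : realType} {V : normedModType R}.

Lemma is_derive_outer (g : R -> R) (f : V -> R) x v (a b : R) :
  is_derive (f x) 1 g b -> is_derive x v f a ->
  is_derive x v (fun z => g (f z)) (b * a).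
Proof.
move=> gb fa; rewrite -[x]addr0 -(scale0r v); apply/is_derive_line.
have /is_derive_line fa' : is_derive (x + 0 *: v) v f a by rewrite scale0r addr0.
have gb' : is_derive (f (x + 0 *: v)) 1 g b by rewrite scale0r addr0.
exact: (@is_derive1_comp _ g (fun s => f (x + s *: v)) _ _ _ gb' fa').
Qed.
End OuterComposition.

Section MatrixValued.
Context {R : realType} {V : normedModType R} {m n : nat}.
Implicit Types (F : V -> 'M[R]_(m, n)) (x v : V).

Lemma is_derive_entry F x v (A : 'M[R]_(m, n)) i j :
  is_derive x v F A -> is_derive x v (fun z => F z i j) (A i j).
Proof.
move=> [d <-]; split; first by move/derivable_mxP : d.
by rewrite derive_mx// mxE.
Qed.

Lemma is_derive_mx F x v (A : 'M[R]_(m, n)) :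
  (forall i j, is_derive x v (fun z => F z i j) (A i j)) -> is_derive x v F A.
Proof.
move=> d; have dF : derivable F x v by apply/derivable_mxP => i j; exact: ex_derive.
by split=> //; rewrite derive_mx//; apply/matrixP => i j; rewrite mxE derive_val.
Qed.

Lemma differentiable_entry F x i j :
  differentiable F x -> differentiable (fun z => F z i j) x.
Proof. by move=> d; exact: (differentiable_comp d (differentiable_coord (F x) i j)). Qed.

Lemma differentiable_mx F x :
  (forall i j, differentiable (fun z => F z i j) x) -> differentiable F x.
Proof.
move=> d.
have -> : F = \sum_(i < m) \sum_(j < n) (fun z => F z i j *: delta_mx i j).
  apply/funext => z; rewrite [LHS]matrix_sum_delta fct_sumE.
  by apply: eq_bigr => i _; rewrite fct_sumE.
apply: differentiable_sum => i; apply: differentiable_sum => j.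
exact: differentiableZl.
Qed.

Lemma differentiable_derive_sum p (G : 'rV[R]_p -> 'M[R]_(m, n)) (x v : 'rV[R]_p) :
  differentiable G x -> 'D_v G x = \sum_a v 0 a *: 'D_(delta_mx 0 a) G x.
Proof.
move=> d; rewrite deriveE// {1}[v]row_sum_delta linear_sum.
by apply: eq_bigr => a _; rewrite linearZ deriveE.
Qed.

End MatrixValued.

Lemma differentiable_derive_coord (R : realType) p (f : 'rV[R]_p -> R) (x v : 'rV[R]_p) :
  differentiable f x -> 'D_v f x = \sum_a v 0 a * 'D_(delta_mx 0 a) f x.
Proof.
move=> d; rewrite deriveE// {1}[v]row_sum_delta linear_sum.
by apply: eq_bigr => a _; rewrite linearZ deriveE.
Qed.

Lemma is_derive_chain (R : realType) (U V W : normedModType R)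
    (f : U -> V) (g : V -> W) (x v : U) :
  differentiable f x -> differentiable g (f x) ->
  is_derive x v (fun z => g (f z)) ('D_('D_v f x) g (f x)).
Proof.
move=> df dg; have dgf : differentiable (g \o f) x by exact: differentiable_comp.
split; first exact: diff_derivable.
by rewrite [LHS]deriveE// diff_comp//= !deriveE.
Qed.

(** * Smooth functions on open sets *)

Section SmoothClosure.
Context {R : realType} {V : normedModType R}.

Lemma differentiable_near0 (W : normedModType R) (e : V -> W) (x : V) :
  (\forall z \near x, e z = 0) -> differentiable e x.
Proof.
move=> e0; have E : e \o shift x = cst (e x) + (\0 : {linear V -> W}) +o_ 0 id.
  apply/eqaddoP => _/posnumP[eps]; rewrite (nbhs_singleton e0).
  have : \forall h \near (0 : V), e (h + x) = 0.
    by move: e0; rewrite (near_shift 0) subr0.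
  apply: filterS => h /= eh; rewrite -![(_ + _ : _ -> _) _]/(_ + _) /= eh.
  by rewrite addr0 subrr normr0 mulr_ge0.
have d0 : 'd e x = (\0 : {linear V -> W}) :> (V -> W).
  by apply: diff_unique => //; exact: cst_continuous.
by apply/diff_locallyP; rewrite d0; split=> //; exact: cst_continuous.
Qed.

(** Differentiability is a property of germs: the difference g - f vanishes near x. *)
Lemma near_eq_differentiable (W : normedModType R) (f g : V -> W) (x : V) :
  (\forall z \near x, f z = g z) -> differentiable f x -> differentiable g x.
Proof.
move=> fg df; have -> : g = f + (g - f) by rewrite addrC subrK.
apply: differentiableD => //; apply: differentiable_near0.
by apply: filterS fg => z fz; rewrite -![(_ + _ : _ -> _) _]/(_ + _) /= -fz subrr.
Qed.

Section OnOpen.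
Variables (U : set V) (oU : open U).

Lemma near_in_open (x : V) (P : V -> Prop) :
  U x -> (forall z, U z -> P z) -> \forall z \near x, P z.
Proof. by move=> Ux h; near=> z; apply: h; near: z; exact: open_nbhs_nbhs.
Unshelve. all: by end_near. Qed.

Lemma derive_eq_in (W : normedModType R) (f g : V -> W) v x :
  (forall z, U z -> f z = g z) -> U x -> 'D_v f x = 'D_v g x.
Proof. by move=> fg Ux; apply: near_eq_derive; exact: near_in_open. Qed.

Lemma Ck_eq_in (W : normedModType R) k (f g : V -> W) :
  (forall z, U z -> f z = g z) -> Ck U k f -> Ck U k g.
Proof.
elim: k f g => [|k IH] f g fg /=.
  move=> cf x Ux; rewrite /prop_for /continuous_at -(fg _ Ux).
  have /(_ _) := cf x Ux; apply: cvg_trans; apply: near_eq_cvg.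
  exact: near_in_open.
move=> [df cf]; split=> [x Ux|v].
  by apply: near_eq_differentiable (df _ Ux); exact: near_in_open.
by apply: IH (cf v) => z Uz; exact: derive_eq_in.
Qed.

Lemma Ck_leS (W : normedModType R) k (f : V -> W) : Ck U k.+1 f -> Ck U k f.
Proof.
elim: k f => [|k IH] f /=; first by case=> df _ x /df /differentiable_continuous.
by move=> [df cf]; split=> // v; exact: IH.
Qed.

Lemma smooth_eq_in (W : normedModType R) (f g : V -> W) :
  (forall z, U z -> f z = g z) -> smooth_on U f -> smooth_on U g.
Proof. by move=> fg sf k; exact: Ck_eq_in (sf k). Qed.

Lemma smooth_differentiable (W : normedModType R) (f : V -> W) x :
  smooth_on U f -> U x -> differentiable f x.
Proof. by move=> /(_ 1) [df _] /df. Qed.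

Lemma smooth_derivable (W : normedModType R) (f : V -> W) x v :
  smooth_on U f -> U x -> derivable f x v.
Proof. by move=> sf Ux; apply: diff_derivable; exact: smooth_differentiable Ux. Qed.

Lemma smooth_is_derive (W : normedModType R) (f : V -> W) x v :
  smooth_on U f -> U x -> is_derive x v f ('D_v f x).
Proof. by move=> sf Ux; exact: derivableP (smooth_derivable sf Ux). Qed.

Lemma smooth_continuous (W : normedModType R) (f : V -> W) x :
  smooth_on U f -> U x -> {for x, continuous f}.
Proof. by move=> /(_ 0) cf /cf. Qed.

Lemma smooth_derive (W : normedModType R) (f : V -> W) v :
  smooth_on U f -> smooth_on U ('D_v f).
Proof. by move=> sf k; have [_] := sf k.+1; apply. Qed.

Lemma Ck_cst (W : normedModType R) k (a : W) : Ck U k (fun=> a).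
Proof.
elim: k a => [|k IH] a /=; first by move=> x _; exact: cst_continuous.
split=> [x _|v]; first exact: differentiable_cst.
by rewrite (_ : 'D_v _ = fun=> 0)//; apply/funext => x; exact: derive_cst.
Qed.

Lemma differentiable_is_derive (W : normedModType R) (f : V -> W) x v :
  differentiable f x -> is_derive x v f ('D_v f x).
Proof. by move=> df; exact: derivableP (diff_derivable df). Qed.

Lemma is_deriveE (W : normedModType R) (f : V -> W) x v (a : W) :
  is_derive x v f a -> 'D_v f x = a.
Proof. by case. Qed.

Lemma Ck_add (W : normedModType R) k (f g : V -> W) :
  Ck U k f -> Ck U k g -> Ck U k (fun z => f z + g z).
Proof.
elim: k f g => [|k IH] f g /=.
  by move=> cf cg x Ux; apply: continuousD; [exact: cf|exact: cg].
move=> [df cf] [dg cg]; split=> [x Ux|v].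
  by apply: differentiableD; [exact: df|exact: dg].
apply: Ck_eq_in (IH _ _ (cf v) (cg v)) => z Uz; apply/esym/is_deriveE.
by apply: is_derive_add; apply: differentiable_is_derive; [exact: df|exact: dg].
Qed.

Lemma Ck_mul k (f g : V -> R) :
  Ck U k f -> Ck U k g -> Ck U k (fun z => f z * g z).
Proof.
elim: k f g => [|k IH] f g.
  by move=> /= cf cg x Ux; apply: continuousM; [exact: cf|exact: cg].
move=> Cf Cg; have [df cf] := Cf; have [dg cg] := Cg; split=> [x Ux|v].
  by apply: differentiableM; [exact: df|exact: dg].
have /Ck_add /(_ (IH _ _ (Ck_leS Cf) (cg v))) := IH _ _ (cf v) (Ck_leS Cg).
apply: Ck_eq_in => z Uz; apply/esym/is_deriveE.
by apply: is_derive_mul; apply: differentiable_is_derive; [exact: df|exact: dg].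
Qed.

Lemma smooth_cst (W : normedModType R) (a : W) : smooth_on U (fun=> a).
Proof. by move=> k; exact: Ck_cst. Qed.

Lemma smooth_add (W : normedModType R) (f g : V -> W) :
  smooth_on U f -> smooth_on U g -> smooth_on U (fun z => f z + g z).
Proof. by move=> sf sg k; exact: Ck_add. Qed.

Lemma smooth_mul (f g : V -> R) :
  smooth_on U f -> smooth_on U g -> smooth_on U (fun z => f z * g z).
Proof. by move=> sf sg k; exact: Ck_mul. Qed.

Lemma smooth_opp (f : V -> R) :
  smooth_on U f -> smooth_on U (fun z => - f z).
Proof.
move=> sf; apply: smooth_eq_in (smooth_mul (smooth_cst (-1 : R)) sf) => z _.
by rewrite mulN1r.
Qed.

Lemma smooth_sub (f g : V -> R) :
  smooth_on U f -> smooth_on U g -> smooth_on U (fun z => f z - g z).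
Proof. by move=> sf sg; apply: smooth_add => //; exact: smooth_opp. Qed.

Lemma smooth_sum (I : Type) (r : seq I) (P : pred I) (F : I -> V -> R) :
  (forall i, P i -> smooth_on U (F i)) ->
  smooth_on U (fun z => \sum_(i <- r | P i) F i z).
Proof.
move=> sF; elim: r => [|i r IH].
  by apply: smooth_eq_in (smooth_cst (0 : R)) => z _; rewrite big_nil.
have [Pi|nPi] := boolP (P i).
  apply: smooth_eq_in (smooth_add (sF i Pi) IH) => z _.
  by rewrite big_cons Pi.
by apply: smooth_eq_in IH => z _; rewrite big_cons (negbTE nPi).
Qed.

Lemma smooth_prod (I : Type) (r : seq I) (P : pred I) (F : I -> V -> R) :
  (forall i, P i -> smooth_on U (F i)) ->
  smooth_on U (fun z => \prod_(i <- r | P i) F i z).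
Proof.
move=> sF; elim: r => [|i r IH].
  by apply: smooth_eq_in (smooth_cst (1 : R)) => z _; rewrite big_nil.
have [Pi|nPi] := boolP (P i).
  apply: smooth_eq_in (smooth_mul (sF i Pi) IH) => z _.
  by rewrite big_cons Pi.
by apply: smooth_eq_in IH => z _; rewrite big_cons (negbTE nPi).
Qed.

(** By induction, since the derivative of 1 / f is - f' (1 / f)^2. *)
Lemma Ck_inv k (f : V -> R) : (forall x, U x -> f x != 0) ->
  Ck U k f -> Ck U k (fun z => (f z)^-1).
Proof.
move=> f0; elim: k => [|k IH] Cf.
  by move=> x Ux; apply: continuousV; [exact: f0|exact: Cf].
have [df cf] := Cf; split=> [x Ux|v].
  by apply: differentiableV; [exact: df|exact: f0].
have Ci := IH (Ck_leS Cf).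
have := Ck_mul (Ck_mul (Ck_cst k (-1 : R)) (cf v)) (Ck_mul Ci Ci).
apply: Ck_eq_in => z Uz; apply/esym/is_deriveE.
rewrite mulN1r -invfM -expr2; apply: is_derive_inv; first exact: f0.
by apply: differentiable_is_derive; exact: df.
Qed.

Lemma smooth_inv (f : V -> R) : (forall x, U x -> f x != 0) ->
  smooth_on U f -> smooth_on U (fun z => (f z)^-1).
Proof. by move=> f0 sf k; exact: Ck_inv. Qed.

Lemma smooth_entry m n (F : V -> 'M[R]_(m, n)) i j :
  smooth_on U F -> smooth_on U (fun z => F z i j).
Proof.
move=> sF k; elim: k F sF => [|k IH] F sF.
  move=> x Ux; apply: (@continuous_comp _ _ _ F (fun M : 'M[R]_(m, n) => M i j)).
    exact: smooth_continuous sF Ux.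
  exact: coord_continuous.
split=> [x Ux|v].
  by apply: differentiable_entry; exact: smooth_differentiable sF Ux.
apply: Ck_eq_in (IH _ (smooth_derive v sF)) => z Uz; apply/esym/is_deriveE.
by apply: is_derive_entry; exact: smooth_is_derive.
Qed.

Lemma smooth_mx m n (F : V -> 'M[R]_(m, n)) :
  (forall i j, smooth_on U (fun z => F z i j)) -> smooth_on U F.
Proof.
move=> sF k; elim: k F sF => [|k IH] F sF.
  move=> x Ux; apply: differentiable_continuous; apply: differentiable_mx => i j.
  exact: smooth_differentiable (sF i j) Ux.
have dF x : U x -> differentiable F x.
  by move=> Ux; apply: differentiable_mx => i j; exact: smooth_differentiable (sF i j) Ux.
split=> // v; apply: IH => i j.
apply: smooth_eq_in (smooth_derive v (sF i j)) => z Uz; apply/is_deriveE.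
by apply: is_derive_entry; exact: differentiable_is_derive (dF _ Uz).
Qed.

End OnOpen.

Lemma Ck_local (W : normedModType R) k (U : set V) (f : V -> W) :
  (forall x, U x -> exists2 B : set V, B x & Ck B k f) -> Ck U k f.
Proof.
elim: k f => [|k IH] f h; first by by move=> x /h [B Bx cf]; exact: cf.
split=> [x /h [B Bx [df _]]|v]; first exact: df.
by apply: IH => x /h [B Bx [_ cf]]; exists B => //; exact: cf.
Qed.

Lemma smooth_local (W : normedModType R) (U : set V) (f : V -> W) :
  (forall x, U x -> exists2 B : set V, B x & smooth_on B f) -> smooth_on U f.
Proof. by move=> h k; apply: Ck_local => x /h [B Bx sf]; exists B. Qed.

Lemma smooth_subset (W : normedModType R) (U B : set V) (f : V -> W) :
  B `<=` U -> smooth_on U f -> smooth_on B f.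
Proof. by move=> BU sf; apply: smooth_local => x /BU Ux; exists U. Qed.

End SmoothClosure.

(** Determinants are polynomials in the entries. *)
Lemma smooth_det (R : realType) (V : normedModType R) (U : set V) (oU : open U)
    n (F : V -> 'M[R]_n) : smooth_on U F -> smooth_on U (fun z => \det (F z)).
Proof.
move=> sF; apply: (smooth_sum oU) => s _.
by apply: (smooth_mul oU); [exact: smooth_cst|apply: (smooth_prod oU) => i _; exact: smooth_entry].
Qed.

(** Cramer: the inverse is rational in the entries. *)
Lemma smooth_invmx (R : realType) (V : normedModType R) (U : set V) (oU : open U)
    n (F : V -> 'M[R]_n) : (forall z, U z -> F z \in unitmx) ->
  smooth_on U F -> smooth_on U (fun z => invmx (F z)).
Proof.
move=> uF sF; apply: (smooth_mx oU) => i j.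
have d0 z : U z -> \det (F z) != 0 by move=> /uF; rewrite unitmxE unitfE.
have sadj : smooth_on U (fun z => (\adj (F z)) i j).
  apply: (smooth_eq_in oU (f := fun z => (-1) ^+ (j + i) * \det (row' j (col' i (F z))))).
    by move=> z _; rewrite mxE.
  apply: (smooth_mul oU); first exact: smooth_cst.
  apply: (smooth_det oU); apply: (smooth_mx oU) => a b.
  apply: (smooth_eq_in oU (f := fun z => F z (lift j a) (lift i b))).
    by move=> z _; rewrite !mxE.
  exact: smooth_entry.
apply: (smooth_eq_in oU (f := fun z => (\det (F z))^-1 * (\adj (F z)) i j)).
  by move=> z Uz; rewrite /invmx (uF _ Uz) !mxE.
by apply: (smooth_mul oU) => //; apply: (smooth_inv oU) => //; exact: smooth_det.
Qed.

Lemma differentiable_line (R : realType) (V W : normedModType R) (F : V -> W)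
    (x v : V) (t : R) : differentiable F (x + t *: v) ->
  is_derive t 1 (fun s : R => F (x + s *: v)) ('D_v F (x + t *: v)).
Proof.
by move=> dF; apply/(is_derive_line F x v t); exact: differentiable_is_derive.
Qed.

(** Two applications of the mean value theorem to the second difference of f on
    the parallelogram spanned by h X and h Y. *)
Lemma second_difference (R : realType) (V : normedModType R) (f : V -> R)
    (x X Y : V) (d h : R) :
  0 < h -> h * (`|X| + `|Y|) < d ->
  (forall z, ball x d z -> differentiable f z) ->
  (forall z, ball x d z -> differentiable ('D_X f) z) ->
  exists2 z, ball x d z &
    f (x + h *: X + h *: Y) - f (x + h *: X) - (f (x + h *: Y) - f x)
    = h ^+ 2 * 'D_Y ('D_X f) z.
Proof.
move=> h0 hd df ddf.
have inb s t : 0 <= s <= h -> 0 <= t <= h -> ball x d (x + s *: X + t *: Y).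
  move=> /andP[s0 sh] /andP[t0 th]; rewrite -ball_normE /ball_ /=.
  rewrite -addrA opprD addrA subrr sub0r normrN (le_lt_trans (ler_normD _ _))//.
  apply: le_lt_trans hd; rewrite !normrZ !ger0_norm// mulrDr.
  by rewrite lerD// ler_wpM2r.
have hh : 0 <= h <= h by rewrite ltW/=.
have oh : (0 : R) <= 0 <= h by rewrite lexx ltW.
have din (s : R) : s \in `]0, h[ -> 0 <= s <= h.
  by rewrite in_itv/= => /andP[a b]; rewrite !ltW.
pose g (s : R) := f (x + s *: X + h *: Y) - f (x + s *: X).
have dg (s : R) : 0 <= s <= h -> is_derive s 1 g
    ('D_X f (x + s *: X + h *: Y) - 'D_X f (x + s *: X)).
  move=> sh; have E r : x + r *: X + h *: Y = x + h *: Y + r *: X by rewrite addrAC.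
  have L1 : is_derive s 1 (fun r : R => f (x + h *: Y + r *: X))
      ('D_X f (x + h *: Y + s *: X)).
    by apply: differentiable_line; apply: df; rewrite -E; exact: inb.
  have L2 : is_derive s 1 (fun r : R => f (x + r *: X)) ('D_X f (x + s *: X)).
    apply: differentiable_line; apply: df.
    by have := inb s 0 sh oh; rewrite scale0r addr0.
  have -> : g = fun r => f (x + h *: Y + r *: X) + - f (x + r *: X).
    by apply/funext => r; rewrite /g E.
  by rewrite E; exact: is_derive_add L1 (is_derive_opp L2).
have [s sh gE] : exists2 s, s \in `]0, h[ & g h - g 0 =
   ('D_X f (x + s *: X + h *: Y) - 'D_X f (x + s *: X)) * (h - 0).
  apply: MVT => //; first by move=> s /din; exact: dg.
  apply: derivable_within_continuous => s; rewrite in_itv/= => sh.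
  by have [] := dg s sh.
pose k (t : R) := 'D_X f (x + s *: X + t *: Y).
have dk (t : R) : 0 <= t <= h ->
   is_derive t 1 k ('D_Y ('D_X f) (x + s *: X + t *: Y)).
  move=> th; apply: differentiable_line.
  by apply: ddf; apply: inb => //; exact: din.
have ck : {within `[0, h], continuous k}.
  apply: derivable_within_continuous => t; rewrite in_itv/= => th.
  by have [] := dk t th.
have [t th kE] := @MVT R k (fun t => 'D_Y ('D_X f) (x + s *: X + t *: Y)) 0 h h0
  (fun t th => dk t (din t th)) ck.
exists (x + s *: X + t *: Y); first by apply: inb; exact: din.
move: gE; rewrite /g !scale0r !addr0 => ->.
move: kE; rewrite /k !scale0r !addr0 !subr0 => ->.
by rewrite expr2; ring.
Qed.

Lemma normr_sub_two (R : realType) (a a' b b' r : R) :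
  `|a - a'| < r -> `|b - b'| < r -> b' = a' -> `|a - b| < r + r.
Proof.
move=> la lb bE; rewrite (_ : a - b = (a - a') - (b - b')); last by rewrite bE; ring.
by rewrite (le_lt_trans (ler_normB _ _))// ltrD.
Qed.

(** Symmetry of second derivatives: in both orders, the derivative at some point
    near x is the same second difference divided by h^2, and second derivatives
    are continuous. *)
Lemma derive_comm (R : realType) (V : normedModType R) (U : set V) (f : V -> R)
    (x X Y : V) : open U -> smooth_on U f -> U x ->
  'D_X ('D_Y f) x = 'D_Y ('D_X f) x.
Proof.
move=> oU sf Ux; apply/eqP; apply: contraT => /negPf ne.
set A := 'D_X ('D_Y f) in ne *; set B := 'D_Y ('D_X f) in ne *.
have sA : smooth_on U A by do 2!apply: smooth_derive.
have sB : smooth_on U B by do 2!apply: smooth_derive.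
have e0 : 0 < `|A x - B x| / 2 by rewrite divr_gt0// normr_gt0 subr_eq0 ne.
set e := _ / 2 in e0.
have cA : \forall z \near x, `|A x - A z| < e.
  by have /cvgrPdist_lt/(_ e e0) := smooth_continuous sA Ux.
have cB : \forall z \near x, `|B x - B z| < e.
  by have /cvgrPdist_lt/(_ e e0) := smooth_continuous sB Ux.
have nU : \forall z \near x, U z by exact: near_in_open Ux _.
have N : nbhs x [set z | (`|A x - A z| < e /\ `|B x - B z| < e) /\ U z].
  exact: filterI (filterI cA cB) nU.
have [d /= d0 dP] := (nbhs_ballP _ _).1 N.
(* A step h for which the parallelogram spanned by h X and h Y stays in the ball. *)
have XY0 : 0 < `|X| + `|Y| + 1 by rewrite ltr_wpDl// addr_ge0.
pose h := d / 2 / (`|X| + `|Y| + 1).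
have h0 : 0 < h by rewrite /h !divr_gt0.
have hd : h * (`|X| + `|Y|) < d.
  apply: (@le_lt_trans _ _ (h * (`|X| + `|Y| + 1))).
    by rewrite ler_wpM2l ?lerDl// ltW.
  have -> : h * (`|X| + `|Y| + 1) = d / 2 by rewrite /h divfK ?gt_eqF.
  by rewrite ltr_pdivrMr// ltr_pMr// ltr1n.
have df Z z : ball x d z -> differentiable ('D_Z f) z.
  by move=> /dP[_ Uz]; apply: smooth_differentiable Uz; exact: smooth_derive.
have df0 z : ball x d z -> differentiable f z.
  by move=> /dP[_ Uz]; exact: smooth_differentiable Uz.
have [z1 z1d E1] := second_difference h0 hd df0 (df X).
have hd' : h * (`|Y| + `|X|) < d by rewrite addrC.
have [z2 z2d E2] := second_difference h0 hd' df0 (df Y).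
have E : B z1 = A z2.
  have hn : h ^+ 2 != 0 by rewrite expf_neq0// gt_eqF.
  apply: (mulfI hn); rewrite -[LHS]E1 -[RHS]E2.
  rewrite (_ : x + h *: Y + h *: X = x + h *: X + h *: Y); last by rewrite addrAC.
  by ring.
have [[_ b1] _] := dP _ z1d; have [[a2 _] _] := dP _ z2d.
by have := normr_sub_two a2 b1 E; rewrite /e -splitr ltxx.
Qed.

(** * Powers at the zeros of their base *)

Section PowerAtZero.
Context {R : realType}.
Implicit Types (a b c t : R).

Lemma powR_le_of_exponent_ge a b c : 0 <= a <= 1 -> 0 <= b <= c -> a `^ c <= a `^ b.
Proof.
move=> /andP[a0 a1] /andP[b0 bc]; rewrite /powR; case: eqVneq => [_|an0].
  case: (eqVneq c 0) => [c0|_]; last by rewrite ler_nat.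
  by rewrite (_ : b = 0) ?eqxx//; apply/eqP; rewrite eq_le b0 -c0 bc.
by rewrite ler_expR; apply: ler_wnM2r => //; exact: ln_le0.
Qed.

Lemma powR_le1 a b : 0 <= a <= 1 -> 0 <= b -> a `^ b <= 1.
Proof. by move=> a01 b0; rewrite -(powRr0 a) powR_le_of_exponent_ge// lexx. Qed.

(** The inequality ln r <= r at r = 1 / sqrt a. *)
Lemma mul_ln_ge a : 0 < a -> - (2 * Num.sqrt a) <= a * ln a.
Proof.
move=> a0; have s0 : 0 < Num.sqrt a by rewrite sqrtr_gt0.
have lnE : ln a = - (2 * ln (Num.sqrt a)^-1).
  rewrite lnV ?posrE// mulrN opprK -[in LHS](sqr_sqrtr (ltW a0)) lnXn//.
  by rewrite mulr_natl.
have h : ln (Num.sqrt a)^-1 <= (Num.sqrt a)^-1 by rewrite ltW// ln_sublinear// invr_gt0.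
rewrite lnE mulrN lerN2.
have -> : 2 * Num.sqrt a = a * (2 * (Num.sqrt a)^-1).
  rewrite -[X in _ = X * _](sqr_sqrtr (ltW a0)).
  by move: s0; set r := Num.sqrt a => s0; field; rewrite gt_eqF.
by rewrite ler_pM2l// ler_pM2l.
Qed.

(** The power a ^ (K a) tends to 1 at 0, in a quantitative form: it is
    exp (K a ln a) >= 1 + K a ln a. *)
Lemma powR_near1 a b K : 0 < a <= 1 -> 0 <= K -> 0 <= b <= K * a ->
  1 - K * (2 * Num.sqrt a) <= a `^ b.
Proof.
move=> /andP[a0 a1] K0 /andP[b0 bK].
apply: (@le_trans _ _ (a `^ (K * a))); last first.
  by apply: powR_le_of_exponent_ge; [rewrite ltW|rewrite b0].
rewrite /powR gt_eqF//; apply: le_trans (expR_ge1Dx _).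
by rewrite lerD2l -mulrN -mulrA; apply: ler_wpM2l => //; exact: mul_ln_ge.
Qed.

Lemma is_derive_cvg (V W : normedModType R) (f : V -> W) x v (l : W) :
  (fun h : R => h^-1 *: (f (h *: v + x) - f x)) @ 0^' --> l -> is_derive x v f l.
Proof.
move=> fl; split; first by apply/cvg_ex; exists l.
exact: cvg_lim fl.
Qed.

Lemma is_derive_quotient (f : R -> R) (l : R) : f 0 = 0 ->
  is_derive (0 : R) 1 f l -> (fun t => t^-1 * f t) @ 0^' --> l.
Proof.
move=> f0 [df <-].
have E : (fun h : R => h^-1 *: ((f \o shift 0) (h *: (1 : R)) - f 0)) = fun t => t^-1 * f t.
  by apply/funext => h /=; rewrite addr0 [h *: 1]mulr1 f0 subr0.
by move: df; rewrite /derive /derivable E.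
Qed.

(** A power s ^ (q - 2) times a function u = O(s) has at a zero of s the
    derivative 0 ^ (q - 2) u': the power tends to 0 if q > 2 there; if q = 2 then
    q - 2 = O(t), and either u = o(t) or s is at least of order t, in which case
    the power tends to 1. *)
Lemma is_derive_powR_mul_at_zero (s q u : R -> R) (u' C : R) :
  s 0 = 0 -> s @ 0 --> (0 : R) -> (forall t, 0 <= s t) ->
  (\forall t \near 0, 2 <= q t) -> derivable q (0 : R) 1 ->
  0 < C -> (\forall t \near 0, `|u t| <= C * s t) ->
  is_derive (0 : R) 1 u u' ->
  is_derive (0 : R) 1 (fun t => s t `^ (q t - 2) * u t) (0 `^ (q 0 - 2) * u').
Proof.
move=> s0 cs sge q2 dq C0 us du.
have u0 : u 0 = 0.
  by apply/eqP; rewrite -normr_eq0 eq_le normr_ge0 andbT (le_trans (nbhs_singleton us))// s0 mulr0.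
have cq : {for 0, continuous q} by apply/differentiable_continuous/derivable1_diffP.
have cu := is_derive_quotient u0 du.
have s1 : \forall t \near 0, s t < 1.
  by near do apply/(le_lt_trans (ler_norm _)); have /cvgr0_norm_lt := cs; exact.
have s1' : \forall t \near 0^', s t < 1 by exact: cvg_within s1.
have us' : \forall t \near 0^', `|u t| <= C * s t by exact: cvg_within us.
have q2' : \forall t \near 0^', 2 <= q t by exact: cvg_within q2.
apply: is_derive_cvg.
have -> : (fun h : R => h^-1 *: (s (h *: 1 + 0) `^ (q (h *: 1 + 0) - 2) * u (h *: 1 + 0)
     - s 0 `^ (q 0 - 2) * u 0)) =
   fun t => s t `^ (q t - 2) * (t^-1 * u t).
  by apply/funext => h; rewrite addr0 [h *: 1]mulr1 u0 mulr0 subr0 [LHS]mulrCA.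
have q02 : 2 <= q 0 := nbhs_singleton q2.
case: (ltrgtP (q 0) 2) q02 => // q0 _; last first.
  rewrite q0 subrr powRr0.
  have [u'0|u'0] := eqVneq u' 0.
    rewrite u'0 mulr0; apply/cvgr0Pnorm_lt => e e0.
    have cu0 : \forall t \near 0^', `|t^-1 * u t| < e.
      by have := cu; rewrite u'0 => /cvgr0Pnorm_lt /(_ e e0).
    near=> t; have w01 : 0 <= s t `^ (q t - 2) <= 1.
      rewrite powR_ge0 powR_le1//; last by rewrite subr_ge0; near: t.
      by rewrite sge ltW//; near: t.
    have [w0 w1] := andP w01.
    apply: (@le_lt_trans _ _ `|t^-1 * u t|); last by near: t.
    by rewrite normrM ger0_norm// ler_piMl.
  apply: cvgM => //.
  have u'p : 0 < `|u'| by rewrite normr_gt0.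
  (* Near 0 one has |u'| |t| / 2 <= |u t| <= C (s t), hence c |t| <= s t. *)
  pose c := `|u'| / 2 / C.
  have c0 : 0 < c by rewrite /c !divr_gt0.
  have sc : \forall t \near 0^', c * `|t| <= s t.
    have hu : \forall t \near 0^', `|u' - t^-1 * u t| < `|u'| / 2.
      by have /cvgrPdist_lt := cu; apply; rewrite divr_gt0.
    near=> t; have tn0 : t != 0 by near: t; exact: nbhs_dnbhs_neq.
    have t0 : 0 < `|t| by rewrite normr_gt0.
    have h1 : `|u' - t^-1 * u t| < `|u'| / 2 by near: t.
    have h2 : `|u t| <= C * s t by near: t.
    have h3 : `|u'| / 2 <= `|t|^-1 * `|u t|.
      rewrite -normfV -normrM.
      have := ler_normD (u' - t^-1 * u t) (t^-1 * u t); rewrite subrK => h.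
      by move: h h1; lra.
    have h4 : `|u'| / 2 * `|t| <= `|u t| by rewrite -ler_pdivlMr// [leRHS]mulrC.
    by rewrite /c mulrAC ler_pdivrMr// (le_trans h4)// mulrC.
  have [K K0 qK] : exists2 K, 0 <= K & \forall t \near 0^', q t - 2 <= K * `|t|.
    exists (`|'D_1 q 0| + 1); first by rewrite addr_ge0.
    have dq2 : is_derive (0 : R) 1 (fun t => q t + - 2) ('D_1 q 0 + 0).
      by apply: is_derive_add; exact: derivableP.
    have q20 : q 0 + -2 = 0 by rewrite q0 subrr.
    have := is_derive_quotient q20 dq2; rewrite addr0 => /cvgrPdist_lt /(_ _ ltr01) cq2.
    near=> t; have tn0 : t != 0 by near: t; exact: nbhs_dnbhs_neq.
    have t0 : 0 < `|t| by rewrite normr_gt0.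
    rewrite (le_trans (ler_norm _))// -ler_pdivrMr// mulrC -normfV -normrM.
    have h1 : `|'D_1 q 0 - t^-1 * (q t - 2)| < 1 by near: t.
    have := ler_normB ('D_1 q 0) ('D_1 q 0 - t^-1 * (q t - 2)).
    by rewrite opprB addrC subrK => /le_trans; apply; rewrite lerD2l ltW.
  apply: (squeeze_cvgr (f := fun t => 1 - K / c * (2 * Num.sqrt (s t))) (h := cst 1)).
  - near=> t.
    have tn0 : t != 0 by near: t; exact: nbhs_dnbhs_neq.
    have t0 : 0 < c * `|t| by rewrite mulr_gt0// normr_gt0.
    have st1 : s t < 1 by near: t.
    have q2t : 0 <= q t - 2 by rewrite subr_ge0; near: t.
    have qKt : q t - 2 <= K * `|t| by near: t.
    have sct : c * `|t| <= s t by near: t.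
    apply/andP; split; last by apply: powR_le1 => //; rewrite sge ltW.
    apply: powR_near1; first by rewrite (lt_le_trans t0)// ltW.
      by rewrite divr_ge0// ltW.
    rewrite q2t (le_trans qKt)// -mulrA ler_wpM2l//.
    by rewrite mulrC ler_pdivlMr// mulrC.
  - have cs' : s @ 0^' --> (0 : R) by apply: cvg_trans cs; apply: cvg_app; exact: nbhs_dnbhs.
    have : (fun t => 1 - K / c * (2 * Num.sqrt (s t))) @ 0^' -->
      1 - K / c * (2 * Num.sqrt (0 : R)).
      apply: cvgB; first exact: cvg_cst.
      apply: cvgM; first exact: cvg_cst.
      apply: cvgM; first exact: cvg_cst.
      by apply: continuous_cvg => //; exact: sqrt_continuous.
    by rewrite sqrtr0 !mulr0 subr0.
  - exact: cvg_cst.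
have q0p : 0 < (q 0 - 2) / 2 by rewrite divr_gt0// subr_gt0.
rewrite powR0 ?gt_eqF ?subr_gt0//.
suff w0 : (fun t => s t `^ (q t - 2)) @ 0^' --> (0 : R) by apply: cvgM.
apply/cvgr0Pnorm_lt => e e0.
(* Near 0 the exponents stay above b, and s ^ b < e as soon as s < e ^ (1 / b). *)
pose b := (q 0 - 2) / 2.
have qb0 : \forall t \near 0, b <= q t - 2.
  near=> t.
  have h : `|q 0 - q t| < b by near: t; move/cvgrPdist_lt: cq => /(_ b q0p).
  by move: h (ler_norm (q 0 - q t)); rewrite /b; lra.
have qb : \forall t \near 0^', b <= q t - 2 by exact: cvg_within qb0.
have se0 : \forall t \near 0, s t < e `^ b^-1.
  have e1 : 0 < e `^ b^-1 by exact: powR_gt0.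
  by near do apply/(le_lt_trans (ler_norm _)); have /cvgr0_norm_lt := cs; exact.
have se : \forall t \near 0^', s t < e `^ b^-1 by exact: cvg_within se0.
near=> t.
have bt : b <= q t - 2 by near: t.
have st1 : s t < 1 by near: t.
have ste : s t < e `^ b^-1 by near: t.
rewrite ger0_norm ?powR_ge0// (@le_lt_trans _ _ (s t `^ b))//.
  by apply: powR_le_of_exponent_ge; [rewrite sge ltW|rewrite bt (ltW q0p)].
have -> : e = (e `^ b^-1) `^ b by rewrite -powRrM mulVf ?powRr1 ?ltW// gt_eqF.
by apply: gt0_ltr_powR => //; rewrite nnegrE ?powR_ge0.
Unshelve. all: by end_near. Qed.
End PowerAtZero.

(** * Forms and metric traces *)

Section Forms.
Context {R : realType} {m : nat}.
Implicit Types (A : 'M[R]_m) (X Y Z : 'rV[R]_m).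
Local Notation e_ := (delta_mx (0 : 'I_1)).

Lemma ipE A X Y : ip A X Y = \sum_a \sum_b X 0 a * A a b * Y 0 b.
Proof.
rewrite /ip mxE exchange_big; apply: eq_bigr => b _.
by rewrite !mxE mulr_suml.
Qed.

Lemma ip_addl A X Y Z : ip A (X + Y) Z = ip A X Z + ip A Y Z.
Proof. by rewrite /ip !mulmxDl mxE. Qed.
Lemma ip_addr A X Y Z : ip A X (Y + Z) = ip A X Y + ip A X Z.
Proof. by rewrite /ip linearD mulmxDr mxE. Qed.
Lemma ip_scalel A c X Z : ip A (c *: X) Z = c * ip A X Z.
Proof. by rewrite /ip -!scalemxAl mxE. Qed.
Lemma ip_scaler A c X Z : ip A X (c *: Z) = c * ip A X Z.
Proof. by rewrite /ip linearZ -scalemxAr mxE. Qed.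
Lemma ip_oppl A X Z : ip A (- X) Z = - ip A X Z.
Proof. by rewrite -scaleN1r ip_scalel mulN1r. Qed.
Lemma ip_oppr A X Z : ip A X (- Z) = - ip A X Z.
Proof. by rewrite -scaleN1r ip_scaler mulN1r. Qed.
Lemma ip_sumr A X (I : Type) (r : seq I) (P : pred I) (F : I -> 'rV[R]_m) :
  ip A X (\sum_(i <- r | P i) F i) = \sum_(i <- r | P i) ip A X (F i).
Proof. by rewrite /ip linear_sum mulmx_sumr summxE. Qed.
Lemma ip_suml A Y (I : Type) (r : seq I) (P : pred I) (F : I -> 'rV[R]_m) :
  ip A (\sum_(i <- r | P i) F i) Y = \sum_(i <- r | P i) ip A (F i) Y.
Proof. by rewrite /ip !mulmx_suml summxE. Qed.

Lemma ip_sym A X Y : A^T = A -> ip A X Y = ip A Y X.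
Proof.
move=> AT; rewrite !ipE exchange_big; apply: eq_bigr => a _; apply: eq_bigr => b _.
by rewrite -[in LHS]AT mxE; ring.
Qed.

Lemma ip_delta A a b : ip A (e_ a) (e_ b) = A a b.
Proof. by rewrite /ip -rowE trmx_delta -colE !mxE. Qed.

Lemma ip_nondegenerate A X : A \in unitmx -> (forall Z, ip A X Z = 0) -> X = 0.
Proof.
move=> uA h; rewrite -[X](mulmxK uA); suff -> : X *m A = 0 by rewrite mul0mx.
by apply/rowP => b; rewrite [RHS]mxE -(h (e_ b)) /ip trmx_delta -colE [RHS]mxE.
Qed.

(** Bilinearity as the expansion in coordinates, the form in which the metric
    trace uses it. *)
Definition bilinear_form (B : 'rV[R]_m -> 'rV[R]_m -> R) :=
  forall X Y, B X Y = \sum_a \sum_b X 0 a * Y 0 b * B (e_ a) (e_ b).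

Lemma trace_gE (G : 'rV[R]_m -> 'M[R]_m) y (B : 'rV[R]_m -> 'rV[R]_m -> R) :
  trace_g G y (W := R^o) B = \tr (invmx (G y) *m (\matrix_(a, b) B (e_ a) (e_ b))^T).
Proof.
rewrite /trace_g /mxtrace; apply: eq_bigr => a _; rewrite mxE.
by apply: eq_bigr => b _; rewrite !mxE.
Qed.

Lemma mulmx_left_inverse A (B : 'M[R]_m) : B *m A = 1%:M -> invmx A = B.
Proof.
move=> BA; have [_ uA] := mulmx1_unit BA.
by rewrite -[LHS]mul1mx -BA mulmxK.
Qed.

(** The metric trace of a bilinear form does not depend on the coordinates: J
    turns the matrices of the metric and of the form into congruent ones, and
    the trace of G^-1 B is then preserved. *)
Lemma trace_g_change (G G' : 'rV[R]_m -> 'M[R]_m) y y' (J : 'M[R]_m) B B' :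
  G y \in unitmx -> (forall X Y, ip (G y) X Y = ip (G' y') (X *m J) (Y *m J)) ->
  bilinear_form B' -> (forall X Y, B X Y = B' (X *m J) (Y *m J)) ->
  trace_g G y (W := R^o) B = trace_g G' y' (W := R^o) B'.
Proof.
move=> uG GJ bB' BJ; rewrite !trace_gE.
have EG : G y = J *m G' y' *m J^T.
  apply/matrixP => a b; rewrite -ip_delta GJ /ip trmx_mul trmx_delta !mulmxA.
  by rewrite -colE [LHS]mxE -!mulmxA -rowE [LHS]mxE.
have uJ : J \in unitmx.
  by move: uG; rewrite EG !unitmx_mul => /andP[/andP[]].
have uG' : G' y' \in unitmx.
  by move: uG; rewrite EG !unitmx_mul => /andP[/andP[]].
set N := \matrix_(a, b) B' (e_ a) (e_ b).
have EB : \matrix_(a, b) B (e_ a) (e_ b) = J *m N *m J^T.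
  apply/matrixP => a b; rewrite mxE BJ bB' -!rowE.
  rewrite mxE exchange_big; apply: eq_bigr => d _; rewrite !mxE mulr_suml.
  by apply: eq_bigr => c _; rewrite !mxE; ring.
have -> : invmx (G y) = (invmx J)^T *m invmx (G' y') *m invmx J.
  apply: mulmx_left_inverse; rewrite EG !mulmxA -(mulmxA _ (invmx J)) mulVmx// mulmx1.
  by rewrite -(mulmxA _ (invmx _)) mulVmx// mulmx1 -trmx_mul mulmxV// trmx1.
rewrite EB !trmx_mul trmxK !mulmxA -(mulmxA _ (invmx J)) mulVmx// mulmx1.
by rewrite mxtrace_mulC !mulmxA -trmx_mul mulVmx// trmx1 mul1mx.
Qed.

Lemma eq_trace_g (W : lmodType R) (G : 'rV[R]_m -> 'M[R]_m) y
    (B B' : 'rV[R]_m -> 'rV[R]_m -> W) :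
  (forall X Y, B X Y = B' X Y) -> trace_g G y B = trace_g G y B'.
Proof.
move=> BB; apply: eq_bigr => a _; apply: eq_bigr => b _; by rewrite BB.
Qed.

Lemma trace_g_sum (G : 'rV[R]_m -> 'M[R]_m) y (I : finType) (k : I -> R)
    (B : I -> 'rV[R]_m -> 'rV[R]_m -> R) :
  \sum_i k i * trace_g G y (W := R^o) (B i) =
  trace_g G y (W := R^o) (fun X Y => \sum_i k i * B i X Y).
Proof.
rewrite /trace_g; under eq_bigr do rewrite mulr_sumr.
rewrite exchange_big; apply: eq_bigr => a _ /=.
under eq_bigr do rewrite mulr_sumr.
rewrite exchange_big; apply: eq_bigr => b _ /=; rewrite [RHS]mulr_sumr.
by apply: eq_bigr => i _; rewrite [LHS]mulrCA.
Qed.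

Lemma trace_gD (G : 'rV[R]_m -> 'M[R]_m) y (B C : 'rV[R]_m -> 'rV[R]_m -> R) :
  trace_g G y (W := R^o) (fun X Y => B X Y + C X Y) =
  trace_g G y (W := R^o) B + trace_g G y (W := R^o) C.
Proof.
rewrite /trace_g -big_split; apply: eq_bigr => a _ /=.
by rewrite -big_split; apply: eq_bigr => b _ /=; rewrite scalerDr.
Qed.

Lemma trace_gZ (G : 'rV[R]_m -> 'M[R]_m) y (k : R) (B : 'rV[R]_m -> 'rV[R]_m -> R) :
  trace_g G y (W := R^o) (fun X Y => k * B X Y) = k * trace_g G y (W := R^o) B.
Proof.
rewrite /trace_g mulr_sumr; apply: eq_bigr => a _; rewrite mulr_sumr.
by apply: eq_bigr => b _; rewrite [LHS]mulrCA.
Qed.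

Lemma ip_trace_g n (H : 'M[R]_n) (w : 'rV[R]_n) (G : 'rV[R]_m -> 'M[R]_m) y
    (B : 'rV[R]_m -> 'rV[R]_m -> 'rV[R]_n) :
  ip H w (trace_g G y B) = trace_g G y (W := R^o) (fun X Y => ip H w (B X Y)).
Proof.
rewrite /trace_g /ip linear_sum mulmx_sumr summxE; apply: eq_bigr => a _.
rewrite linear_sum mulmx_sumr summxE; apply: eq_bigr => b _.
by rewrite linearZ -scalemxAr mxE.
Qed.

End Forms.

(** * Inner products and the Koszul formula *)

Section InnerProducts.
Context {R : realType} {m : nat}.
Implicit Types (A : 'M[R]_m) (X Y : 'rV[R]_m).

Definition posdef A := forall X, X != 0 -> 0 < ip A X X.

Lemma posdef_unit A : posdef A -> A \in unitmx.
Proof.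
move=> pA; rewrite -row_free_unit -kermx_eq0; apply: contraT => /rowV0Pn[X XA X0].
have := pA X X0; move/sub_kermxP : XA => XA.
by rewrite /ip XA mul0mx mxE ltxx.
Qed.

Lemma posdef_ge0 A X : posdef A -> 0 <= ip A X X.
Proof.
move=> pA; have [->|/pA/ltW//] := eqVneq X 0.
by rewrite /ip !mul0mx mxE.
Qed.

Lemma ip_cauchy_schwarz A X Y : A^T = A -> posdef A ->
  (ip A X Y) ^+ 2 <= ip A X X * ip A Y Y.
Proof.
move=> sA pA; have [->|Y0] := eqVneq Y 0.
  by rewrite /ip trmx0 !mulmx0 !mxE expr0n mulr0.
have y0 := pA Y Y0; rewrite -subr_ge0 -(pmulr_rge0 _ y0).
(* The vector is <Y, Y> times the component of X orthogonal to Y. *)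
have := posdef_ge0 (ip A Y Y *: X - ip A X Y *: Y) pA.
rewrite ip_addl !ip_addr !(ip_oppl, ip_oppr, ip_scalel, ip_scaler) [ip A Y X]ip_sym//.
by congr (0 <= _); ring.
Qed.

Lemma is_derive_ip (V : normedModType R) (M : V -> 'M[R]_m) (P Q : V -> 'rV[R]_m)
    x v (M' : 'M[R]_m) (P' Q' : 'rV[R]_m) :
  is_derive x v M M' -> is_derive x v P P' -> is_derive x v Q Q' ->
  is_derive x v (fun z => ip (M z) (P z) (Q z))
    (ip M' (P x) (Q x) + ip (M x) P' (Q x) + ip (M x) (P x) Q').
Proof.
move=> dM dP dQ.
have -> : (fun z => ip (M z) (P z) (Q z)) =
    fun z => \sum_a \sum_b P z 0 a * M z a b * Q z 0 b.
  by apply/funext => z; rewrite ipE.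
have -> : ip M' (P x) (Q x) + ip (M x) P' (Q x) + ip (M x) (P x) Q' =
  \sum_a \sum_b ((P' 0 a * M x a b + P x 0 a * M' a b) * Q x 0 b
                 + P x 0 a * M x a b * Q' 0 b).
  rewrite !ipE -!big_split; apply: eq_bigr => a _ /=.
  by rewrite -!big_split; apply: eq_bigr => b _ /=; ring.
apply: is_derive_bigsum => a _; apply: is_derive_bigsum => b _.
by apply: is_derive_mul; [apply: is_derive_mul|]; exact: is_derive_entry.
Qed.

End InnerProducts.

Section Christoffel.
Context {R : realType} {m : nat} (G : 'rV[R]_m -> 'M[R]_m).
Implicit Types (X Y Z y : 'rV[R]_m).
Local Notation e_ := (delta_mx (0 : 'I_1)).

Lemma derive_ip_cst y X Y Z : differentiable G y ->
  'D_X (fun z => ip (G z) Y Z) y = ip ('D_X G y) Y Z.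
Proof.
move=> dG; apply: is_deriveE.
have := is_derive_ip (differentiable_is_derive X dG) (is_derive_cst Y y X) (is_derive_cst Z y X).
move=> h; apply: (is_derive_eq h); rewrite /= [X in _ + X + _](_ : _ = 0);
  last by rewrite /ip !mul0mx mxE.
by rewrite addr0 [X in _ + X](_ : _ = 0) ?addr0// /ip trmx0 mulmx0 mxE.
Qed.

(** Lowering the index cancels the inverse matrix in the definition, and leaves
    the Koszul formula. *)
Lemma ip_christoffel y X Y Z : differentiable G y -> G y \in unitmx ->
  ip (G y) (christoffel G y X Y) Z =
  2^-1 * (ip ('D_X G y) Y Z + ip ('D_Y G y) X Z - ip ('D_Z G y) X Y).
Proof.
move=> dG uG; rewrite {1}/ip /christoffel mulmxKV//.
have ipZ A T : ip A T Z = \sum_a Z 0 a * ip A T (e_ a).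
  rewrite [Z in LHS]row_sum_delta ip_sumr; apply: eq_bigr => a _.
  by rewrite ip_scaler.
have DZ : ip ('D_Z G y) X Y = \sum_a Z 0 a * ip ('D_(e_ a) G y) X Y.
  rewrite differentiable_derive_sum// /ip mulmx_sumr mulmx_suml summxE.
  by apply: eq_bigr => a _; rewrite -scalemxAr -scalemxAl mxE.
rewrite ipZ [ip _ X Z]ipZ DZ mxE -big_split -sumrB mulr_sumr.
by apply: eq_bigr => a _ /=; rewrite !mxE !derive_ip_cst//; ring.
Qed.

End Christoffel.

(** Coordinate expansion of the Koszul formula, with scalars in place of the
    derivatives of the metric. *)
Lemma koszul_sum (R : realType) m (A B C : R) (x a b d : 'I_m -> 'I_m -> R) :
  A = \sum_i \sum_j x i j * a i j -> B = \sum_i \sum_j x i j * b i j ->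
  C = \sum_i \sum_j x i j * d i j ->
  2^-1 * (A + B - C) -
    \sum_i \sum_j x i j * (2^-1 * (a i j + b i j - d i j)) = 0.
Proof.
move=> -> -> ->; rewrite -big_split -sumrB mulr_sumr -sumrB big1// => i _.
rewrite -big_split -sumrB mulr_sumr -sumrB big1// => j _ /=.
by ring.
Qed.

Section RiemannianChart.
Context {R : realType} {m : nat}.
Variables (U : set 'rV[R]_m) (G : 'rV[R]_m -> 'M[R]_m).
Hypotheses (oU : open U) (sG : smooth_on U G).
Hypotheses (symG : forall y, U y -> (G y)^T = G y).
Hypotheses (posG : forall y, U y -> posdef (G y)).
Implicit Types (X Y Z y : 'rV[R]_m) (a b u : 'rV[R]_m -> R).
Local Notation e_ := (delta_mx (0 : 'I_1)).

Definition grad_ip a b y : R := trace_g G y (W := R^o) (fun X Y => 'D_X a y * 'D_Y b y).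

Definition laplacian u y : R :=
  trace_g G y (W := R^o) (fun X Y => 'D_X ('D_Y u) y - 'D_(christoffel G y X Y) u y).

Let uG y : U y -> G y \in unitmx.
Proof. by move=> Uy; exact: posdef_unit (posG Uy). Qed.

Let dG y : U y -> differentiable G y.
Proof. by move=> Uy; exact: smooth_differentiable sG Uy. Qed.

Lemma derive_bilinear y u X Y : smooth_on U u -> U y ->
  'D_X ('D_Y u) y = \sum_a \sum_b X 0 a * Y 0 b * 'D_(e_ a) ('D_(e_ b) u) y.
Proof.
move=> su Uy; have sY := smooth_derive Y su.
rewrite (differentiable_derive_coord X (smooth_differentiable sY Uy)).
apply: eq_bigr => a _.
have E z : U z -> 'D_Y u z = \sum_b Y 0 b * 'D_(e_ b) u z.
  by move=> Uz; apply: differentiable_derive_coord; exact: smooth_differentiable su Uz.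
rewrite (derive_eq_in oU _ E Uy) -[RHS](_ : X 0 a * \sum_b Y 0 b * 'D_(e_ a) ('D_(e_ b) u) y = _).
  congr (_ * _); apply: is_deriveE; apply: is_derive_bigsum => b _.
  have h := is_derive_mul (is_derive_cst (Y 0 b) y (e_ a))
    (smooth_is_derive (e_ a) (smooth_derive (e_ b) su) Uy).
  by apply: (is_derive_eq h); rewrite mul0r add0r.
by rewrite mulr_sumr; apply: eq_bigr => b _; rewrite mulrA.
Qed.

(** The right-hand side of the Koszul formula is bilinear, and the metric is
    nondegenerate. *)
Lemma christoffel_bilinear y X Y : U y -> christoffel G y X Y =
  \sum_a \sum_b (X 0 a * Y 0 b) *: christoffel G y (e_ a) (e_ b).
Proof.
move=> Uy; apply/subr0_eq; apply: (ip_nondegenerate (uG Uy)) => Z.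
rewrite ip_addl ip_oppl (ip_christoffel _ _ _ (dG Uy) (uG Uy)).
have -> : ip (G y) (\sum_a \sum_b (X 0 a * Y 0 b) *: christoffel G y (e_ a) (e_ b)) Z =
  \sum_a \sum_b X 0 a * Y 0 b * (2^-1 * (ip ('D_(e_ a) G y) (e_ b) Z
     + ip ('D_(e_ b) G y) (e_ a) Z - ip ('D_Z G y) (e_ a) (e_ b))).
  rewrite ip_suml; apply: eq_bigr => a _; rewrite ip_suml; apply: eq_bigr => b _.
  by rewrite ip_scalel (ip_christoffel _ _ _ (dG Uy) (uG Uy)).
have DX T T' : ip ('D_T G y) T' Z =
   \sum_a \sum_b T 0 a * T' 0 b * ip ('D_(e_ a) G y) (e_ b) Z.
  rewrite (differentiable_derive_sum _ (dG Uy)) {1}/ip mulmx_sumr mulmx_suml summxE.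
  apply: eq_bigr => a _; rewrite -scalemxAr -scalemxAl mxE -[X in _ * X]/(ip _ _ _).
  rewrite {1}[T']row_sum_delta ip_suml mulr_sumr; apply: eq_bigr => b _.
  by rewrite ip_scalel mulrA.
have DZ : ip ('D_Z G y) X Y = \sum_a \sum_b X 0 a * Y 0 b * ip ('D_Z G y) (e_ a) (e_ b).
  rewrite ipE; apply: eq_bigr => a _; apply: eq_bigr => b _.
  by rewrite ip_delta mulrAC.
have DYX : ip ('D_Y G y) X Z =
   \sum_a \sum_b X 0 a * Y 0 b * ip ('D_(e_ b) G y) (e_ a) Z.
  have h := DX Y X; rewrite exchange_big /= in h; apply: (etrans h).
  by apply: eq_bigr => a _; apply: eq_bigr => b _; congr (_ * _); exact: mulrC.
exact: (koszul_sum (DX X Y) DYX DZ).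
Qed.

Lemma hessian_bilinear y u : smooth_on U u -> U y ->
  bilinear_form (fun X Y => 'D_X ('D_Y u) y - 'D_(christoffel G y X Y) u y).
Proof.
move=> su Uy X Y; rewrite derive_bilinear// christoffel_bilinear//.
have du := smooth_differentiable su Uy.
rewrite (differentiable_derive_coord _ du).
transitivity (\sum_a \sum_b (X 0 a * Y 0 b * 'D_(e_ a) ('D_(e_ b) u) y) -
   \sum_a \sum_b (X 0 a * Y 0 b * 'D_(christoffel G y (e_ a) (e_ b)) u y)); last first.
  rewrite -sumrB; apply: eq_bigr => a _; rewrite -sumrB; apply: eq_bigr => b _.
  by rewrite mulrBr.
congr (_ - _).
under eq_bigr => c _.
  rewrite summxE mulr_suml; under eq_bigr => a _.
    rewrite summxE mulr_suml; over.
  over.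
rewrite exchange_big; apply: eq_bigr => a _; rewrite exchange_big; apply: eq_bigr => b _.
rewrite (differentiable_derive_coord _ du) mulr_sumr; apply: eq_bigr => c _.
by rewrite mxE mulrA.
Qed.

Lemma grad_ip_bilinear y a b : differentiable a y -> differentiable b y ->
  bilinear_form (fun X Y => 'D_X a y * 'D_Y b y).
Proof.
move=> da db X Y; rewrite (differentiable_derive_coord X da).
rewrite (differentiable_derive_coord Y db) mulr_suml; apply: eq_bigr => i _.
by rewrite mulr_sumr; apply: eq_bigr => j _; ring.
Qed.

Let smooth_inv_metric i j : smooth_on U (fun y => invmx (G y) i j).
Proof. by apply: smooth_entry => //; apply: smooth_invmx. Qed.

Lemma smooth_grad_ip a b : smooth_on U a -> smooth_on U b -> smooth_on U (grad_ip a b).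
Proof.
move=> sa sb; apply: (smooth_sum oU) => i _; apply: (smooth_sum oU) => j _.
apply: (smooth_mul oU); first exact: smooth_inv_metric.
by apply: (smooth_mul oU); exact: smooth_derive.
Qed.

Lemma smooth_christoffel X Y : smooth_on U (fun y => christoffel G y X Y).
Proof.
apply: (smooth_mx oU) => i j.
have sip A B : smooth_on U (fun y => ip (G y) A B).
  apply: (smooth_eq_in oU (f := fun y => \sum_a \sum_b A 0 a * G y a b * B 0 b)).
    by move=> z _; rewrite ipE.
  apply: (smooth_sum oU) => k _; apply: (smooth_sum oU) => l _.
  apply: (smooth_mul oU); last exact: smooth_cst.
  by apply: (smooth_mul oU); [exact: smooth_cst|exact: smooth_entry].
pose K d y := 2^-1 * ('D_X (fun z => ip (G z) Y (e_ d)) y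
   + 'D_Y (fun z => ip (G z) X (e_ d)) y - 'D_(e_ d) (fun z => ip (G z) X Y) y).
apply: (smooth_eq_in oU (f := fun y => \sum_d K d y * invmx (G y) d j)).
  move=> z _; rewrite /christoffel mxE; apply: eq_bigr => d _.
  by rewrite mxE.
apply: (smooth_sum oU) => d _; apply: (smooth_mul oU); last exact: smooth_inv_metric.
apply: (smooth_mul oU); first exact: smooth_cst.
apply: (smooth_sub oU); last exact/smooth_derive/sip.
by apply: (smooth_add oU); exact/smooth_derive/sip.
Qed.

Lemma smooth_laplacian u : smooth_on U u -> smooth_on U (laplacian u).
Proof.
move=> su; apply: (smooth_sum oU) => i _; apply: (smooth_sum oU) => j _.
apply: (smooth_mul oU); first exact: smooth_inv_metric.
apply: (smooth_sub oU); first by do 2!apply: smooth_derive.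
apply: (smooth_eq_in oU (f := fun y => \sum_c (christoffel G y (e_ i) (e_ j)) 0 c * 'D_(e_ c) u y)).
  by move=> z Uz; rewrite -(differentiable_derive_coord _ (smooth_differentiable su Uz)).
apply: (smooth_sum oU) => c _; apply: (smooth_mul oU); last exact: smooth_derive.
by apply: smooth_entry => //; exact: smooth_christoffel.
Qed.

Definition gradient a y : 'rV[R]_m := (\row_c 'D_(e_ c) a y) *m invmx (G y).

Lemma ip_gradient a y X : differentiable a y -> U y ->
  ip (G y) (gradient a y) X = 'D_X a y.
Proof.
move=> da Uy; rewrite /ip mulmxKV ?uG// mxE (differentiable_derive_coord X da).
by apply: eq_bigr => c _; rewrite !mxE mulrC.
Qed.

Lemma grad_ipE a b y : differentiable a y -> differentiable b y -> U y ->
  grad_ip a b y = ip (G y) (gradient a y) (gradient b y).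
Proof.
move=> da db Uy; rewrite ip_gradient// (differentiable_derive_coord _ da); apply: eq_bigr => i _.
rewrite mxE mulr_suml; apply: eq_bigr => j _; rewrite mxE.
have -> : invmx (G y) j i = invmx (G y) i j.
  by rewrite -[in RHS](symG Uy) -trmx_inv mxE.
by rewrite -[LHS]/(_ * _); ring.
Qed.

Lemma grad_ip_ge0 a y : differentiable a y -> U y -> 0 <= grad_ip a a y.
Proof. by move=> da Uy; rewrite grad_ipE//; exact: posdef_ge0 (posG Uy). Qed.

(** Cauchy-Schwarz, for X and the gradient. *)
Lemma derive_le_grad_ip a y X : differentiable a y -> U y ->
  ('D_X a y) ^+ 2 <= grad_ip a a y * ip (G y) X X.
Proof.
move=> da Uy; rewrite -ip_gradient// grad_ipE//.
by apply: ip_cauchy_schwarz; [exact: symG|exact: posG].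
Qed.

Lemma grad_ip_eq0 a y X : differentiable a y -> U y -> grad_ip a a y = 0 -> 'D_X a y = 0.
Proof.
move=> da Uy a0; apply/eqP; rewrite -sqrf_eq0 eq_le sqr_ge0 andbT.
by rewrite (le_trans (derive_le_grad_ip _ da Uy))// a0 mul0r.
Qed.

End RiemannianChart.

(** The scalar identity behind [christoffel_change]: a, b, d stand for derivatives
    of the target metric, and r, s, t for the terms that contain second
    derivatives of the change of chart. *)
Lemma koszul_cancel (R : realType) (A B C a b d s t t' r : R) :
  A = a + s + t -> B = b + s + r -> C = d + t' + r -> t' = t ->
  2^-1 * (A + B - C) - (2^-1 * (a + b - d) + s) = 0.
Proof. by move=> -> -> -> ->; field. Qed.

Lemma sub_cancel (R : realType) (A B h g s : R) :
  A = s + h -> B = g + s -> A - B = h - g.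
Proof. by move=> -> ->; ring. Qed.

(** Change of chart: tau is an isometry from (U, G) to (U', G'). *)
Section ChangeOfChart.
Context {R : realType} {m : nat}.
Variables (U U' : set 'rV[R]_m) (G G' : 'rV[R]_m -> 'M[R]_m).
Variable tau : 'rV[R]_m -> 'rV[R]_m.
Hypotheses (oU : open U) (oU' : open U').
Hypotheses (sG : smooth_on U G) (sG' : smooth_on U' G').
Hypotheses (symG' : forall y, U' y -> (G' y)^T = G' y).
Hypotheses (posG : forall y, U y -> posdef (G y)).
Hypotheses (posG' : forall y, U' y -> posdef (G' y)).
Hypotheses (stau : smooth_on U tau) (tauU : forall y, U y -> U' (tau y)).
Hypothesis iso : forall y X Y, U y ->
  ip (G' (tau y)) ('D_X tau y) ('D_Y tau y) = ip (G y) X Y.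
Implicit Types (X Y Z y : 'rV[R]_m) (u : 'rV[R]_m -> R).
Local Notation e_ := (delta_mx (0 : 'I_1)).

Let dtau y : U y -> differentiable tau y.
Proof. by move=> Uy; exact: smooth_differentiable stau Uy. Qed.

Let J y : 'M[R]_m := jacobian tau y.

Let tauJ y X : U y -> 'D_X tau y = X *m J y.
Proof. by move=> Uy; rewrite deriveEjacobian//; exact: dtau. Qed.

Let ip_J y : U y -> forall X Y, ip (G y) X Y = ip (G' (tau y)) (X *m J y) (Y *m J y).
Proof. by move=> Uy X Y; rewrite -!tauJ// iso. Qed.

Let unitJ y : U y -> J y \in unitmx.
Proof.
move=> Uy; have := posdef_unit (posG Uy).
have -> : G y = J y *m G' (tau y) *m (J y)^T.
  apply/matrixP => a b; rewrite -ip_delta ip_J// /ip trmx_mul trmx_delta !mulmxA.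
  by rewrite -colE [LHS]mxE -!mulmxA -rowE [LHS]mxE.
by rewrite !unitmx_mul => /andP[/andP[]].
Qed.

Lemma derive_comm_mx y X Y : U y -> 'D_X ('D_Y tau) y = 'D_Y ('D_X tau) y.
Proof.
move=> Uy; apply/rowP => c.
have E A z : U z -> 'D_A tau z 0 c = 'D_A (fun z => tau z 0 c) z.
  by move=> Uz; apply/esym/is_deriveE/is_derive_entry/smooth_is_derive.
have E2 A B : ('D_A ('D_B tau) y) 0 c = 'D_A ('D_B (fun z => tau z 0 c)) y.
  rewrite -(derive_eq_in oU A (E B) Uy); apply/esym/is_deriveE/is_derive_entry.
  by apply: smooth_is_derive Uy; exact: smooth_derive.
apply: (etrans (E2 X Y)); apply: (etrans _ (esym (E2 Y X))).
by apply: derive_comm oU _ Uy; exact: smooth_entry.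
Qed.

(** Differentiating the isometry condition in the three directions of the Koszul
    formula, all second derivatives of tau cancel but D_X D_Y tau. *)
Lemma christoffel_change y X Y : U y ->
  'D_(christoffel G y X Y) tau y =
  christoffel G' (tau y) ('D_X tau y) ('D_Y tau y) + 'D_X ('D_Y tau) y.
Proof.
move=> Uy; apply/subr0_eq.
have uG' := posdef_unit (posG' (tauU Uy)).
have dG' := smooth_differentiable sG' (tauU Uy).
have dG := smooth_differentiable sG Uy.
apply: (ip_nondegenerate uG') => Z'.
have -> : Z' = 'D_(Z' *m invmx (J y)) tau y by rewrite tauJ// mulmxKV ?unitJ.
set Z := Z' *m _.
rewrite ip_addl ip_oppl ip_addl (iso _ _ Uy) (ip_christoffel _ _ _ dG (posdef_unit (posG Uy))).
rewrite (ip_christoffel _ _ _ dG' uG').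
have DG A B C : ip ('D_A G y) B C = ip ('D_('D_A tau y) G' (tau y)) ('D_B tau y) ('D_C tau y)
   + ip (G' (tau y)) ('D_A ('D_B tau) y) ('D_C tau y)
   + ip (G' (tau y)) ('D_B tau y) ('D_A ('D_C tau) y).
  rewrite -derive_ip_cst//.
  rewrite -(derive_eq_in oU A (f := fun z => ip (G' (tau z)) ('D_B tau z) ('D_C tau z)) _ Uy); last first.
    by move=> z Uz; exact: iso.
  apply: is_deriveE; apply: is_derive_ip.
  - exact: is_derive_chain (dtau Uy) dG'.
  - by apply: smooth_is_derive Uy; exact: smooth_derive.
  - by apply: smooth_is_derive Uy; exact: smooth_derive.
have DG' A B C S T : 'D_A ('D_B tau) y = S -> 'D_A ('D_C tau) y = T ->
    ip ('D_A G y) B C = ip ('D_('D_A tau y) G' (tau y)) ('D_B tau y) ('D_C tau y)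
   + ip (G' (tau y)) S ('D_C tau y) + ip (G' (tau y)) ('D_B tau y) T.
  by move=> <- <-; exact: DG.
exact: koszul_cancel (DG X Y Z) (DG' Y X Z _ _ (derive_comm_mx Y X Uy) erefl)
  (DG' Z X Y _ _ (derive_comm_mx Z X Uy) (derive_comm_mx Z Y Uy))
  (ip_sym _ _ (symG' (tauU Uy))).
Qed.

Variables (u u' v v' : 'rV[R]_m -> R).
Hypotheses (su' : smooth_on U' u') (sv' : smooth_on U' v').
Hypotheses (uE : forall y, U y -> u y = u' (tau y)).
Hypotheses (vE : forall y, U y -> v y = v' (tau y)).

Let derive_u y X : U y -> 'D_X u y = 'D_('D_X tau y) u' (tau y).
Proof.
move=> Uy; rewrite (derive_eq_in oU X uE Uy); apply: is_deriveE.
by apply: is_derive_chain; [exact: dtau|exact: smooth_differentiable su' (tauU Uy)].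
Qed.

Let derive_v y X : U y -> 'D_X v y = 'D_('D_X tau y) v' (tau y).
Proof.
move=> Uy; rewrite (derive_eq_in oU X vE Uy); apply: is_deriveE.
by apply: is_derive_chain; [exact: dtau|exact: smooth_differentiable sv' (tauU Uy)].
Qed.

Lemma grad_ip_change y : U y -> grad_ip G u v y = grad_ip G' u' v' (tau y).
Proof.
move=> Uy; apply: (trace_g_change (J := J y)).
- exact: posdef_unit (posG Uy).
- exact: ip_J.
- by apply: grad_ip_bilinear; apply: smooth_differentiable (tauU Uy).
- move=> X Y; rewrite -(tauJ X Uy) -(tauJ Y Uy).
  exact: (congr2 *%R (derive_u X Uy) (derive_v Y Uy)).
Qed.

(** The second derivatives of tau in the Hessian are those of [christoffel_change]. *)
Lemma laplacian_change y : U y -> laplacian G u y = laplacian G' u' (tau y).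
Proof.
move=> Uy; have U'y := tauU Uy; apply: (trace_g_change (J := J y)).
- exact: posdef_unit (posG Uy).
- exact: ip_J.
- exact: (hessian_bilinear oU' sG' posG' su' U'y).
move=> X Y; have du' := smooth_differentiable su' U'y.
have addD A B : 'D_(A + B) u' (tau y) = 'D_A u' (tau y) + 'D_B u' (tau y).
  by rewrite !deriveE// linearD.
have DG : 'D_(christoffel G y X Y) u y =
    'D_(christoffel G' (tau y) ('D_X tau y) ('D_Y tau y)) u' (tau y)
    + 'D_('D_X ('D_Y tau) y) u' (tau y).
  apply: (etrans (derive_u _ Uy)).
  exact: (etrans (congr1 (fun w => 'D_w u' (tau y)) (christoffel_change X Y Uy)) (addD _ _)).
have DD : 'D_X ('D_Y u) y = 'D_('D_X ('D_Y tau) y) u' (tau y)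
    + 'D_('D_X tau y) ('D_('D_Y tau y) u') (tau y).
  have E z : U z -> 'D_Y u z = \sum_c ('D_Y tau z) 0 c * 'D_(e_ c) u' (tau z).
    move=> Uz; apply: (etrans (derive_u Y Uz)); apply: differentiable_derive_coord.
    exact: smooth_differentiable su' (tauU Uz).
  have E' W z : U' z -> 'D_W u' z = \sum_c W 0 c * 'D_(e_ c) u' z.
    by move=> Uz; apply: differentiable_derive_coord; exact: smooth_differentiable su' Uz.
  have DW W T : 'D_T ('D_W u') (tau y) = \sum_c W 0 c * 'D_T ('D_(e_ c) u') (tau y).
    apply: (etrans (derive_eq_in oU' T (E' W) U'y)).
    apply/is_deriveE/is_derive_bigsum => c _.
    have h := is_derive_mul (is_derive_cst (W 0 c) (tau y) T)
      (smooth_is_derive T (smooth_derive (e_ c) su') U'y).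
    by apply: (is_derive_eq h); rewrite mul0r add0r.
  apply: (etrans (derive_eq_in oU X E Uy)); apply: is_deriveE.
  have -> : 'D_('D_X ('D_Y tau) y) u' (tau y)
      + 'D_('D_X tau y) ('D_('D_Y tau y) u') (tau y) =
    \sum_c (('D_X ('D_Y tau) y) 0 c * 'D_(e_ c) u' (tau y)
     + ('D_Y tau y) 0 c * 'D_('D_X tau y) ('D_(e_ c) u') (tau y)).
    by apply: etrans (esym (big_split _ _ _ _ _)); congr (_ + _); [exact: E'|exact: DW].
  apply: is_derive_bigsum => c _; apply: is_derive_mul.
    by apply: is_derive_entry; apply: smooth_is_derive Uy; exact: smooth_derive.
  apply: is_derive_chain; first exact: dtau.
  by apply: smooth_differentiable U'y; exact: smooth_derive.
move: DD DG; rewrite (tauJ X Uy) (tauJ Y Uy).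
exact: sub_cancel.
Qed.

End ChangeOfChart.

(** * The round metric in stereographic coordinates *)

Section Dot.
Context {R : realType} {n : nat}.
Implicit Types (X Y Z : 'rV[R]_n) (c : R).

Definition dot X Y : R := \sum_i X 0 i * Y 0 i.

Lemma dotC X Y : dot X Y = dot Y X.
Proof. by apply: eq_bigr => i _; rewrite mulrC. Qed.
Lemma dotDl X Y Z : dot (X + Y) Z = dot X Z + dot Y Z.
Proof. by rewrite -big_split; apply: eq_bigr => i _; rewrite mxE mulrDl. Qed.
Lemma dotZl c X Y : dot (c *: X) Y = c * dot X Y.
Proof. by rewrite mulr_sumr; apply: eq_bigr => i _; rewrite mxE mulrA. Qed.
Lemma dotDr X Y Z : dot X (Y + Z) = dot X Y + dot X Z.
Proof. by rewrite dotC dotDl !(dotC X). Qed.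
Lemma dotZr c X Y : dot X (c *: Y) = c * dot X Y.
Proof. by rewrite dotC dotZl dotC. Qed.
Lemma dotNl X Y : dot (- X) Y = - dot X Y.
Proof. by rewrite -scaleN1r dotZl mulN1r. Qed.
Lemma dotNr X Y : dot X (- Y) = - dot X Y.
Proof. by rewrite dotC dotNl dotC. Qed.
Lemma dot_ge0 X : 0 <= dot X X.
Proof. by apply: sumr_ge0 => i _; rewrite -expr2 sqr_ge0. Qed.
Lemma dot_delta X i : dot (delta_mx 0 i) X = X 0 i.
Proof.
rewrite /dot (bigD1 i)//= mxE !eqxx mul1r big1 ?addr0// => j ji.
by rewrite mxE (negbTE ji) andbF mul0r.
Qed.

Lemma ip_scalar c X Y : ip (c%:M) X Y = c * dot X Y.
Proof.
rewrite /ip mul_mx_scalar -scalemxAl !mxE; congr (_ * _).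
by apply: eq_bigr => i _; rewrite mxE.
Qed.

Lemma is_derive_dot (V : normedModType R) (P Q : V -> 'rV[R]_n) x v (P' Q' : 'rV[R]_n) :
  is_derive x v P P' -> is_derive x v Q Q' ->
  is_derive x v (fun z => dot (P z) (Q z)) (dot P' (Q x) + dot (P x) Q').
Proof.
move=> dP dQ; rewrite /dot -big_split; apply: is_derive_bigsum => i _.
by apply: is_derive_mul; exact: is_derive_entry.
Qed.

Lemma is_derive_scale (V : normedModType R) (c : V -> R) (P : V -> 'rV[R]_n)
    x v c' (P' : 'rV[R]_n) :
  is_derive x v c c' -> is_derive x v P P' ->
  is_derive x v (fun z => c z *: P z) (c' *: P x + c x *: P').
Proof.
move=> dc dP; apply: is_derive_mx => i j.
have h := is_derive_mul dc (is_derive_entry i j dP).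
have -> : (fun z => (c z *: P z) i j) = fun z => c z * P z i j.
  by apply/funext => z; rewrite mxE.
by apply: (is_derive_eq h); rewrite !mxE.
Qed.

End Dot.

Section StereographicMetric.
Context {R : realType} {n : nat}.
Implicit Types (X Y Z y : 'rV[R]_n) (b : bool).

(** The conformal factor of the stereographic chart: the round metric is conf^2
    times the Euclidean one. *)
Definition conf y : R := 2 / (1 + dot y y).

Lemma conf_denom y : 0 < 1 + dot y y.
Proof. by rewrite ltr_pwDl// dot_ge0. Qed.

Lemma conf_gt0 y : 0 < conf y.
Proof. by rewrite /conf divr_gt0// conf_denom. Qed.

Lemma conf_dot y : conf y * (1 + dot y y) = 2.
Proof. by rewrite /conf divfK// gt_eqF// conf_denom. Qed.

Lemma is_derive_conf y X : is_derive y X conf (- (conf y) ^+ 2 * dot y X).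
Proof.
have dyy := is_derive_add (is_derive_cst (1 : R) y X)
  (is_derive_dot (is_derive_id y X) (is_derive_id y X)).
have h := is_derive_mul (is_derive_cst (2 : R) y X)
  (is_derive_inv (f := fun z => 1 + dot z z) (lt0r_neq0 (conf_denom y)) dyy).
apply: (is_derive_eq h); rewrite /conf /= (dotC X y).
have := lt0r_neq0 (conf_denom y); move: (dot y X) (dot y y) => t r r0.
by field.
Qed.

Lemma stereo_fun0 b y : stereo_fun b y 0 ord0 = pole R b * (1 - conf y).
Proof.
rewrite mxE unlift_none (_ : \sum_k y 0 k ^+ 2 = dot y y).
  by have := lt0r_neq0 (conf_denom y); rewrite /conf; move: (dot y y) => r r0; field.
by apply: eq_bigr => k _; rewrite expr2.
Qed.

Lemma stereo_funS b y l : stereo_fun b y 0 (lift ord0 l) = conf y * y 0 l.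
Proof.
rewrite mxE liftK (_ : \sum_k y 0 k ^+ 2 = dot y y).
  by have := lt0r_neq0 (conf_denom y); rewrite /conf; move: (dot y y) => r r0; field.
by apply: eq_bigr => k _; rewrite expr2.
Qed.

Lemma is_derive_stereo0 b y X :
  is_derive y X (fun z => stereo_fun b z 0 ord0) (pole R b * (conf y ^+ 2 * dot y X)).
Proof.
have -> : (fun z => stereo_fun b z 0 ord0) = fun z => pole R b * (1 + - conf z).
  by apply/funext => z; exact: stereo_fun0.
have h := is_derive_mul (is_derive_cst (pole R b) y X)
  (is_derive_add (is_derive_cst (1 : R) y X) (is_derive_opp (is_derive_conf y X))).
by apply: (is_derive_eq h); rewrite /cst; ring.
Qed.

Lemma is_derive_stereoS b y X l :
  is_derive y X (fun z => stereo_fun b z 0 (lift ord0 l))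
    (conf y * X 0 l - conf y ^+ 2 * dot y X * y 0 l).
Proof.
have -> : (fun z => stereo_fun b z 0 (lift ord0 l)) = fun z => conf z * z 0 l.
  by apply/funext => z; exact: stereo_funS.
have h := is_derive_mul (is_derive_conf y X) (is_derive_entry 0 l (is_derive_id y X)).
by apply: (is_derive_eq h); ring.
Qed.

Lemma sqr_pole b : pole R b ^+ 2 = 1.
Proof. by case: b; rewrite /pole ?sqrrN expr1n. Qed.

Lemma sphere_metricE b : @metric R _ n (sphere_atlas R n) b = fun y => (conf y ^+ 2)%:M.
Proof.
apply/funext => y; apply/matrixP => i j; rewrite mxE.
have dS X c : 'D_X (stereo_fun b) y 0 c = 'D_X (fun z => stereo_fun b z 0 c) y.
  rewrite derive_mx ?mxE//; apply/derivable_mxP => i' c'; rewrite ord1.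
  case: (unliftP ord0 c') => [l|] ->; first by have [] := is_derive_stereoS b y X l.
  by have [] := is_derive_stereo0 b y X.
have D0 X : ('D_X (stereo_fun b) y) 0 ord0 = pole R b * (conf y ^+ 2 * dot y X).
  by rewrite dS; exact: is_deriveE (is_derive_stereo0 b y X).
have DS X l : ('D_X (stereo_fun b) y) 0 (lift ord0 l)
   = (conf y *: X - (conf y ^+ 2 * dot y X) *: y) 0 l.
  by rewrite dS (is_deriveE (is_derive_stereoS b y X l)) !mxE.
(* Only the components of the differential matter from here on. *)
suff alg (P : 'rV[R]_n -> 'rV[R]_n.+1) :
    (forall X, P X 0 ord0 = pole R b * (conf y ^+ 2 * dot y X)) ->
    (forall X l, P X 0 (lift ord0 l) = (conf y *: X - (conf y ^+ 2 * dot y X) *: y) 0 l) ->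
    \sum_k P (delta_mx 0 i) 0 k * P (delta_mx 0 j) 0 k = (conf y ^+ 2)%:M i j.
  exact: alg D0 DS.
clear => D0 DS; rewrite big_ord_recl !D0; under eq_bigr => l _ do rewrite !DS.
rewrite -/(dot _ _) !(dotDl, dotDr, dotNl, dotNr, dotZl, dotZr) !(dotC y) !dot_delta.
rewrite !mxE !eqxx /=.
have := conf_dot y; have := sqr_pole b.
move: (pole R b) (conf y) (dot y y) (y 0 i) (y 0 j) => p k r yi yj p2 kr.
have E : p * (k ^+ 2 * yi) * (p * (k ^+ 2 * yj)) = p ^+ 2 * (k ^+ 3 * yi * yj * (k * 1)).
  by ring.
rewrite E p2 -[k * 1](_ : 2 - k * r = _); last by rewrite -kr; ring.
by rewrite -[RHS]mulr_natr; ring.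
Qed.

Lemma ip_sphere b y X Y :
  ip (@metric R _ n (sphere_atlas R n) b y) X Y = conf y ^+ 2 * dot X Y.
Proof. by rewrite sphere_metricE ip_scalar. Qed.

Lemma sphere_metric_unit b y : @metric R _ n (sphere_atlas R n) b y \in unitmx.
Proof.
by rewrite sphere_metricE unitmxE det_scalar unitrX// unitrX// unitfE gt_eqF// conf_gt0.
Qed.

Lemma smooth_id (V : normedModType R) (U : set V) : open U -> smooth_on U (fun z : V => z).
Proof.
move=> oU; case=> [|k] /=; first by move=> x _; exact: cvg_id.
split=> [x _|v]; first by [].
by apply: (Ck_eq_in oU _ (Ck_cst U k v)) => z _; rewrite derive_id.
Qed.

Lemma smooth_dot (V : normedModType R) (U : set V) (P Q : V -> 'rV[R]_n) : open U ->
  smooth_on U P -> smooth_on U Q -> smooth_on U (fun z => dot (P z) (Q z)).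
Proof.
move=> oU sP sQ; apply: (smooth_sum oU) => i _.
by apply: (smooth_mul oU); exact: smooth_entry.
Qed.

Lemma smooth_conf (V : normedModType R) (U : set V) (f : V -> 'rV[R]_n) : open U ->
  smooth_on U f -> smooth_on U (fun z => conf (f z)).
Proof.
move=> oU sf; apply: (smooth_mul oU); first exact: smooth_cst.
apply: (smooth_inv oU); first by move=> x _; rewrite gt_eqF// conf_denom.
by apply: (smooth_add oU); [exact: smooth_cst|exact: smooth_dot].
Qed.

Lemma smooth_sphere_metric b :
  smooth_on setT (@metric R _ n (sphere_atlas R n) b).
Proof.
rewrite sphere_metricE; apply: (smooth_mx openT) => i j.
apply: (smooth_eq_in openT (f := fun z => conf z * conf z * (i == j)%:R)).
  by move=> z _; rewrite mxE mulr_natr expr2.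
have sc := smooth_conf openT (smooth_id openT).
apply: (smooth_mul openT); last exact: smooth_cst.
exact: (smooth_mul openT sc sc).
Qed.

(** The Christoffel symbols of the metric k^2 <X, Y>, where k is [conf]:
    X(ln k) Y + Y(ln k) X - <X, Y> grad ln k, with grad ln k = - k y. *)
Definition stereo_gamma y X Y : 'rV[R]_n :=
  conf y *: (dot X Y *: y - dot y X *: Y - dot y Y *: X).

Lemma sphere_christoffel b y X Y :
  christoffel (@metric R _ n (sphere_atlas R n) b) y X Y = stereo_gamma y X Y.
Proof.
set H := @metric R _ n (sphere_atlas R n) b.
have dH X' : is_derive y X' H ((- 2 * conf y ^+ 3 * dot y X')%:M).
  rewrite /H sphere_metricE; apply: is_derive_mx => i j.
  have h := is_derive_mul (is_derive_mul (is_derive_conf y X') (is_derive_conf y X'))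
    (is_derive_cst ((i == j)%:R : R) y X').
  have -> : (fun z : 'rV[R]_n => ((conf z ^+ 2)%:M : 'M[R]_n) i j) =
     fun z => conf z * conf z * (i == j)%:R.
    by apply/funext => z; rewrite mxE expr2 mulr_natr.
  by apply: (is_derive_eq h); rewrite !mxE /cst mulr0 addr0 -[in RHS]mulr_natr; ring.
have dfH : differentiable H y.
  by apply: (smooth_differentiable (U := setT)) => //; exact: smooth_sphere_metric.
apply/subr0_eq; apply: (ip_nondegenerate (sphere_metric_unit b y)) => Z.
rewrite ip_addl ip_oppl -/H (ip_christoffel _ _ _ dfH (sphere_metric_unit b y)).
rewrite !(is_deriveE (dH _)) /H ip_sphere !ip_scalar /stereo_gamma.
rewrite !(dotDl, dotDr, dotNl, dotNr, dotZl, dotZr).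
by field.
Qed.

Lemma stereo_gamma_derive y X Y Z :
  is_derive y X (fun z => stereo_gamma z Y Z)
    ((- (conf y) ^+ 2 * dot y X) *: (dot Y Z *: y - dot y Y *: Z - dot y Z *: Y)
     + conf y *: (dot Y Z *: X - dot X Y *: Z - dot X Z *: Y)).
Proof.
have dl (T S : 'rV[R]_n) : is_derive y X (fun z => - (dot z T *: S)) (- (dot X T *: S)).
  have h := is_derive_opp (is_derive_scale
    (is_derive_dot (is_derive_id y X) (is_derive_cst T y X)) (is_derive_cst S y X)).
  apply: (is_derive_eq h); rewrite /= scaler0 addr0.
  by rewrite [dot _ 0](_ : _ = 0) ?addr0// /dot big1// => i _; rewrite mxE mulr0.
have h := is_derive_scale (is_derive_conf y X) (is_derive_add (is_derive_add
  (is_derive_scale (is_derive_cst (dot Y Z) y X) (is_derive_id y X)) (dl Y Z)) (dl Z Y)).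
by apply: (is_derive_eq h); rewrite /= scale0r add0r.
Qed.

End StereographicMetric.

(** * Curvature and conformal gradient fields of the sphere *)

Section StereographicCurvature.
Context {R : realType} {n : nat}.
Implicit Types (X Y Z y : 'rV[R]_n) (b : bool).

Lemma dot_self_conf y : dot y y = 2 / conf y - 1.
Proof.
have k0 := lt0r_neq0 (conf_gt0 y).
by rewrite -(conf_dot y) mulrC mulKf// addrAC subrr add0r.
Qed.

Lemma dot0r (X : 'rV[R]_n) : dot X 0 = 0.
Proof. by rewrite /dot big1// => i _; rewrite mxE mulr0. Qed.

(** Constant curvature 1, as an identity between the Christoffel symbols and
    their derivatives. *)
Lemma stereo_gamma_curvature y X Y Z :
  ((- (conf y) ^+ 2 * dot y X) *: (dot Y Z *: y - dot y Y *: Z - dot y Z *: Y)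
     + conf y *: (dot Y Z *: X - dot X Y *: Z - dot X Z *: Y))
  + stereo_gamma y X (stereo_gamma y Y Z)
  - (((- (conf y) ^+ 2 * dot y Y) *: (dot X Z *: y - dot y X *: Z - dot y Z *: X)
     + conf y *: (dot X Z *: Y - dot Y X *: Z - dot Y Z *: X))
  + stereo_gamma y Y (stereo_gamma y X Z)) =
  conf y ^+ 2 *: (dot Y Z *: X - dot X Z *: Y).
Proof.
have k0 := lt0r_neq0 (conf_gt0 y).
apply/rowP => i; rewrite /stereo_gamma !(dotDl, dotDr, dotNl, dotNr, dotZl, dotZr) !mxE.
rewrite (dotC Y X) (dotC X y) (dotC Y y) dot_self_conf; move: k0.
move: (conf y) (dot y X) (dot y Y) (dot y Z) (dot X Y) (dot X Z) (dot Y Z)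
  (X 0 i) (Y 0 i) (Z 0 i) (y 0 i) => k a b c d e f x1 y1 z1 t k0.
by field.
Qed.

Lemma nabla_sphere_cst b Y Z :
  nabla (@metric R _ n (sphere_atlas R n) b) (cst Y) (cst Z) = fun y => stereo_gamma y Y Z.
Proof.
apply/funext => y; rewrite /nabla sphere_christoffel /cst.
by rewrite derive_cst add0r.
Qed.

Lemma sphere_curvature b y X Y Z :
  curvature (@metric R _ n (sphere_atlas R n) b) y X Y Z =
  conf y ^+ 2 *: (dot Y Z *: X - dot X Z *: Y).
Proof.
rewrite /curvature !nabla_sphere_cst -(stereo_gamma_curvature y X Y Z).
have -> : lie_bracket (cst X) (cst Y) = cst (0 : 'rV[R]_n).
  by apply/funext => z; rewrite /lie_bracket /cst !derive_cst subrr.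
rewrite nabla_sphere_cst.
have -> : stereo_gamma y 0 Z = 0.
  by rewrite /stereo_gamma (dotC 0) !dot0r !scale0r scaler0 !subr0 scaler0.
rewrite subr0 /nabla !sphere_christoffel /cst.
by rewrite (is_deriveE (stereo_gamma_derive y X Y Z)) (is_deriveE (stereo_gamma_derive y Y X Z)).
Qed.

(** The tangential part of a constant vector of the ambient space, read in the
    chart: [beta] is the component of the vector along the axis, multiplied by
    the sign of the pole, and [a] is the rest. *)
Definition conformal_field (beta : R) (a : 'rV[R]_n) y : 'rV[R]_n :=
  (beta - dot a y) *: y + ((1 + dot y y) / 2) *: a.

(** The inner product of that vector with the position on the sphere. *)
Definition height (beta : R) (a : 'rV[R]_n) y : R :=
  beta * (1 - conf y) + conf y * dot a y.

Section ConformalField.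
Variables (beta : R) (a : 'rV[R]_n).
Local Notation W := (conformal_field beta a).
Local Notation u := (height beta a).

Lemma is_derive_height y X : is_derive y X u (conf y ^+ 2 * dot (W y) X).
Proof.
have h := is_derive_add
  (is_derive_mul (is_derive_cst beta y X)
    (is_derive_add (is_derive_cst (1 : R) y X) (is_derive_opp (is_derive_conf y X))))
  (is_derive_mul (is_derive_conf y X) (is_derive_dot (is_derive_cst a y X) (is_derive_id y X))).
apply: (is_derive_eq h); rewrite /cst /conformal_field !(dotDl, dotZl) (dotC 0) dot0r.
rewrite dot_self_conf; have := lt0r_neq0 (conf_gt0 y).
move: (conf y) (dot y X) (dot a X) (dot a y) => k p q r k0.
by field.
Qed.

Lemma is_derive_conformal_field y X :
  is_derive y X W (- (dot a X) *: y + (beta - dot a y) *: X + dot y X *: a).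
Proof.
have d1 := is_derive_scale (is_derive_add (is_derive_cst beta y X)
  (is_derive_opp (is_derive_dot (is_derive_cst a y X) (is_derive_id y X)))) (is_derive_id y X).
have d2 := is_derive_scale (is_derive_mul (is_derive_add (is_derive_cst (1 : R) y X)
    (is_derive_dot (is_derive_id y X) (is_derive_id y X))) (is_derive_cst (2^-1 : R) y X))
  (is_derive_cst a y X).
apply: (is_derive_eq (is_derive_add d1 d2)); rewrite /cst /= (dotC 0) dot0r.
rewrite (dotC X y); apply/rowP => i; rewrite !mxE.
by field.
Qed.

(** The field is the gradient of the height, whose Hessian is - u times the metric. *)
Lemma nabla_conformal_field y X :
  (- (dot a X) *: y + (beta - dot a y) *: X + dot y X *: a) + stereo_gamma y X (W y)
  = - u y *: X.
Proof.
have k0 := lt0r_neq0 (conf_gt0 y).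
apply/rowP => i; rewrite /stereo_gamma /height /conformal_field !(dotDl, dotDr, dotZl, dotZr) !mxE.
rewrite (dotC X y) (dotC X a) (dotC y a) dot_self_conf.
move: k0; move: (conf y) (dot y X) (dot a X) (dot a y) (y 0 i) (X 0 i) (a 0 i) => k p q s t x1 a1 k0.
by field.
Qed.

(** Pythagoras: the normal part of the constant vector has length u. *)
Lemma norm_conformal_field y :
  conf y ^+ 2 * dot (W y) (W y) = beta ^+ 2 + dot a a - u y ^+ 2.
Proof.
have k0 := lt0r_neq0 (conf_gt0 y).
rewrite /height /conformal_field !(dotDl, dotDr, dotZl, dotZr) (dotC y a) dot_self_conf.
move: k0; move: (conf y) (dot a y) (dot a a) => k s t k0.
by field.
Qed.

End ConformalField.

(** Compatibility with the metric: - 2 conf <y, X> is the logarithmic derivative of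
    conf^2. *)
Lemma stereo_gamma_compat y X Y Z :
  dot (stereo_gamma y X Z) Y + dot Z (stereo_gamma y X Y) =
  - (2 * conf y * dot y X * dot Z Y).
Proof.
rewrite /stereo_gamma !(dotDl, dotDr, dotNl, dotNr, dotZl, dotZr).
rewrite (dotC Z y) (dotC Z X).
by ring.
Qed.

End StereographicCurvature.

(** * Tension of a map into the sphere *)

Section SmoothHeight.
Context {R : realType} {n : nat} {V : normedModType R} (U : set V) (oU : open U).
Variables (f : V -> 'rV[R]_n) (beta : R) (a : 'rV[R]_n).
Hypothesis sf : smooth_on U f.

Lemma smooth_height : smooth_on U (fun z => height beta a (f z)).
Proof.
have sc := smooth_conf oU sf.
apply: (smooth_add oU); apply: (smooth_mul oU) => //; try exact: smooth_cst.
  by apply: (smooth_sub oU) => //; exact: smooth_cst.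
by apply: (smooth_dot oU) => //; exact: smooth_cst.
Qed.

Lemma smooth_conformal_field : smooth_on U (fun z => conformal_field beta a (f z)).
Proof.
apply: (smooth_mx oU) => i j.
apply: (smooth_eq_in oU (f := fun z => (beta - dot a (f z)) * f z i j
   + (1 + dot (f z) (f z)) * 2^-1 * a i j)).
  by move=> z _; rewrite !mxE.
apply: (smooth_add oU); apply: (smooth_mul oU); try exact: smooth_cst.
- apply: (smooth_sub oU); first exact: smooth_cst.
  by apply: (smooth_dot oU) => //; exact: smooth_cst.
- exact: smooth_entry.
- apply: (smooth_mul oU); last exact: smooth_cst.
  by apply: (smooth_add oU); [exact: smooth_cst|exact: smooth_dot].
Qed.

End SmoothHeight.

(** The product rule in [hessian_height], where WQ comes from the derivative of
    the field, and G1 and G2 from the two Christoffel terms of metric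
    compatibility. *)
Lemma hessian_height_algebra (R : realType) (k yP wQ wD WQ PQ u G1 G2 : R) :
  WQ = - u * PQ - G1 -> G1 + G2 = - (2 * k * yP * wQ) ->
  k ^+ 2 * (wD + G2) = ((- k ^+ 2 * yP * k + k * (- k ^+ 2 * yP)) * wQ
    + k * k * (WQ + wD)) + u * (k ^+ 2 * PQ).
Proof.
move=> -> E; have -> : G2 = - (2 * k * yP * wQ) - G1 by rewrite -E; ring.
by ring.
Qed.

Lemma stereo_gammaZr (R : realType) n (y X Y : 'rV[R]_n) c :
  stereo_gamma y X (c *: Y) = c *: stereo_gamma y X Y.
Proof. by apply/rowP => i; rewrite /stereo_gamma !dotZr !mxE; ring. Qed.

Lemma trace_g_combination (R : realType) m (G : 'rV[R]_m -> 'M[R]_m) y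
    (A B C : 'rV[R]_m -> 'rV[R]_m -> R) (c v : R) :
  trace_g G y (W := R^o) A +
    c * (trace_g G y (W := R^o) B + v * trace_g G y (W := R^o) C) =
  trace_g G y (W := R^o) (fun X Y => A X Y + c * (B X Y + v * C X Y)).
Proof. by rewrite trace_gD trace_gZ trace_gD trace_gZ. Qed.

Lemma divergence_algebra (R : realType) n (w A B C D : 'rV[R]_n) (k c cX T1 T2 h v : R) :
  T1 = k * dot w A -> T2 = k * dot w D -> k * dot w (B + C) = h + v ->
  k * dot w (cX *: A + c *: B + c *: C - c *: D) = cX * T1 + c * (h - T2 + v).
Proof.
move=> -> -> E; rewrite dotDr in E; rewrite !(dotDr, dotNr, dotZr).
have -> : h - k * dot w D + v = k * (dot w B + dot w C) - k * dot w D by rewrite E; ring.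
by ring.
Qed.

Section MapToSphere.
Context {R : realType} {m n : nat}.
Variables (U : set 'rV[R]_m) (G : 'rV[R]_m -> 'M[R]_m) (b : bool).
Hypotheses (oU : open U).
Variables (f : 'rV[R]_m -> 'rV[R]_n) (beta : R) (a : 'rV[R]_n).
Hypothesis (sf : smooth_on U f).
Implicit Types (X Y y : 'rV[R]_m).
Local Notation H := (@metric R _ n (sphere_atlas R n) b).
Local Notation k := (fun z => conf (f z)).
Local Notation w := (fun z => conformal_field beta a (f z)).
Local Notation u := (fun z => height beta a (f z)).

Let df y : U y -> differentiable f y.
Proof. by move=> Uy; exact: smooth_differentiable sf Uy. Qed.

Lemma derive_height y X : U y ->
  'D_X u y = conf (f y) ^+ 2 * dot (w y) ('D_X f y).
Proof.
move=> Uy; apply: is_deriveE.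
have dh : differentiable (height beta a) (f y).
  apply: (smooth_differentiable (U := setT)) => //.
  by apply: (smooth_height openT); exact: smooth_id openT.
apply: (is_derive_eq (is_derive_chain X (df Uy) dh)).
exact: is_deriveE (is_derive_height beta a (f y) _).
Qed.

Lemma is_derive_conformal_field_comp y X : U y ->
  is_derive y X w (- u y *: 'D_X f y - stereo_gamma (f y) ('D_X f y) (w y)).
Proof.
move=> Uy.
have dW : differentiable (conformal_field beta a) (f y).
  apply: (smooth_differentiable (U := setT)) => //.
  by apply: (smooth_conformal_field openT); exact: smooth_id openT.
apply: (is_derive_eq (is_derive_chain X (df Uy) dW)).
rewrite (is_deriveE (is_derive_conformal_field beta a (f y) _)).
by rewrite -nabla_conformal_field addrK.
Qed.

Lemma nabla_pb_conformal_field y X : U y ->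
  nabla_pb H f w y X = - u y *: 'D_X f y.
Proof.
move=> Uy; rewrite /nabla_pb sphere_christoffel.
by rewrite (is_deriveE (is_derive_conformal_field_comp X Uy)) subrK.
Qed.

(** The Hessian of a composition is du applied to the second fundamental form of
    f, plus the Hessian of the height pulled back by f; the latter is - u times the
    pulled-back metric. *)
Lemma hessian_height y X Y : U y ->
  conf (f y) ^+ 2 * dot (w y) ('D_X ('D_Y f) y + stereo_gamma (f y) ('D_X f y) ('D_Y f y))
  = 'D_X ('D_Y u) y + u y * (conf (f y) ^+ 2 * dot ('D_X f y) ('D_Y f y)).
Proof.
move=> Uy.
have dk : is_derive y X k (- (conf (f y)) ^+ 2 * dot (f y) ('D_X f y)).
  have dc : differentiable (@conf R n) (f y).
    apply: (smooth_differentiable (U := setT)) => //.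
    by apply: (smooth_conf openT); exact: smooth_id openT.
  apply: (is_derive_eq (is_derive_chain X (df Uy) dc)).
  exact: is_deriveE (is_derive_conf (f y) _).
have E z : U z -> 'D_Y u z = conf (f z) * conf (f z) * dot (w z) ('D_Y f z).
  by move=> Uz; rewrite -expr2; exact: derive_height.
have dDf : is_derive y X ('D_Y f) ('D_X ('D_Y f) y).
  by apply: smooth_is_derive Uy; exact: smooth_derive.
have := is_derive_mul (is_derive_mul dk dk)
  (is_derive_dot (is_derive_conformal_field_comp X Uy) dDf).
move=> /is_deriveE h; rewrite (derive_eq_in oU X E Uy) h dotDr.
apply: hessian_height_algebra; last exact: stereo_gamma_compat.
by rewrite dotDl dotNl dotZl.
Qed.

Lemma hs_inner_differential y :
  hs_inner G H f (differential f) (differential f) y =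
  trace_g G y (W := R^o) (fun X Y => conf (f y) ^+ 2 * dot ('D_X f y) ('D_Y f y)).
Proof. by apply: eq_trace_g => X Y; rewrite ip_sphere. Qed.

(** Presents |df|^2 as a sum of squares, which shows its smoothness and its sign. *)
Lemma hs_inner_grad_ip y : U y ->
  hs_inner G H f (differential f) (differential f) y =
  \sum_i conf (f y) ^+ 2 * grad_ip G (fun z => f z 0 i) (fun z => f z 0 i) y.
Proof.
move=> Uy; rewrite hs_inner_differential trace_g_sum; apply: eq_trace_g => X Y.
rewrite -mulr_sumr; congr (_ * _); apply: eq_bigr => i _.
by congr (_ * _); apply/esym/is_deriveE/is_derive_entry/smooth_is_derive.
Qed.

(** As the field is the gradient of the height, its product with the divergence of
    c df is <dc, du> + c (Laplacian(u) + u |df|^2), by [hessian_height]. The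
    derivative is that of c df and not of c, which may fail to be differentiable
    where df vanishes. *)
Lemma ip_trace_nabla (c : 'rV[R]_m -> R) (cX : 'rV[R]_m -> R) y : U y ->
  (forall X Y, is_derive y X (fun z => c z *: 'D_Y f z)
     (cX X *: 'D_Y f y + c y *: 'D_X ('D_Y f) y)) ->
  ip (H (f y)) (w y) (trace_nabla G H f (fun z X => c z *: 'D_X f z) y) =
  trace_g G y (W := R^o) (fun X Y => cX X * 'D_Y u y)
  + c y * (laplacian G u y
           + u y * hs_inner G H f (differential f) (differential f) y).
Proof.
move=> Uy dc; rewrite /trace_nabla ip_trace_g hs_inner_differential.
apply: (etrans _ (esym (trace_g_combination _ _ _ _ _ _ _))).
apply: eq_trace_g => X Y; rewrite /nabla_pb sphere_christoffel (is_deriveE (dc X Y)).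
rewrite /nabla derive_cst add0r ip_sphere stereo_gammaZr.
exact: divergence_algebra (derive_height Y Uy) (derive_height _ Uy) (hessian_height X Y Uy).
Qed.

End MapToSphere.

(** * The energy density and its powers *)

Lemma is_derive_line0 (R : realType) (V W : normedModType R) (F : V -> W) (x v : V) (a : W) :
  is_derive (0 : R) 1 (fun t : R => F (x + t *: v)) a <-> is_derive x v F a.
Proof.
have E : x + (0 : R) *: v = x by rewrite scale0r addr0.
have := is_derive_line F x v 0 a; rewrite E => -[h1 h2].
by split.
Qed.

Lemma near_line (R : realType) (V : normedModType R) (x v : V) (P : V -> Prop) :
  (\forall z \near x, P z) -> \forall t \near (0 : R), P (x + t *: v).
Proof.
move=> nP; have cl : (fun t : R => x + t *: v) @ 0 --> x.
  rewrite -[X in _ --> X]addr0 -(scale0r v); apply: cvgD; first exact: cvg_cst.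
  by apply: cvgZr_tmp; exact: cvg_id.
exact: cl.
Qed.

Lemma is_derive_powR_sqrt (R : realType) (V : normedModType R) (S q : V -> R) x v (dS dq : R) :
  (\forall z \near x, 0 < S z) -> is_derive x v S dS -> is_derive x v q dq ->
  is_derive x v (fun z => Num.sqrt (S z) `^ (q z - 2))
    (Num.sqrt (S x) `^ (q x - 2) * (2^-1 * (dq * ln (S x) + (q x - 2) * (dS / S x)))).
Proof.
move=> nS hS hq; have S0 := nbhs_singleton nS.
have E (r e : R) : 0 < r -> Num.sqrt r `^ e = expR (e * (2^-1 * ln r)).
  move=> r0; rewrite /powR gt_eqF ?sqrtr_gt0//; congr (expR (_ * _)).
  by rewrite -powR12_sqrt ?ltW// ln_powR.
have near_E : \forall z \near x,
    expR ((q z + - 2) * (2^-1 * ln (S z))) = Num.sqrt (S z) `^ (q z - 2).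
  by apply: filterS nS => z Sz; rewrite E.
apply: near_eq_is_derive near_E _.
have dln := is_derive_outer (is_derive1_ln S0) hS.
have dexp := is_derive_outer (is_derive_expR _)
  (is_derive_mul (is_derive_add hq (is_derive_cst (- 2 : R) x v))
     (is_derive_mul (is_derive_cst (2^-1 : R) x v) dln)).
apply: (is_derive_eq dexp); rewrite /cst E//; congr (_ * _).
by field; rewrite gt_eqF.
Qed.

(** At S = 0 both sides vanish: the power 0 ^ (q - 2) is nonzero only if the factor
    q - 2 is zero. *)
Lemma powR_sqrt_shift (R : realType) (S q : R) : 0 <= S -> 2 <= q ->
  (q - 2) * Num.sqrt S `^ (q - 4) * S = (q - 2) * Num.sqrt S `^ (q - 2).
Proof.
move=> S0 q2; rewrite -mulrA; have [->|Sn0] := eqVneq S 0.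
  rewrite mulr0 sqrtr0; have [->|q2n] := eqVneq q 2; first by rewrite subrr !mul0r.
  by rewrite powR0 ?mulr0// subr_eq0.
congr (_ * _); rewrite -[X in _ * X](sqr_sqrtr S0) -powR_mulrn ?sqrtr_ge0//.
rewrite -powRD; first by congr (_ `^ _); lra.
by apply/implyP => _; rewrite sqrtr_eq0 -ltNge lt_neqAle eq_sym Sn0.
Qed.

Section EnergyDensity.
Context {R : realType} {m n : nat}.
Variables (U : set 'rV[R]_m) (G : 'rV[R]_m -> 'M[R]_m) (b : bool).
Hypotheses (oU : open U) (sG : smooth_on U G).
Hypotheses (symG : forall y, U y -> (G y)^T = G y).
Hypotheses (posG : forall y, U y -> posdef (G y)).
Variables (f : 'rV[R]_m -> 'rV[R]_n) (q : 'rV[R]_m -> R).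
Hypothesis (sf : smooth_on U f) (sq : smooth_on U q).
Hypothesis (q2 : forall y, U y -> 2 <= q y).
Implicit Types (X Y y : 'rV[R]_m).
Local Notation H := (@metric R _ n (sphere_atlas R n) b).

Definition energy y : R := hs_inner G H f (differential f) (differential f) y.

Let df y : U y -> differentiable f y.
Proof. by move=> Uy; exact: smooth_differentiable sf Uy. Qed.

Let sfi i : smooth_on U (fun z => f z 0 i).
Proof. exact: smooth_entry. Qed.

Let derive_entry y X i : U y -> 'D_X f y 0 i = 'D_X (fun z => f z 0 i) y.
Proof. by move=> Uy; apply/esym/is_deriveE/is_derive_entry/smooth_is_derive. Qed.

Lemma smooth_energy : smooth_on U energy.
Proof.
apply: (smooth_eq_in oU (f := fun y => \sum_i (conf (f y) * conf (f y)) *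
    grad_ip G (fun z => f z 0 i) (fun z => f z 0 i) y)).
  by move=> z Uz; rewrite /energy (hs_inner_grad_ip G b sf Uz); apply: eq_bigr => i _; rewrite expr2.
apply: (smooth_sum oU) => i _; apply: (smooth_mul oU).
  by apply: (smooth_mul oU); exact: smooth_conf.
by apply: (smooth_grad_ip oU) => //; exact: sfi.
Qed.

Lemma energy_ge0 y : U y -> 0 <= energy y.
Proof.
move=> Uy; rewrite /energy (hs_inner_grad_ip G b sf Uy); apply: sumr_ge0 => i _.
by rewrite mulr_ge0 ?sqr_ge0// (grad_ip_ge0 symG posG)//; exact: smooth_differentiable (sfi i) Uy.
Qed.

(** The components of df are O(|df|), by Cauchy-Schwarz. *)
Lemma derive_le_energy y Y i : U y ->
  ('D_Y f y 0 i) ^+ 2 <= ip (G y) Y Y / conf (f y) ^+ 2 * energy y.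
Proof.
move=> Uy; have k0 : 0 < conf (f y) ^+ 2 by rewrite exprn_gt0// conf_gt0.
have dfi j : differentiable (fun z => f z 0 j) y by exact: smooth_differentiable (sfi j) Uy.
rewrite derive_entry// (le_trans (derive_le_grad_ip symG posG Y (dfi i) Uy))//.
rewrite mulrC -mulrA; apply: ler_wpM2l; first exact: posdef_ge0 (posG Uy).
rewrite mulrC ler_pdivlMr// mulrC /energy (hs_inner_grad_ip G b sf Uy) (bigD1 i)//= lerDl.
apply: sumr_ge0 => j _; apply: mulr_ge0; first exact: ltW.
exact: (grad_ip_ge0 symG posG (dfi j) Uy).
Qed.

(** The derivative of |df|^(q - 2). At the zeros of the energy, the conventions
    ln 0 = 0 and x / 0 = 0 give it the value 0 that [is_derive_weighted] needs. *)
Definition weight_derive y X : R := Num.sqrt (energy y) `^ (q y - 2) *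
  (2^-1 * ('D_X q y * ln (energy y) + (q y - 2) * ('D_X energy y / energy y))).

(** At a zero of df, the components of df are dominated by |df| on lines through
    the point, and [is_derive_powR_mul_at_zero] applies. *)
Lemma is_derive_weighted y X Y : U y ->
  is_derive y X (fun z => Num.sqrt (energy z) `^ (q z - 2) *: 'D_Y f z)
   (weight_derive y X *: 'D_Y f y
      + Num.sqrt (energy y) `^ (q y - 2) *: 'D_X ('D_Y f) y).
Proof.
move=> Uy; have sDf := smooth_derive Y sf.
have hD : is_derive y X ('D_Y f) ('D_X ('D_Y f) y) by exact: smooth_is_derive sDf Uy.
have [S0|Sn0] := eqVneq (energy y) 0; last first.
  have Sp : 0 < energy y by rewrite lt_neqAle eq_sym Sn0 energy_ge0.
  have nS : \forall z \near y, 0 < energy z.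
    have c := smooth_continuous smooth_energy Uy.
    exact: cvgr_gt c _ Sp.
  apply: is_derive_scale hD; apply: is_derive_powR_sqrt => //.
    exact: smooth_is_derive smooth_energy Uy.
  exact: smooth_is_derive sq Uy.
have -> : weight_derive y X = 0.
  by rewrite /weight_derive S0 (ln0 (lexx 0)) invr0 !mulr0 addr0 !mulr0.
rewrite scale0r add0r; apply: is_derive_mx => i0 i; rewrite ord1 {i0}.
have -> : (fun z => (Num.sqrt (energy z) `^ (q z - 2) *: 'D_Y f z) 0 i) =
   fun z => Num.sqrt (energy z) `^ (q z - 2) * ('D_Y f z) 0 i.
  by apply/funext => z; rewrite mxE.
apply/is_derive_line0.
(* The squared constant of [derive_le_energy], bounded near y by A y + 1. *)
pose A z := ip (G z) Y Y / conf (f z) ^+ 2.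
have sA : smooth_on U A.
  apply: (smooth_eq_in oU (f := fun z => (\sum_j \sum_k (Y 0 j * Y 0 k) * G z j k)
      * (conf (f z) * conf (f z))^-1)).
    move=> z _; rewrite /A ipE expr2; congr (_ * _).
    by apply: eq_bigr => j _; apply: eq_bigr => k _; rewrite mulrAC.
  apply: (smooth_mul oU).
    apply: (smooth_sum oU) => j _; apply: (smooth_sum oU) => k _.
    by apply: (smooth_mul oU); [exact: smooth_cst|exact: smooth_entry].
  apply: (smooth_inv oU) => [x _|]; first by rewrite mulf_neq0 ?gt_eqF ?conf_gt0.
  by apply: (smooth_mul oU); exact: smooth_conf.
have Ay0 : 0 <= A y.
  by rewrite /A divr_ge0 ?posdef_ge0//; [exact: posG|rewrite sqr_ge0].
have C0 : 0 < Num.sqrt (A y + 1) by rewrite sqrtr_gt0 ltr_wpDl.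
have nU : \forall z \near y, U z by exact: near_in_open Uy _.
have nC : \forall z \near y, `|('D_Y f z) 0 i| <= Num.sqrt (A y + 1) * Num.sqrt (energy z).
  have nA : \forall z \near y, A z < A y + 1.
    have c := smooth_continuous sA Uy.
    by apply: (cvgr_lt _ c); rewrite ltrDl.
  near=> z; have Uz : U z by near: z.
  have Az : A z < A y + 1 by near: z.
  rewrite -sqrtr_sqr -sqrtrM; last by rewrite addr_ge0.
  rewrite ler_wsqrtr// (le_trans (derive_le_energy Y i Uz))//.
  by apply: ler_wpM2r; [exact: energy_ge0|exact: ltW].
have E0 : y + (0 : R) *: X = y by rewrite scale0r addr0.
have -> : Num.sqrt (energy y) `^ (q y - 2) *: 'D_X ('D_Y f) y =
   0 `^ (q (y + (0 : R) *: X) - 2) *: 'D_X ('D_Y f) y by rewrite E0 S0 sqrtr0.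
rewrite mxE.
apply: (is_derive_powR_mul_at_zero (s := fun t => Num.sqrt (energy (y + t *: X)))
   (q := fun t => q (y + t *: X)) (u := fun t => ('D_Y f (y + t *: X)) 0 i) _ _ _ _ _ C0).
- by rewrite E0 S0 sqrtr0.
- have cs := smooth_continuous smooth_energy Uy.
  apply/cvgr0Pnorm_lt => e e0; apply: (near_line X (P := fun z => `|Num.sqrt (energy z)| < e)).
  have nS : \forall z \near y, energy z < e ^+ 2.
    by apply: (cvgr_lt _ cs); rewrite S0 exprn_gt0.
  apply: filterS nS => z Sz; rewrite ger0_norm ?sqrtr_ge0//.
  by rewrite -(ger0_norm (ltW e0)) -sqrtr_sqr ltr_sqrt// exprn_gt0.
- by move=> t; exact: sqrtr_ge0.
- by apply: (near_line X (P := fun z => 2 <= q z)); apply: filterS nU => z; exact: q2.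
- by have [] := (is_derive_line0 q y X _).2 (smooth_is_derive X sq Uy).
- exact: (near_line X nC).
- exact: ((is_derive_line0 _ y X _).2 (is_derive_entry 0 i hD)).
Unshelve. all: by end_near. Qed.

End EnergyDensity.

(** * The index form of a conformal field in a chart *)

(** The value of h(v, J v) when v is the gradient of a height u, in terms of
    scalar invariants: S = |df|^2, the exponent q, the squared length N of the
    constant vector, gu = |du|^2, gqu = <dq, du>, gSu = <dS, du> and the Laplacian
    L of u. *)
Definition density (R : realType) (S q u N gu gqu gSu L : R) : R :=
  Num.sqrt S `^ (q - 2) * (- (S * (N - u ^+ 2)) + q * gu
    + (q - 1) * u * (2^-1 * (gqu * ln S + (q - 2) * (gSu / S)) + L + u * S) + u * gqu).

(** The three terms of the Jacobi operator, where P = |df|^(q - 2) and K is the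
    product of du with the derivative of ln P. *)
Lemma density_algebra (R : realType) (P q u N S gu gqu K L : R) :
  - (P * (S * (N - u ^+ 2) - gu))
  - (P * - gu + - u * (P * K) + - u * P * (L + u * S))
  - (P * - (u * gqu + (q - 2) * gu) + - ((q - 2) * u) * (P * K)
      + - ((q - 2) * u) * P * (L + u * S)) =
  P * (- (S * (N - u ^+ 2)) + q * gu + (q - 1) * u * (K + L + u * S) + u * gqu).
Proof. by ring. Qed.

Lemma shift_algebra (R : realType) (x r4 r2 S u : R) :
  x * r4 * S = x * r2 -> x * r4 * (- u * S) = - (x * u) * r2.
Proof.
move=> E; have -> : x * r4 * (- u * S) = - u * (x * r4 * S) by ring.
by rewrite E; ring.
Qed.

Lemma curvature_algebra (R : realType) (k pq wp wq ww T1 T2 N : R) :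
  T1 = k * wp -> T2 = k * wq -> k * ww = N ->
  k * (k * (pq * ww - wq * wp)) = N * (k * pq) + (-1) * (T1 * T2).
Proof. by move=> -> -> <-; ring. Qed.

Section JacobiDensity.
Context {R : realType} {m n : nat}.
Variables (U : set 'rV[R]_m) (G : 'rV[R]_m -> 'M[R]_m) (b : bool).
Hypotheses (oU : open U) (sG : smooth_on U G).
Hypotheses (symG : forall y, U y -> (G y)^T = G y).
Hypotheses (posG : forall y, U y -> posdef (G y)).
Variables (f : 'rV[R]_m -> 'rV[R]_n) (q : 'rV[R]_m -> R).
Hypothesis (sf : smooth_on U f) (sq : smooth_on U q).
Hypothesis (q2 : forall y, U y -> 2 <= q y).
Variables (beta : R) (a : 'rV[R]_n).
Implicit Types (X Y y : 'rV[R]_m).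
Local Notation H := (@metric R _ n (sphere_atlas R n) b).
Local Notation S := (energy G b f).
Local Notation P := (fun z => Num.sqrt (energy G b f z) `^ (q z - 2)).
Local Notation w := (fun z => conformal_field beta a (f z)).
Local Notation u := (fun z => height beta a (f z)).
Local Notation K y := (2^-1 * (grad_ip G q u y * ln (S y) + (q y - 2) * (grad_ip G S u y / S y))).

Lemma trace_nabla_eq_in (sigma tau : 'rV[R]_m -> 'rV[R]_m -> 'rV[R]_n) y :
  (forall z X, U z -> sigma z X = tau z X) -> U y ->
  trace_nabla G H f sigma y = trace_nabla G H f tau y.
Proof.
move=> st Uy; apply: eq_trace_g => X Y.
exact: (f_equal3 (fun d s t => d + christoffel H (f y) ('D_X f y) s - t)
  (derive_eq_in oU X (fun z Uz => st z Y Uz) Uy) (st y Y Uy) (st y _ Uy)).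
Qed.

Lemma trace_weight_derive y :
  trace_g G y (W := R^o) (fun X Y => weight_derive G b f q y X * 'D_Y u y) = P y * K y.
Proof.
rewrite /grad_ip mulrA [_ / _]mulrC mulrA -!trace_gZ.
rewrite [X in _ * (X + _)]mulrC -!trace_gZ -trace_gD -!trace_gZ.
by apply: eq_trace_g => X Y; rewrite /weight_derive; ring.
Qed.

Lemma ip_trace_nabla_weighted (theta : 'rV[R]_m -> R) (thX : 'rV[R]_m -> R) y : U y ->
  (forall X, is_derive y X theta (thX X)) ->
  ip (H (f y)) (w y) (trace_nabla G H f (fun z X => (theta z * P z) *: 'D_X f z) y) =
  P y * trace_g G y (W := R^o) (fun X Y => thX X * 'D_Y u y)
  + theta y * (P y * K y) + theta y * P y * (laplacian G u y + u y * S y).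
Proof.
move=> Uy dth.
pose cX X := thX X * P y + theta y * weight_derive G b f q y X.
have dc X Y : is_derive y X (fun z => (theta z * P z) *: 'D_Y f z)
    (cX X *: 'D_Y f y + (theta y * P y) *: 'D_X ('D_Y f) y).
  have h := is_derive_scale (dth X) (is_derive_weighted b oU sG symG posG sf sq q2 X Y Uy).
  have -> : (fun z => (theta z * P z) *: 'D_Y f z) = fun z => theta z *: (P z *: 'D_Y f z).
    by apply/funext => z; rewrite scalerA.
  by apply: (is_derive_eq h); rewrite scalerDr !scalerA addrA -scalerDl.
have T := @ip_trace_nabla R m n U G b oU f beta a sf (fun z => theta z * P z) cX y Uy dc.
apply: (etrans T); clear T.
congr (_ + _); rewrite -trace_weight_derive -!trace_gZ -trace_gD.
apply: eq_trace_g => X Y; rewrite /cX.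
by move: (weight_derive _ _ _ _ _ _) (thX X) (P y) ('D_Y u y) (theta y) => *; ring.
Qed.

Lemma ip_sphere_curvature y : U y ->
  ip (H (f y)) (w y) (trace_g G y (fun X Y =>
    curvature H (f y) (w y) (differential f y X) (differential f y Y))) =
  S y * (beta ^+ 2 + dot a a - u y ^+ 2) - grad_ip G u u y.
Proof.
move=> Uy; rewrite ip_trace_g /energy hs_inner_differential mulrC -[X in _ = _ + X]mulN1r.
rewrite /grad_ip -!trace_gZ -trace_gD; apply: eq_trace_g => X Y.
rewrite sphere_curvature ip_sphere /differential dotZr dotDr dotNr !dotZr.
exact: curvature_algebra (derive_height beta a sf X Uy) (derive_height beta a sf Y Uy)
  (norm_conformal_field _ _ _).
Qed.

(** By [nabla_pb_conformal_field], both divergences in J are those of sections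
    theta |df|^(q - 2) df, with theta = - u and theta = - (q - 2) u. *)
Lemma jacobi_densityE y : U y ->
  ip (H (f y)) (w y) (jacobi G H f q w y) =
  density (S y) (q y) (u y) (beta ^+ 2 + dot a a) (grad_ip G u u y)
    (grad_ip G q u y) (grad_ip G S u y) (laplacian G u y).
Proof.
move=> Uy.
have S1 : trace_nabla G H f (fun z X => (hs_norm_diff G H f z `^ (q z - 2)) *: nabla_pb H f w z X) y
  = trace_nabla G H f (fun z X => (- u z * P z) *: 'D_X f z) y.
  apply: trace_nabla_eq_in Uy => z X Uz; rewrite (nabla_pb_conformal_field b beta a sf X Uz).
  by rewrite scalerA mulrC.
have S2 : trace_nabla G H f (fun z X =>
      ((q z - 2) * hs_norm_diff G H f z `^ (q z - 4)
        * hs_inner G H f (nabla_pb H f w) (differential f) z) *: differential f z X) y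
  = trace_nabla G H f (fun z X => (- ((q z - 2) * u z) * P z) *: 'D_X f z) y.
  apply: trace_nabla_eq_in Uy => z X Uz; congr (_ *: _).
  have -> : hs_inner G H f (nabla_pb H f w) (differential f) z = - u z * S z.
    rewrite /energy /hs_inner -trace_gZ; apply: eq_trace_g => X' Y'.
    by rewrite (nabla_pb_conformal_field b beta a sf X' Uz) ip_scalel.
  exact: shift_algebra (powR_sqrt_shift (energy_ge0 b oU symG posG sf Uz) (q2 Uz)).
have du X : is_derive y X u ('D_X u y).
  by apply: smooth_is_derive Uy; exact: smooth_height.
have T1 := ip_trace_nabla_weighted Uy (fun X => is_derive_opp (du X)).
have dth2 X : is_derive y X (fun z => - ((q z - 2) * u z))
    (- ('D_X q y * u y + (q y - 2) * 'D_X u y)).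
  have h := is_derive_opp (is_derive_mul (is_derive_add (smooth_is_derive X sq Uy)
     (is_derive_cst (- 2 : R) y X)) (du X)).
  by apply: (is_derive_eq h); rewrite addr0.
have T2 := ip_trace_nabla_weighted Uy dth2.
have E1 : trace_g G y (W := R^o) (fun X Y => - 'D_X u y * 'D_Y u y) = - grad_ip G u u y.
  by rewrite -mulN1r -trace_gZ; apply: eq_trace_g => X Y; rewrite mulN1r mulNr.
have E2 : trace_g G y (W := R^o)
    (fun X Y => - ('D_X q y * u y + (q y - 2) * 'D_X u y) * 'D_Y u y)
  = - (u y * grad_ip G q u y + (q y - 2) * grad_ip G u u y).
  rewrite /grad_ip -[RHS]mulN1r -!trace_gZ -trace_gD -trace_gZ; apply: eq_trace_g => X Y.
  by move: ('D_X q y) ('D_X u y) ('D_Y u y) (q y) (u y) => *; ring.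
rewrite E1 in T1; rewrite E2 in T2.
rewrite /jacobi S1 S2 !ip_addr !ip_oppr ip_scaler (ip_sphere_curvature Uy).
rewrite [X in _ - X - _]T1 [X in _ - _ - X]T2.
exact: density_algebra.
Qed.

End JacobiDensity.

(** * The stereographic atlas *)

Section SphereAtlas.
Context {R : realType} {n : nat}.
Local Notation SA := (sphere_atlas R n).
Local Notation sdom j := (@dom R _ n SA j).
Local Notation scoord j := (@Defs.coord R _ n SA j).
Local Notation sparam j := (@param R _ n SA j).
Local Notation strans j k := (@transition R _ n SA j k).
Implicit Types (x : sphere R n) (j k : bool) (y X : 'rV[R]_n) (c : 'I_n.+1).

Lemma sphere_sqr_sum x : \sum_c (val x : 'rV[R]_n.+1) 0 c ^+ 2 = 1.
Proof. by have := valP x; rewrite inE. Qed.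

Lemma sphere_chart_at x : sdom (chart_at SA x) x.
Proof.
rewrite /=; have [h|/negPn/eqP ->] := boolP ((val x : 'rV[R]_n.+1) 0 ord0 != pole R true).
  exact: h.
by rewrite /pole /= gt_eqF// (lt_trans (ltrN10 _) ltr01).
Qed.

Lemma stereo_of_unit j (X : 'rV[R]_n.+1) :
  \sum_c X 0 c ^+ 2 = 1 -> X 0 ord0 != pole R j ->
  stereo_fun j (\row_k (X 0 (lift ord0 k) / (1 - pole R j * X 0 ord0))) = X.
Proof.
move=> sX dx; have p2 := @sqr_pole R j.
have d0 : 1 - pole R j * X 0 ord0 != 0.
  rewrite subr_eq0; apply: contra_neq dx => h.
  by rewrite -[LHS]mul1r -p2 expr2 -mulrA -h mulr1.
set y := \row_k _; rewrite big_ord_recl in sX.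
have yy : dot y y = (1 + pole R j * X 0 ord0) / (1 - pole R j * X 0 ord0).
  transitivity ((\sum_l X 0 (lift ord0 l) ^+ 2) / (1 - pole R j * X 0 ord0) ^+ 2).
    rewrite mulr_suml; apply: eq_bigr => l _; rewrite !mxE.
    by move: d0; move: (1 - pole R j * X 0 ord0) (X 0 (lift ord0 l)) => d t d0; field.
  have -> : \sum_l X 0 (lift ord0 l) ^+ 2 = (1 - pole R j * X 0 ord0) * (1 + pole R j * X 0 ord0).
    transitivity (1 - pole R j ^+ 2 * X 0 ord0 ^+ 2); last by ring.
    by rewrite p2 mul1r -sX addrAC subrr add0r.
  by move: d0; move: (pole R j * X 0 ord0) => t t0; field.
have cy : conf y = 1 - pole R j * X 0 ord0.
  rewrite /conf yy; move: d0; move: (pole R j * X 0 ord0) => t t0; field.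
  by rewrite t0 /= (_ : 1 - t + (1 + t) = 2) ?pnatr_eq0//; ring.
apply/rowP => c; case: (unliftP ord0 c) => [l|] ->.
  rewrite stereo_funS cy !mxE.
  by move: d0; move: (1 - pole R j * X 0 ord0) (X 0 (lift ord0 l)) => d t d0; field.
rewrite stereo_fun0 cy (_ : 1 - (1 - _) = pole R j * X 0 ord0); last by ring.
by rewrite mulrA -expr2 p2 mul1r.
Qed.

Lemma sphere_paramK j x : sdom j x -> sparam j (scoord j x) = x.
Proof.
by move=> /= dx; apply: val_inj; exact: stereo_of_unit (sphere_sqr_sum x) dx.
Qed.

Lemma sphere_coordK j y : scoord j (sparam j y) = y.
Proof.
apply/rowP => l; rewrite mxE /= stereo_fun0 stereo_funS mulrA -expr2 sqr_pole mul1r.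
rewrite (_ : 1 - (1 - conf y) = conf y); last by ring.
by rewrite mulrC mulKf// gt_eqF// conf_gt0.
Qed.

(** The two charts differ by the inversion in the unit sphere. At the origin, the
    pole that the other chart omits, both sides are 0. *)
Lemma stereo_other j y : scoord (~~ j) (sparam j y) = (dot y y)^-1 *: y.
Proof.
apply/rowP => l; rewrite [LHS]mxE [RHS]mxE /= stereo_fun0 stereo_funS mulrA.
have -> : pole R (~~ j) * pole R j = -1 by case: j; rewrite /pole /= ?mul1r ?mulr1.
have [y0|y0] := eqVneq (dot y y) 0.
  have -> : y 0 l = 0.
    apply/eqP; rewrite -sqrf_eq0 eq_le sqr_ge0 andbT -y0 /dot (bigD1 l)//= -expr2 lerDl.
    by apply: sumr_ge0 => i _; rewrite -expr2 sqr_ge0.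
  by rewrite !mulr0 mul0r.
have := conf_denom y; rewrite /conf; move: (dot y y) (y 0 l) y0 => r t r0 r1.
field; rewrite r0 gt_eqF//=.
by rewrite (_ : _ - _ = 2 * r) ?mulf_neq0 ?pnatr_eq0//; ring.
Qed.

(** [pole_part] and [tail_part] split the c-th basis vector as [conformal_field]
    expects it. *)
Definition pole_part c j : R := pole R j * (c == ord0)%:R.
Definition tail_part c : 'rV[R]_n := \row_l (lift ord0 l == c)%:R.

Lemma stereo_height j c y : stereo_fun j y 0 c = height (pole_part c j) (tail_part c) y.
Proof.
rewrite /height /pole_part; case: (unliftP ord0 c) => [l|] ->.
  rewrite stereo_funS eq_sym (negbTE (neq_lift _ _)) mulr0 mul0r add0r.
  have -> : tail_part (lift ord0 l) = delta_mx 0 l.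
    by apply/rowP => i; rewrite !mxE (inj_eq (@lift_inj _ _)).
  by rewrite dot_delta.
have -> : tail_part ord0 = 0.
  by apply/rowP => i; rewrite !mxE eq_sym (negbTE (neq_lift _ _)).
by rewrite dotC dot0r eqxx mulr1 mulr0 addr0 stereo_fun0.
Qed.

Lemma height_norm c j : pole_part c j ^+ 2 + dot (tail_part c) (tail_part c) = 1.
Proof.
rewrite /pole_part; case: (unliftP ord0 c) => [l|] ->.
  have -> : tail_part (lift ord0 l) = delta_mx 0 l.
    by apply/rowP => i; rewrite !mxE (inj_eq (@lift_inj _ _)).
  by rewrite eq_sym (negbTE (neq_lift _ _)) mulr0 expr0n add0r dot_delta mxE !eqxx.
have -> : tail_part ord0 = 0.
  by apply/rowP => i; rewrite !mxE eq_sym (negbTE (neq_lift _ _)).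
by rewrite dot0r eqxx mulr1 sqr_pole addr0.
Qed.

(** The gradient of the ambient coordinate x_c, read in the chart j. *)
Definition coordinate_gradient c j y : 'rV[R]_n :=
  conformal_field (pole_part c j) (tail_part c) y.

Lemma is_derive_inversion y X : dot y y != 0 ->
  is_derive y X (fun z : 'rV[R]_n => (dot z z)^-1 *: z)
    (- (2 * dot y X) / dot y y ^+ 2 *: y + (dot y y)^-1 *: X).
Proof.
move=> y0; have h := is_derive_scale (is_derive_inv (f := fun z => dot z z) y0
  (is_derive_dot (is_derive_id y X) (is_derive_id y X))) (is_derive_id y X).
by apply: (is_derive_eq h); rewrite (dotC X y) mulr2n mulrDl mul1r.
Qed.

(** The conformal fields correspond to each other under the inversion, which
    exchanges the poles and hence the sign of [beta]. *)
Lemma coordinate_gradient_transition c j k x :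
  sdom j x -> sdom k x ->
  coordinate_gradient c k (scoord k x) =
  'D_(coordinate_gradient c j (scoord j x)) (strans j k) (scoord j x).
Proof.
move=> dj dk; have [<-|jk] := eqVneq j k.
  have -> : strans j j = id.
    by apply/funext => y; exact: sphere_coordK.
  by rewrite derive_id.
have kE : k = ~~ j by move: jk; case: (j); case: (k).
have xE : scoord k x = strans j k (scoord j x).
  by rewrite /transition /= -[in LHS](sphere_paramK dj).
rewrite xE; have -> : strans j k = fun z => (dot z z)^-1 *: z.
  by apply/funext => y; rewrite kE; exact: stereo_other.
set y := scoord j x.
have y0 : dot y y != 0.
  apply: contraNneq dk => y0.
  have -> : (val x : 'rV[R]_n.+1) 0 ord0 = stereo_fun j y 0 ord0.
    by rewrite -[in LHS](sphere_paramK dj).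
  rewrite stereo_fun0 /conf y0 kE addr0 divr1.
  by apply/eqP; case: (j); rewrite /pole /=; ring.
rewrite (is_deriveE (is_derive_inversion _ y0)) /coordinate_gradient /conformal_field.
have -> : pole_part c k = - pole_part c j.
  by rewrite /pole_part kE; case: (j); rewrite /pole /= ?mul1r ?mulN1r ?opprK.
rewrite !(dotDl, dotDr, dotZl, dotZr) (dotC y (tail_part c)).
clearbody y; apply/rowP => l; rewrite !mxE; move: y0.
move: (dot y y) (dot (tail_part c) y) (pole_part c j) (y 0 l) ((_ == _)%:R) => r s b t d r0.
by field.
Qed.

End SphereAtlas.

(** * Scalar invariants on a Riemannian manifold *)

(** Values at a point depend only on germs. *)
Section Germs.
Context {R : realType} {m : nat} (O : set 'rV[R]_m) (oO : open O).
Variable (G : 'rV[R]_m -> 'M[R]_m).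

Lemma grad_ip_eq_in (a a' b b' : 'rV[R]_m -> R) y :
  (forall z, O z -> a z = a' z) -> (forall z, O z -> b z = b' z) -> O y ->
  grad_ip G a b y = grad_ip G a' b' y.
Proof.
move=> aE bE Oy; apply: eq_trace_g => X Y.
exact: (congr2 *%R (derive_eq_in oO X aE Oy) (derive_eq_in oO Y bE Oy)).
Qed.

Lemma laplacian_eq_in (u u' : 'rV[R]_m -> R) y :
  (forall z, O z -> u z = u' z) -> O y -> laplacian G u y = laplacian G u' y.
Proof.
move=> uE Oy; apply: eq_trace_g => X Y.
have E : 'D_X ('D_Y u) y = 'D_X ('D_Y u') y.
  have F z : O z -> 'D_Y u z = 'D_Y u' z := fun Oz => derive_eq_in oO Y uE Oz.
  have T := derive_eq_in oO X F Oy. exact T.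
exact: (congr2 (fun s t => s - t) E (derive_eq_in oO (christoffel G y X Y) uE Oy)).
Qed.

End Germs.

Section RiemannianManifold.
Context {R : realType} {M : ptopologicalType} {m : nat}.
Variable g : riem_atlas R M m.
Hypothesis Hg : riemannian_manifold g.
Implicit Types (i j : chart_index g) (x : M) (a b : M -> R).
Local Notation crd i := (@Defs.coord R M m g i).

Lemma chart_symmetric i y : codom_chart i y -> (metric i y)^T = metric i y.
Proof. by move=> Uy; apply: (rm_metric_sym Hg). Qed.

Lemma chart_posdef i y : codom_chart i y -> posdef (metric i y).
Proof. by move=> Uy X X0; exact: (rm_metric_pos Hg). Qed.

Lemma codom_coord i x : dom i x -> codom_chart i (crd i x).
Proof. by move=> dx; exists x. Qed.

Lemma dom_param i y : codom_chart i y -> dom i (param i y).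
Proof. by move=> [x dx <-]; rewrite (rm_coordK Hg). Qed.

Lemma param_coord i y : codom_chart i y -> crd i (param i y) = y.
Proof. by move=> [x dx <-]; rewrite (rm_coordK Hg). Qed.

Lemma open_codom i : open (codom_chart i).
Proof. exact: (rm_open_codom Hg). Qed.

Lemma open_dom i : open (dom i).
Proof. exact: (rm_open_dom Hg). Qed.

Lemma coord_continuous_at i x : dom i x -> {for x, continuous (crd i)}.
Proof.
move=> dx; have := rm_coord_continuous Hg (i := i).
by rewrite continuous_open_subspace; [apply; rewrite inE|exact: open_dom].
Qed.

Lemma open_param_preimage i (A : set M) : open A ->
  open (codom_chart i `&` param i @^-1` A).
Proof.
move=> oA; have oc : open (codom_chart i) by exact: open_codom.
have := rm_param_continuous Hg (i := i); rewrite continuous_open_subspace//.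
by move=> /(continuous_inP _ oc); apply.
Qed.

Lemma open_overlap i j : open (crd i @` (dom i `&` dom j)).
Proof.
have -> : crd i @` (dom i `&` dom j) = codom_chart i `&` param i @^-1` dom j.
  apply/seteqP; split => y.
    by move=> [x [di dj] <-]; split; [exists x|rewrite /= (rm_coordK Hg)].
  move=> [cy dj]; exists (param i y); last exact: param_coord.
  by split=> //; exact: dom_param.
by apply: open_param_preimage; exact: open_dom.
Qed.

Section Overlap.
Variables (i j : chart_index g).
Local Notation V := (crd i @` (dom i `&` dom j)).

Lemma overlap_codom y : V y -> codom_chart i y.
Proof. by move=> [x [di _] <-]; exact: codom_coord. Qed.

Lemma transition_codom y : V y -> codom_chart j (transition i j y).
Proof.
by move=> [x [di dj] <-]; rewrite /transition /= (rm_coordK Hg)//; exact: codom_coord.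
Qed.

Lemma transition_iso y X Y : V y ->
  ip (metric j (transition i j y)) ('D_X (transition i j) y) ('D_Y (transition i j) y)
  = ip (metric i y) X Y.
Proof.
move=> [x [di dj] <-]; rewrite [transition i j (crd i x)](_ : _ = crd j x).
  exact: (rm_metric_transition Hg).
by rewrite /transition /= (rm_coordK Hg).
Qed.

Lemma transition_fun a y : V y -> (a \o param i) y = (a \o param j) (transition i j y).
Proof. by move=> [x [di dj] <-]; rewrite /transition /= !(rm_coordK Hg). Qed.

End Overlap.

(** Computed in the chart attached to the point, but the same in all charts
    ([grad_at_chart]), which makes it a smooth function. *)
Definition grad_at a b x : R :=
  let i := chart_at g x in grad_ip (metric i) (a \o param i) (b \o param i) (crd i x).

Definition laplacian_at a x : R :=
  let i := chart_at g x in laplacian (metric i) (a \o param i) (crd i x).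

Lemma smooth_overlap i j (W : normedModType R) (F : 'rV[R]_m -> W) :
  smooth_on (codom_chart i) F -> smooth_on (crd i @` (dom i `&` dom j)) F.
Proof. by apply: smooth_subset => y; exact: overlap_codom. Qed.

Lemma grad_at_chart a b i x : smooth_function g a -> smooth_function g b -> dom i x ->
  grad_at a b x = grad_ip (metric i) (a \o param i) (b \o param i) (crd i x).
Proof.
move=> sa sb di; set j := chart_at g x; have dj : dom j x := rm_chart_at Hg x.
have Vx : (crd j @` (dom j `&` dom i)) (crd j x) by exists x.
have -> : crd i x = transition j i (crd j x) by rewrite /transition /= (rm_coordK Hg).
have T := (grad_ip_change (open_overlap (i := j) (j := i))
  (fun y Vy => chart_posdef (overlap_codom Vy)) (rm_transition Hg j i)
  (@transition_codom j i) (@transition_iso j i) (sa i) (sb i)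
  (@transition_fun j i a) (@transition_fun j i b) Vx).
exact T.
Qed.

Lemma laplacian_at_chart a i x : smooth_function g a -> dom i x ->
  laplacian_at a x = laplacian (metric i) (a \o param i) (crd i x).
Proof.
move=> sa di; set j := chart_at g x; have dj : dom j x := rm_chart_at Hg x.
have Vx : (crd j @` (dom j `&` dom i)) (crd j x) by exists x.
have -> : crd i x = transition j i (crd j x) by rewrite /transition /= (rm_coordK Hg).
have T := (laplacian_change (open_overlap (i := j) (j := i)) (open_codom (i := i))
  (smooth_overlap i (rm_metric_smooth Hg j)) (rm_metric_smooth Hg i)
  (@chart_symmetric i) (fun y Vy => chart_posdef (overlap_codom Vy)) (@chart_posdef i)
  (rm_transition Hg j i) (@transition_codom j i) (@transition_iso j i) (sa i)
  (@transition_fun j i a) Vx).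
exact T.
Qed.

Lemma smooth_grad_at a b : smooth_function g a -> smooth_function g b ->
  smooth_function g (grad_at a b).
Proof.
move=> sa sb i; have oc : open (codom_chart i) by exact: open_codom.
apply: (smooth_eq_in oc (f := grad_ip (metric i) (a \o param i) (b \o param i))).
  by move=> y cy; rewrite /= (grad_at_chart (i := i))// ?param_coord//; exact: dom_param.
by apply: (smooth_grad_ip oc (rm_metric_smooth Hg i) (@chart_posdef i)).
Qed.

Lemma smooth_laplacian_at a : smooth_function g a -> smooth_function g (laplacian_at a).
Proof.
move=> sa i; have oc : open (codom_chart i) by exact: open_codom.
apply: (smooth_eq_in oc (f := laplacian (metric i) (a \o param i))).
  by move=> y cy; rewrite /= (laplacian_at_chart (i := i))// ?param_coord//; exact: dom_param.
by apply: (smooth_laplacian oc (rm_metric_smooth Hg i) (@chart_posdef i)).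
Qed.

Lemma smooth_function_continuous a : smooth_function g a -> continuous a.
Proof.
move=> sa x; set i := chart_at g x; have di : dom i x := rm_chart_at Hg x.
have od : open (dom i) by exact: open_dom.
have aE : \forall z \near x, ((a \o param i) \o crd i) z = a z.
  near=> z; rewrite /= (rm_coordK Hg)//.
  by near: z; exact: open_nbhs_nbhs.
have := @continuous_comp _ _ _ (crd i) (a \o param i) x (coord_continuous_at di)
  (smooth_continuous (sa (chart_at g x)) (codom_coord di)).
rewrite /prop_for /continuous_at /= (rm_coordK Hg)// => c.
by apply: cvg_trans c; apply: near_eq_cvg; apply: filterS aE => z ->.
Unshelve. all: by end_near. Qed.

Lemma smooth_function_sum (I : finType) (F : I -> M -> R) :
  (forall c, smooth_function g (F c)) -> smooth_function g (fun x => \sum_c F c x).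
Proof.
move=> sF i; have oc : open (codom_chart i) by exact: open_codom.
by have T := @smooth_sum R _ _ oc I (index_enum I) xpredT (fun c => F c \o param i) (fun c _ => sF c i).
Qed.

End RiemannianManifold.

(** * Coordinate gradients along a map into the sphere *)

Lemma density_congr (R : realType) (S S' q q' u u' N N' a a' b b' c c' L L' : R) :
  S = S' -> q = q' -> u = u' -> N = N' -> a = a' -> b = b' -> c = c' -> L = L' ->
  density S q u N a b c L = density S' q' u' N' a' b' c' L'.
Proof. by move=> -> -> -> -> -> -> -> ->. Qed.

(** The terms in <dq, du> and <dS, du> carry a factor u and drop out, and the
    Laplacians cancel with the terms S u^2. There remain n + 1 times - S, once S
    from u^2, and q S from |du|^2. *)
Lemma density_sum (R : realType) n (S q : R) (u gu gqu gSu L : 'I_n.+1 -> R) :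
  \sum_c u c ^+ 2 = 1 -> \sum_c gu c = S -> \sum_c u c * gqu c = 0 ->
  \sum_c u c * gSu c = 0 -> \sum_c u c * L c = - S ->
  \sum_c density S q (u c) 1 (gu c) (gqu c) (gSu c) (L c) =
  Num.sqrt S `^ (q - 2) * ((q - n%:R) * S).
Proof.
move=> u1 guS ugq ugS uL; rewrite /density -mulr_sumr; congr (_ * _).
transitivity (\sum_c (- S + S * u c ^+ 2 + q * gu c
   + (q - 1) * 2^-1 * ln S * (u c * gqu c) + (q - 1) * 2^-1 * (q - 2) / S * (u c * gSu c)
   + (q - 1) * (u c * L c) + (q - 1) * S * u c ^+ 2 + u c * gqu c)).
  by apply: eq_bigr => c _; ring.
rewrite !big_split /= -!mulr_sumr u1 guS ugq ugS uL sumr_const card_ord.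
by rewrite -[(- S) *+ _]mulr_natr -natr1; ring.
Qed.

Section SumOverHeights.
Context {R : realType} {n : nat}.

(** Parseval: the coordinate gradients are the projections of an orthonormal
    basis to the tangent space. *)
Lemma sum_height (j : bool) (y X Y : 'rV[R]_n) :
  \sum_(c < n.+1) (conf y ^+ 2 * dot (coordinate_gradient c j y) X)
    * (conf y ^+ 2 * dot (coordinate_gradient c j y) Y) = conf y ^+ 2 * dot X Y.
Proof.
have E (c : 'I_n.+1) Z : conf y ^+ 2 * dot (coordinate_gradient c j y) Z =
    'D_Z (fun z => stereo_fun j z 0 c) y.
  apply/esym/is_deriveE.
  have -> : (fun z : 'rV[R]_n => stereo_fun j z 0 c) =
      fun z => height (pole_part c j) (tail_part c) z.
    by apply/funext => z; exact: stereo_height.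
  exact: is_derive_height.
have E0 Z : conf y ^+ 2 * dot (coordinate_gradient ord0 j y) Z =
    pole R j * (conf y ^+ 2 * dot y Z).
  by rewrite E; exact: is_deriveE (is_derive_stereo0 j y Z).
have ES l Z : conf y ^+ 2 * dot (coordinate_gradient (lift ord0 l) j y) Z =
    (conf y *: Z - (conf y ^+ 2 * dot y Z) *: y) 0 l.
  by rewrite E (is_deriveE (is_derive_stereoS j y Z l)) !mxE.
rewrite big_ord_recl !E0; under eq_bigr => l _ do rewrite !ES.
rewrite -/(dot _ _) !(dotDl, dotDr, dotNl, dotNr, dotZl, dotZr) (dotC X y) dot_self_conf.
have := lt0r_neq0 (conf_gt0 y); have := @sqr_pole R j.
move: (pole R j) (conf y) (dot y X) (dot y Y) (dot X Y) => p k a b c p2 k0.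
rewrite (_ : p * (k ^+ 2 * a) * (p * (k ^+ 2 * b)) = p ^+ 2 * (k ^+ 4 * a * b)); last by ring.
by rewrite p2; field.
Qed.

End SumOverHeights.

Section MapsToSphere.
Context {R : realType} {M : ptopologicalType} {m n : nat}.
Variable g : riem_atlas R M m.
Hypothesis Hg : riemannian_manifold g.
Variables (p : M -> R) (phi : M -> sphere R n).
Hypothesis sphi : smooth_map g (sphere_atlas R n) phi.
Implicit Types (i : chart_index g) (j : bool) (x : M) (c : 'I_n.+1).
Local Notation SA := (sphere_atlas R n).
Local Notation crd i := (@Defs.coord R M m g i).
Local Notation scoord j := (@Defs.coord R _ n SA j).
Local Notation ldom i j := (@local_dom R M _ m n g SA phi i j).
Local Notation lmap i j := (@local_map R M _ m n g SA phi i j).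

Definition amb c x : R := (val (phi x) : 'rV[R]_n.+1) 0 c.

Lemma open_local_dom i j : open (ldom i j).
Proof. by have [] := sphi i j. Qed.

Lemma smooth_local_map i j : smooth_on (ldom i j) (lmap i j).
Proof. by have [] := sphi i j. Qed.

Lemma local_dom_codom i j : ldom i j `<=` codom_chart i.
Proof. by move=> _ [x [di _] <-]; exists x. Qed.

Lemma local_dom_coord i j x : dom i x -> @dom R _ n SA j (phi x) -> ldom i j (crd i x).
Proof. by move=> di dj; exists x. Qed.

Lemma amb_local i j c z : ldom i j z ->
  (amb c \o param i) z = height (pole_part c j) (tail_part c) (lmap i j z).
Proof.
move=> [x [di dj] <-]; rewrite /local_map /= (rm_coordK Hg)// -stereo_height.
by rewrite /amb -[in LHS](sphere_paramK dj).
Qed.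

Lemma smooth_amb c : smooth_function g (amb c).
Proof.
move=> i; apply: smooth_local => y cy; pose j := chart_at SA (phi (param i y)).
have oO : open (ldom i j) by exact: open_local_dom.
exists (ldom i j).
  rewrite -(param_coord Hg cy); apply: local_dom_coord; first exact: dom_param.
  exact: sphere_chart_at.
have sh := smooth_height oO (pole_part c j) (tail_part c) (@smooth_local_map i j).
by apply: (smooth_eq_in oO _ sh) => z Oz; rewrite -amb_local.
Qed.

(** The squared norm of d(phi), written without charts of the sphere. *)
Definition energy_at x : R := \sum_c grad_at g (amb c) (amb c) x.

Lemma smooth_energy_at : smooth_function g energy_at.
Proof.
by apply: smooth_function_sum => // c; apply: smooth_grad_at => //; exact: smooth_amb.
Qed.

Lemma energy_local i j z : ldom i j z ->
  energy (metric i) j (lmap i j) z = (energy_at \o param i) z.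
Proof.
move=> Oz; have oO : open (ldom i j) by exact: open_local_dom.
have cz := local_dom_codom Oz.
rewrite /energy hs_inner_differential /= /energy_at.
under [RHS]eq_bigr => c _ do
  rewrite (grad_at_chart Hg (smooth_amb c) (smooth_amb c) (dom_param Hg cz))
    (param_coord Hg cz) -[grad_ip _ _ _ _]mul1r.
rewrite trace_g_sum; apply: eq_trace_g => X Y; rewrite -(sum_height j).
apply: eq_bigr => c _; rewrite mul1r.
have E Z : 'D_Z (amb c \o param i) z = conf (lmap i j z) ^+ 2 *
    dot (coordinate_gradient c j (lmap i j z)) ('D_Z (lmap i j) z).
  have T := derive_eq_in oO Z (@amb_local i j c) Oz.
  exact: (etrans T (derive_height _ _ (@smooth_local_map i j) Z Oz)).
exact: (congr2 *%R (esym (E X)) (esym (E Y))).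
Qed.

Hypothesis sp : smooth_function g p.
Hypothesis p2 : forall x, 2 <= p x.

Definition test_field c (j : chart_index SA) x : 'rV[R]_n :=
  coordinate_gradient c j (scoord j (phi x)).

Lemma test_field_along c : field_along g (h := SA) phi (test_field c).
Proof.
split=> [i j|x j k dj dk]; last exact: coordinate_gradient_transition.
have oO : open (ldom i j) by exact: open_local_dom.
exact: (smooth_conformal_field oO _ _ (@smooth_local_map i j)).
Qed.

Lemma jacobi_density_test_field c x :
  jacobi_density g (h := SA) p phi (test_field c) x =
  density (energy_at x) (p x) (amb c x) 1 (grad_at g (amb c) (amb c) x)
    (grad_at g p (amb c) x) (grad_at g energy_at (amb c) x) (laplacian_at g (amb c) x).
Proof.
set i := chart_at g x; set j := chart_at SA (phi x).
have di : dom i x := rm_chart_at Hg x.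
have dj : @dom R _ n SA j (phi x) := sphere_chart_at (phi x).
have oO : open (ldom i j) by exact: open_local_dom.
set y := crd i x; have Oy : ldom i j y by exact: local_dom_coord.
have xE : param i y = x by rewrite (rm_coordK Hg).
have sO (W : normedModType R) (F : 'rV[R]_m -> W) :
  smooth_on (codom_chart i) F -> smooth_on (ldom i j) F.
  by apply: smooth_subset; exact: local_dom_codom.
have T := jacobi_densityE j oO (sO _ _ (rm_metric_smooth Hg i))
  (fun z Oz => chart_symmetric Hg (local_dom_codom Oz))
  (fun z Oz => chart_posdef Hg (local_dom_codom Oz))
  (@smooth_local_map i j) (sO _ _ (sp i)) (fun z _ => p2 (param i z))
  (pole_part c j) (tail_part c) Oy.
have aE := @amb_local i j c.
have aE' z (Oz : ldom i j z) := esym (aE z Oz).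
apply: (etrans _ (etrans T _)).
  by rewrite /jacobi_density -/i -/j -/y /local_map /= xE.
apply: density_congr.
- by rewrite energy_local//= xE.
- by rewrite /= xE.
- by rewrite -amb_local//= xE.
- exact: height_norm.
- exact: (grad_ip_eq_in oO _ aE' aE' Oy).
- exact: (grad_ip_eq_in oO _ (fun _ _ => erefl) aE' Oy).
- exact: (grad_ip_eq_in oO _ (@energy_local i j) aE' Oy).
- exact: (laplacian_eq_in oO _ aE' Oy).
Qed.

End MapsToSphere.

(** * Summation over the ambient coordinates *)

Lemma hessian_sum_algebra (R : realType) n (u h t d e : 'I_n -> R) :
  \sum_c u c * t c = 0 -> \sum_c (d c * e c + u c * h c) = 0 ->
  \sum_c u c * (h c - t c) = -1 * \sum_c 1 * (d c * e c).
Proof.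
move=> T1 T2.
have -> : \sum_c u c * (h c - t c) =
    \sum_c (d c * e c + u c * h c) - \sum_c u c * t c - \sum_c 1 * (d c * e c).
  by rewrite -!sumrB; apply: eq_bigr => c _; ring.
by rewrite T1 T2 subrr sub0r mulN1r.
Qed.

Section SphereConstraint.
Context {R : realType} {M : ptopologicalType} {m n : nat}.
Variable g : riem_atlas R M m.
Hypothesis Hg : riemannian_manifold g.
Variables (phi : M -> sphere R n).
Hypothesis sphi : smooth_map g (sphere_atlas R n) phi.
Implicit Types (i : chart_index g) (x : M) (c : 'I_n.+1).
Local Notation crd i := (@Defs.coord R M m g i).
Local Notation amb := (amb phi).
Local Notation sa := (smooth_amb Hg sphi).

Lemma sum_amb_sqr x : \sum_c amb c x ^+ 2 = 1.
Proof. exact: sphere_sqr_sum. Qed.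

(** Derivative of the equation of the sphere. *)
Lemma sum_amb_derive i y X : codom_chart i y ->
  \sum_c (amb c \o param i) y * 'D_X (amb c \o param i) y = 0.
Proof.
move=> cy; have oc : open (codom_chart i) by exact: (open_codom Hg).
have h : is_derive y X (fun z => \sum_c (amb c \o param i) z * (amb c \o param i) z)
   (\sum_c ('D_X (amb c \o param i) y * (amb c \o param i) y
     + (amb c \o param i) y * 'D_X (amb c \o param i) y)).
  apply: is_derive_bigsum => c _.
  by apply: is_derive_mul; exact: smooth_is_derive (sa c i) cy.
have E : (fun z => \sum_c (amb c \o param i) z * (amb c \o param i) z) = cst (1 : R).
  apply/funext => z /=; rewrite -(sum_amb_sqr (param i z)).
  by apply: eq_bigr => c _; rewrite expr2.
have := is_deriveE h; rewrite E derive_cst => /esym/eqP.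
under eq_bigr => c _ do rewrite [X in X + _]mulrC -mulr2n.
by rewrite sumrMnl mulrn_eq0 /= => /eqP.
Qed.

Lemma sum_amb_derive2 i y X Y : codom_chart i y ->
  \sum_c ('D_X (amb c \o param i) y * 'D_Y (amb c \o param i) y
    + (amb c \o param i) y * 'D_X ('D_Y (amb c \o param i)) y) = 0.
Proof.
move=> cy; have oc : open (codom_chart i) by exact: (open_codom Hg).
have h : is_derive y X (fun z => \sum_c (amb c \o param i) z * 'D_Y (amb c \o param i) z)
   (\sum_c ('D_X (amb c \o param i) y * 'D_Y (amb c \o param i) y
     + (amb c \o param i) y * 'D_X ('D_Y (amb c \o param i)) y)).
  apply: is_derive_bigsum => c _.
  apply: is_derive_mul; apply: smooth_is_derive cy => //; first exact: sa.
  by apply: smooth_derive; exact: sa.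
rewrite -(is_deriveE h).
have T := derive_eq_in oc X (g := cst (0 : R)) (fun z cz => sum_amb_derive Y cz) cy.
by apply: (etrans T); rewrite derive_cst.
Qed.

Lemma sum_amb_grad a x : \sum_c amb c x * grad_at g a (amb c) x = 0.
Proof.
have di : dom (chart_at g x) x := rm_chart_at Hg x.
have cy := codom_coord di; rewrite /grad_at trace_g_sum.
rewrite /trace_g big1// => k _; rewrite big1// => l _.
have T := sum_amb_derive (delta_mx 0 l) cy.
rewrite (_ : \sum_c _ = 0) ?scaler0//.
under eq_bigr => c _ do rewrite mulrCA.
rewrite -mulr_sumr; move: T; rewrite /= (rm_coordK Hg)// => T.
by rewrite [X in _ * X]T mulr0.
Qed.

(** Metric trace of the second derivative of the equation of the sphere. *)
Lemma sum_amb_laplacian x :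
  \sum_c amb c x * laplacian_at g (amb c) x = - energy_at g phi x.
Proof.
have di : dom (chart_at g x) x := rm_chart_at Hg x.
have cy := codom_coord di; set i := chart_at g x in di cy *; set y := crd i x in cy *.
have ux c : amb c x = (amb c \o param i) y by rewrite /= (rm_coordK Hg).
under eq_bigr => c _ do rewrite ux.
rewrite /laplacian_at /laplacian -/i -/y trace_g_sum.
rewrite /energy_at /grad_at /grad_ip -/i -/y.
under [in RHS]eq_bigr => c _ do rewrite -[trace_g _ _ _]mul1r.
rewrite trace_g_sum -mulN1r -trace_gZ; apply: eq_trace_g => X Y.
exact: hessian_sum_algebra (sum_amb_derive (christoffel (metric i) y X Y) cy)
  (sum_amb_derive2 X Y cy).
Qed.

Variables (p : M -> R).

Lemma sum_density x :
  \sum_c density (energy_at g phi x) (p x) (amb c x) 1 (grad_at g (amb c) (amb c) x)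
    (grad_at g p (amb c) x) (grad_at g (energy_at g phi) (amb c) x)
    (laplacian_at g (amb c) x) =
  Num.sqrt (energy_at g phi x) `^ (p x - 2) * ((p x - n%:R) * energy_at g phi x).
Proof.
apply: density_sum; [exact: sum_amb_sqr|by []|exact: sum_amb_grad|exact: sum_amb_grad|].
exact: sum_amb_laplacian.
Qed.

End SphereConstraint.

(** * Domination near a point and compactness *)

(** Otherwise the sets whose complements satisfy P form a proper filter, which has
    no cluster point. *)
Lemma compact_local_global (T : topologicalType) (P : set T -> Prop) :
  compact [set: T] -> P set0 -> (forall A B, P A -> P B -> P (A `|` B)) ->
  (forall A B, A `<=` B -> P B -> P A) ->
  (forall x : T, exists2 A, nbhs x A & P A) -> P [set: T].
Proof.
move=> cT P0 PU PS Pl; apply: contrapT => nP.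
pose F := [set A | P (~` A)].
have fF : Filter F.
  split; first by rewrite /F /= setCT.
    by move=> A B; rewrite /F /= setCI => PA PB; exact: PU.
  by move=> A B AB; rewrite /F /=; apply: PS; exact: subsetC.
have pF : ProperFilter F by split=> //; rewrite /F /= setC0.
have FT : F setT by rewrite /F /= setCT.
have [x [_ cx]] := cT F pF FT.
have [A Ax PA] := Pl x.
have FA : F (~` A) by rewrite /F /= setCK.
by have [z [nz Az]] := cx _ _ FA Ax.
Qed.

Section Domination.
Context {R : realType} {V : normedModType R} (y : V).
Implicit Types (f h w : V -> R).

(** That is, f = O(w) at y. *)
Definition dominated w f := exists2 C : R, 0 <= C & \forall z \near y, `|f z| <= C * w z.

Lemma dominated_add w f h : dominated w f -> dominated w h ->
  dominated w (fun z => f z + h z).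
Proof.
move=> [C C0 fC] [D D0 hD]; exists (C + D); first exact: addr_ge0.
near=> z; rewrite (le_trans (ler_normD _ _))// mulrDl.
by apply: lerD; near: z.
Unshelve. all: by end_near. Qed.

Lemma dominated0 w : (\forall z \near y, 0 <= w z) -> dominated w (fun=> 0).
Proof. by move=> w0; exists 0 => //; near=> z; rewrite normr0 mul0r.
Unshelve. all: by end_near. Qed.

Lemma dominated_sum w (I : Type) (r : seq I) (F : I -> V -> R) :
  (\forall z \near y, 0 <= w z) -> (forall i, dominated w (F i)) ->
  dominated w (fun z => \sum_(i <- r) F i z).
Proof.
move=> w0 dF; elim: r => [|i r IH].
  by under eq_fun do rewrite big_nil; exact: dominated0.
by under eq_fun do rewrite big_cons; exact: dominated_add.
Qed.

Lemma dominated_mul w w' f h : dominated w f -> dominated w' h ->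
  dominated (fun z => w z * w' z) (fun z => f z * h z).
Proof.
move=> [C C0 fC] [D D0 hD]; exists (C * D); first exact: mulr_ge0.
near=> z; rewrite normrM mulrACA.
by apply: ler_pM => //; near: z.
Unshelve. all: by end_near. Qed.

Lemma dominated_continuous f : {for y, continuous f} -> dominated (fun=> 1) f.
Proof.
move=> cf; exists (`|f y| + 1); first by rewrite addr_ge0.
have /cvgrPdist_lt/(_ 1 ltr01) cf1 := cf.
near=> z; rewrite mulr1 -[f z](subrK (f y)) (le_trans (ler_normD _ _))// addrC lerD2l.
by rewrite distrC ltW//; near: z.
Unshelve. all: by end_near. Qed.

Lemma dominated_continuous_mul w f h : {for y, continuous h} -> dominated w f ->
  dominated w (fun z => h z * f z).
Proof.
move=> ch df; have := dominated_mul (dominated_continuous ch) df.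
by under [X in dominated X]eq_fun do rewrite mul1r.
Qed.

End Domination.

Lemma product_rule3 (R : realType) (h p q dh dp dq : R) :
  dh * p * q + (h * dq * p + h * dp * q) = dh * (p * q) + h * (dp * q + p * dq).
Proof. by ring. Qed.

Section EnergyGradient.
Context {R : realType} {m n : nat}.
Variables (U : set 'rV[R]_m) (G : 'rV[R]_m -> 'M[R]_m).
Hypotheses (oU : open U) (sG : smooth_on U G).
Hypotheses (symG : forall y, U y -> (G y)^T = G y).
Hypotheses (posG : forall y, U y -> posdef (G y)).
Variable (u : 'I_n -> 'rV[R]_m -> R).
Hypothesis su : forall c, smooth_on U (u c).
Local Notation e_ := (delta_mx (0 : 'I_1)).

Let S z := \sum_c grad_ip G (u c) (u c) z.

Let du c z : U z -> differentiable (u c) z.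
Proof. by move=> Uz; exact: smooth_differentiable (su c) Uz. Qed.

Let gu0 c z : U z -> 0 <= grad_ip G (u c) (u c) z.
Proof. by move=> Uz; exact: (grad_ip_ge0 symG posG (du c Uz) Uz). Qed.

Let S0 z : U z -> 0 <= S z.
Proof. by move=> Uz; apply: sumr_ge0 => c _; exact: gu0. Qed.

Let smooth_inv a b : smooth_on U (fun z => invmx (G z) a b).
Proof.
apply: (smooth_entry oU); apply: (smooth_invmx oU) => // z Uz.
exact: posdef_unit (posG Uz).
Qed.

Let sS : smooth_on U S.
Proof.
apply: (smooth_sum oU) => c _.
exact: (smooth_grad_ip oU sG posG (su c) (su c)).
Qed.

Let dominated_derive c a y : U y -> dominated y (fun z => Num.sqrt (S z)) ('D_(e_ a) (u c)).
Proof.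
move=> Uy; pose A z := G z a a.
have sA : smooth_on U A by exact: smooth_entry.
have Ay : 0 <= A y by rewrite /A -ip_delta; exact: posdef_ge0 (posG Uy).
exists (Num.sqrt (A y + 1)); first exact: sqrtr_ge0.
have nA : \forall z \near y, A z < A y + 1.
  by apply: (cvgr_lt _ (smooth_continuous sA Uy)); rewrite ltrDl.
have nU : \forall z \near y, U z by exact: near_in_open Uy _.
near=> z; have Uz : U z by near: z.
have Az : A z < A y + 1 by near: z.
rewrite -sqrtr_sqr -sqrtrM; last by rewrite addr_ge0.
rewrite ler_wsqrtr// (le_trans (derive_le_grad_ip symG posG _ (du c Uz) Uz))//.
rewrite ip_delta mulrC; apply: ler_pM.
- by rewrite -ip_delta; exact: posdef_ge0 (posG Uz).
- exact: gu0.
- exact: ltW.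
- by rewrite /S (bigD1 c)//= lerDl; apply: sumr_ge0 => c' _; exact: gu0.
Unshelve. all: by end_near. Qed.

(** As S is a sum of squares, each term of dS keeps a factor that is a derivative
    of some u c, and hence O(sqrt S). *)
Let dominated_derive_energy X y : U y -> dominated y (fun z => Num.sqrt (S z)) ('D_X S).
Proof.
move=> Uy; pose H a b z := invmx (G z) a b; pose P c a z := 'D_(e_ a) (u c) z.
have sP c a : smooth_on U (P c a) by exact: smooth_derive.
have s0 : \forall z \near y, 0 <= Num.sqrt (S z).
  by near=> z; exact: sqrtr_ge0.
pose T z := \sum_c \sum_a \sum_b (('D_X (H a b) z * P c a z) * P c b z
   + ((H a b z * 'D_X (P c b) z) * P c a z + (H a b z * 'D_X (P c a) z) * P c b z)).
have TE z : U z -> 'D_X S z = T z.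
  move=> Uz; apply: is_deriveE; rewrite /T.
  apply: is_derive_bigsum => c _; apply: is_derive_bigsum => a _.
  apply: is_derive_bigsum => b _.
  have h := is_derive_mul (smooth_is_derive X (smooth_inv a b) Uz)
    (is_derive_mul (smooth_is_derive X (sP c a) Uz) (smooth_is_derive X (sP c b) Uz)).
  exact: (is_derive_eq h (esym (product_rule3 _ _ _ _ _ _))).
have [C C0 TC] : dominated y (fun z => Num.sqrt (S z)) T.
  apply: dominated_sum => // c; apply: dominated_sum => // a; apply: dominated_sum => // b.
  have dm (h k : 'rV[R]_m -> R) : smooth_on U h -> dominated y (fun z => Num.sqrt (S z)) k ->
      dominated y (fun z => Num.sqrt (S z)) (fun z => h z * k z).
    by move=> sh dk; exact: (dominated_continuous_mul (smooth_continuous sh Uy) dk).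
  have T1 := dm _ _ (smooth_mul oU (smooth_derive X (smooth_inv a b)) (sP c a)) (dominated_derive c b Uy).
  have T2 := dm _ _ (smooth_mul oU (smooth_inv a b) (smooth_derive X (sP c b))) (dominated_derive c a Uy).
  have T3 := dm _ _ (smooth_mul oU (smooth_inv a b) (smooth_derive X (sP c a))) (dominated_derive c b Uy).
  exact: (dominated_add T1 (dominated_add T2 T3)).
exists C => //; apply: filterS2 TC (near_in_open oU Uy (fun z Uz => Uz)) => z h Uz.
by rewrite TE.
Unshelve. all: by end_near. Qed.

Lemma dominated_grad_energy y : U y -> dominated y S (grad_ip G S S).
Proof.
move=> Uy; have nU : \forall z \near y, U z := near_in_open oU Uy (fun z Uz => Uz).
have nS : \forall z \near y, 0 <= S z by apply: filterS nU => z; exact: S0.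
have dd a b : dominated y S (fun z => 'D_(e_ a) S z * 'D_(e_ b) S z).
  have [C C0 h] := dominated_mul (dominated_derive_energy (e_ a) Uy) (dominated_derive_energy (e_ b) Uy).
  exists C => //; apply: filterS2 h nS => z h Sz.
  by move: h; rewrite -expr2 sqr_sqrtr.
apply: dominated_sum => // a; apply: dominated_sum => // b.
apply: dominated_continuous_mul (dd a b).
exact: smooth_continuous (smooth_inv a b) Uy.
Qed.

End EnergyGradient.

(** * Boundedness of the densities *)

Section BoundedFunctions.
Context {R : realType} {T : Type}.
Implicit Types f h : T -> R.

Definition bdd f := exists C : R, forall x, `|f x| <= C.

Lemma bdd_cst (c : R) : bdd (fun=> c).
Proof. by exists `|c|. Qed.

Lemma bdd_add f h : bdd f -> bdd h -> bdd (fun x => f x + h x).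
Proof.
move=> [C fC] [D hD]; exists (C + D) => x.
by rewrite (le_trans (ler_normD _ _))// lerD.
Qed.

Lemma bdd_mul f h : bdd f -> bdd h -> bdd (fun x => f x * h x).
Proof. by move=> [C fC] [D hD]; exists (C * D) => x; rewrite normrM ler_pM. Qed.

Lemma bdd_opp f : bdd f -> bdd (fun x => - f x).
Proof. by move=> [C fC]; exists C => x; rewrite normrN. Qed.

End BoundedFunctions.

Lemma bdd_continuous (R : realType) (T : topologicalType) (f : T -> R) :
  compact [set: T] -> continuous f -> bdd f.
Proof.
move=> cT cf.
suff [C h] : exists C : R, forall x : T, [set: T] x -> `|f x| <= C.
  by exists C => x; exact: h.
apply: (@compact_local_global _ (fun A => exists C : R, forall x, A x -> `|f x| <= C)) => //.
- by exists 0.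
- move=> A B [C fC] [D fD]; exists (Num.max C D) => x [Ax|Bx]; rewrite le_max.
    by rewrite fC.
  by rewrite fD ?orbT.
- by move=> A B AB [C fC]; exists C => x /AB; exact: fC.
move=> x; exists [set z | `|f z| <= `|f x| + 1]; last by exists (`|f x| + 1).
have /cvgrPdist_lt/(_ 1 ltr01) cf1 := cf x.
near=> z; rewrite /= -[f z](subrK (f x)) (le_trans (ler_normD _ _))// addrC lerD2l.
by rewrite distrC ltW//; near: z.
Unshelve. all: by end_near. Qed.

(** For S <= 1 the bound 4 follows from [mul_ln_ge] at sqrt S; for S >= 1 the
    other summand from ln S <= S. *)
Lemma sqrt_mul_ln_bound (R : realType) (S K : R) : 0 <= S <= K ->
  `|Num.sqrt S * ln S| <= 4 + (1 + K) * K.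
Proof.
move=> /andP[S0 SK]; have K0 := le_trans S0 SK.
have k0 : 0 <= (1 + K) * K by rewrite mulr_ge0// addr_ge0.
have sK : Num.sqrt S <= 1 + K.
  have e : 1 + K = Num.sqrt ((1 + K) ^+ 2) by rewrite sqrtr_sqr ger0_norm// addr_ge0.
  rewrite e ler_wsqrtr// (le_trans SK)// expr2; nra.
have [->|Sn0] := eqVneq S 0; first by rewrite sqrtr0 mul0r normr0 addr_ge0.
have Sp : 0 < S by rewrite lt_neqAle eq_sym Sn0.
have [S1|S1] := leP S 1.
  have lnS : ln S <= 0 by exact: ln_le0.
  rewrite ler0_norm ?mulr_ge0_le0// ?sqrtr_ge0// (@le_trans _ _ 4)// ?lerDl//.
  have s0 : 0 < Num.sqrt S by rewrite sqrtr_gt0.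
  have := mul_ln_ge s0; rewrite -[in ln _]powR12_sqrt// ln_powR.
  have s1 : Num.sqrt (Num.sqrt S) <= 1.
    rewrite -[X in _ <= X]sqrtr1 ler_wsqrtr// -[X in _ <= X]sqrtr1 ler_wsqrtr//.
  by move: (Num.sqrt S) (Num.sqrt _) s1 (ln S) => a b b1 l; nra.
have l0 : 0 <= ln S by rewrite ln_ge0// ltW.
rewrite ger0_norm ?mulr_ge0 ?sqrtr_ge0//.
rewrite (@le_trans _ _ ((1 + K) * K)) ?lerDr//.
apply: ler_pM => //.
by rewrite (le_trans _ SK)// ltW// ln_sublinear.
Qed.

Lemma powR_sqrt_bound (R : realType) (S K q N : R) : 0 <= S <= K -> 2 <= q <= N ->
  Num.sqrt S `^ (q - 2) <= (1 + K) `^ (N - 2).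
Proof.
move=> /andP[S0 SK] /andP[q2 qN]; have K0 := le_trans S0 SK.
have sK : Num.sqrt S <= 1 + K.
  have e : 1 + K = Num.sqrt ((1 + K) ^+ 2) by rewrite sqrtr_sqr ger0_norm// addr_ge0.
  rewrite e ler_wsqrtr// (le_trans SK)// expr2; nra.
apply: (@le_trans _ _ ((1 + K) `^ (q - 2))).
  by apply: ge0_ler_powR; rewrite ?nnegrE ?subr_ge0 ?sqrtr_ge0 ?addr_ge0.
by apply: ler_powR; rewrite ?lerDl ?lerD2r.
Qed.

Lemma norm_le_of_sqr (R : realType) (a b c : R) : 0 <= b -> 0 <= c ->
  a ^+ 2 <= b ^+ 2 * c -> `|a| <= b * Num.sqrt c.
Proof.
move=> b0 c0 h; rewrite -sqrtr_sqr -[b]ger0_norm// -sqrtr_sqr -sqrtrM ?sqr_ge0//.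
exact: ler_wsqrtr.
Qed.

Section DensityBounds.
Context {R : realType} {M : ptopologicalType} {m n : nat}.
Variable g : riem_atlas R M m.
Hypothesis Hg : riemannian_manifold g.
Hypothesis cM : compact [set: M].
Variables (p : M -> R) (phi : M -> sphere R n).
Hypothesis sphi : smooth_map g (sphere_atlas R n) phi.
Hypothesis sp : smooth_function g p.
Hypothesis p2 : forall x, 2 <= p x <= n%:R.
Implicit Types (i : chart_index g) (x : M) (c : 'I_n.+1).
Local Notation crd i := (@Defs.coord R M m g i).
Local Notation amb := (amb phi).
Local Notation S := (energy_at g phi).
Local Notation sa := (smooth_amb Hg sphi).
Local Notation sS := (smooth_energy_at Hg sphi).

Let bddC a : smooth_function g a -> bdd a.
Proof.
by move=> sa'; apply: (bdd_continuous cM); exact: (smooth_function_continuous Hg sa').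
Qed.

Let diff_chart a x : smooth_function g a ->
  differentiable (a \o param (chart_at g x)) (crd (chart_at g x) x).
Proof.
move=> sa'; apply: smooth_differentiable (sa' _) _.
exact: codom_coord (rm_chart_at Hg x).
Qed.

Let cx x : codom_chart (chart_at g x) (crd (chart_at g x) x).
Proof. exact: codom_coord (rm_chart_at Hg x). Qed.

Lemma grad_at_ge0 a x : smooth_function g a -> 0 <= grad_at g a a x.
Proof.
move=> sa'; exact: (grad_ip_ge0 (@chart_symmetric _ _ _ _ Hg _) (@chart_posdef _ _ _ _ Hg _)
  (diff_chart x sa') (cx x)).
Qed.

Lemma grad_at_cauchy_schwarz a b x : smooth_function g a -> smooth_function g b ->
  grad_at g a b x ^+ 2 <= grad_at g a a x * grad_at g b b x.
Proof.
move=> sa' sb; rewrite /grad_at !(grad_ipE (@chart_symmetric _ _ _ _ Hg _)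
  (@chart_posdef _ _ _ _ Hg _) _ _ (cx x)); try exact: diff_chart.
by apply: ip_cauchy_schwarz; [exact: chart_symmetric|exact: chart_posdef].
Qed.

Lemma energy_at_ge0 x : 0 <= S x.
Proof. by apply: sumr_ge0 => c _; apply: grad_at_ge0; exact: sa. Qed.

Lemma grad_amb_le c x : grad_at g (amb c) (amb c) x <= S x.
Proof.
rewrite /energy_at (bigD1 c)//= lerDl; apply: sumr_ge0 => d _.
by apply: grad_at_ge0; exact: sa.
Qed.

Lemma grad_energy_le : exists2 C : R, 0 <= C & forall x, grad_at g S S x <= C * S x.
Proof.
suff [C C0 h] : exists2 C : R, 0 <= C & forall x, [set: M] x -> grad_at g S S x <= C * S x.
  by exists C => // x; exact: h.
apply: (@compact_local_global _ (fun A => exists2 C : R, 0 <= C &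
  forall x, A x -> grad_at g S S x <= C * S x)) => //.
- by exists 0.
- move=> A B [C C0 fC] [D D0 fD]; exists (C + D); first exact: addr_ge0.
  move=> x [Ax|Bx]; rewrite mulrDl.
    by rewrite (le_trans (fC _ Ax))// lerDl mulr_ge0// energy_at_ge0.
  by rewrite (le_trans (fD _ Bx))// lerDr mulr_ge0// energy_at_ge0.
- by move=> A B AB [C C0 fC]; exists C => // x /AB; exact: fC.
move=> x0; set i := chart_at g x0; have di : dom i x0 := rm_chart_at Hg x0.
have oc : open (codom_chart i) by exact: open_codom.
have SE z : codom_chart i z -> (S \o param i) z =
    \sum_c grad_ip (metric i) (amb c \o param i) (amb c \o param i) z.
  move=> cz; rewrite /= /energy_at; apply: eq_bigr => c _.
  by rewrite (grad_at_chart Hg (sa c) (sa c) (dom_param Hg cz)) (param_coord Hg cz).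
have [C C0 dC] := dominated_grad_energy oc (rm_metric_smooth Hg i)
  (@chart_symmetric _ _ _ _ Hg i) (@chart_posdef _ _ _ _ Hg i) (fun c => sa c i) (codom_coord di).
exists [set x | dom i x /\ grad_at g S S x <= C * S x]; last by exists C => // x [].
have nd : \forall x \near x0, dom i x.
  by apply: open_nbhs_nbhs; split=> //; exact: open_dom.
have cc := coord_continuous_at Hg di.
have nC := cc _ dC.
near=> x; have dx : dom i x by near: x.
have cz := codom_coord dx.
split=> //; rewrite (grad_at_chart Hg sS sS dx) (grad_ip_eq_in oc (metric i) SE SE cz).
have <- : (S \o param i) (crd i x) = S x by rewrite /= (rm_coordK Hg).
by rewrite SE// (le_trans (ler_norm _))//; near: x.
Unshelve. all: by end_near. Qed.

(** The density is bounded: |<dq, du>| = O(sqrt S) absorbs the logarithm, and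
    |<dS, du>| = O(S) the quotient by S. *)
Lemma bdd_density c : bdd (fun x => density (S x) (p x) (amb c x) 1
    (grad_at g (amb c) (amb c) x) (grad_at g p (amb c) x) (grad_at g S (amb c) x)
    (laplacian_at g (amb c) x)).
Proof.
have [K hK] := bddC sS.
have SK x : 0 <= S x <= K.
  by rewrite energy_at_ge0 (le_trans (ler_norm _) (hK x)).
have bS := bddC sS; have bp := bddC sp; have bu := bddC (sa c).
have bgu := bddC (smooth_grad_at Hg (sa c) (sa c)).
have bgp := bddC (smooth_grad_at Hg sp (sa c)).
have bL := bddC (smooth_laplacian_at Hg (sa c)).
have bP : bdd (fun x => Num.sqrt (S x) `^ (p x - 2)).
  exists ((1 + K) `^ (n%:R - 2)) => x; rewrite ger0_norm ?powR_ge0//.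
  exact: powR_sqrt_bound (SK x) (p2 x).
have gu_le x := grad_amb_le c x.
have bln : bdd (fun x => grad_at g p (amb c) x * ln (S x)).
  have [D hD] := bddC (smooth_grad_at Hg sp sp).
  exists (Num.sqrt D * (4 + (1 + K) * K)) => x.
  have D0 : 0 <= D by rewrite (le_trans _ (hD x)).
  have h : `|grad_at g p (amb c) x| <= Num.sqrt D * Num.sqrt (S x).
    apply: norm_le_of_sqr; rewrite ?sqrtr_ge0 ?energy_at_ge0// sqr_sqrtr//.
    apply: le_trans (grad_at_cauchy_schwarz x sp (sa c)) _.
    apply: ler_pM => //; [exact: grad_at_ge0 sp|exact: grad_at_ge0 (sa c)|].
    exact: le_trans (ler_norm _) (hD x).
  rewrite normrM; apply: (@le_trans _ _ (Num.sqrt D * Num.sqrt (S x) * `|ln (S x)|)).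
    by apply: ler_wpM2r.
  rewrite -mulrA; apply: ler_wpM2l; first exact: sqrtr_ge0.
  have := sqrt_mul_ln_bound (SK x).
  by rewrite normrM (ger0_norm (sqrtr_ge0 _)).
have bq : bdd (fun x => grad_at g S (amb c) x / S x).
  have [C C0 hC] := grad_energy_le.
  exists (Num.sqrt C) => x.
  have [S0|Sn0] := eqVneq (S x) 0; first by rewrite S0 invr0 mulr0 normr0 sqrtr_ge0.
  have Sp : 0 < S x by rewrite lt_neqAle eq_sym Sn0 energy_at_ge0.
  rewrite normrM normfV (gtr0_norm Sp) ler_pdivrMr//.
  have -> : S x = Num.sqrt (S x ^+ 2) by rewrite sqrtr_sqr gtr0_norm.
  apply: norm_le_of_sqr; rewrite ?sqrtr_ge0 ?sqr_ge0// sqr_sqrtr//.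
  apply: le_trans (grad_at_cauchy_schwarz x sS (sa c)) _.
  rewrite expr2 mulrA; apply: ler_pM => //; [exact: grad_at_ge0 sS|exact: grad_at_ge0 (sa c)].
have bpm k : bdd (fun x => p x - k) by apply: bdd_add => //; exact: bdd_cst.
have bu2 : bdd (fun x => amb c x ^+ 2) by exact: bdd_mul.
apply: bdd_mul => //; apply: bdd_add; last exact: bdd_mul.
apply: bdd_add; first apply: bdd_add.
- apply: bdd_opp; apply: bdd_mul => //; apply: bdd_add; first exact: bdd_cst.
  exact: bdd_opp.
- exact: bdd_mul.
- apply: bdd_mul; first by apply: bdd_mul.
  apply: bdd_add; last exact: bdd_mul.
  apply: bdd_add => //; apply: bdd_mul; first exact: bdd_cst.
  by apply: bdd_add => //; exact: bdd_mul.
Qed.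

End DensityBounds.

(** * Volumes of cubes *)

Section IteratedIntegral.
Context {R : realType}.

(** Integrals of nonnegative functions are suprema over the simple functions
    below them. This covers the inner iterated integrals, whose measurability is
    unclear. *)
Lemma integral_nonneg_le d (T : measurableType d) (mu : {measure set T -> \bar R})
    (f h : T -> \bar R) : (forall x, 0 <= f x)%E -> (forall x, f x <= h x)%E ->
  (\int[mu]_x f x <= \int[mu]_x h x)%E.
Proof.
move=> f0 fh; have h0 x : (0 <= h x)%E by exact: le_trans (f0 x) (fh x).
rewrite !ge0_integralTE//; apply: le_ereal_sup => _ [k /= kf <-]; exists k => // x.
exact: le_trans (kf x) (fh x).
Qed.

Lemma lebesgue_int_ge0 m (F : 'rV[R]_m -> \bar R) :
  (forall y, 0 <= F y)%E -> (0 <= lebesgue_int F)%E.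
Proof.
elim: m F => [|m IH] F F0; first exact: F0.
by apply: integral_ge0 => t _; apply: IH => y; exact: F0.
Qed.

Lemma lebesgue_int_le m (F F' : 'rV[R]_m -> \bar R) :
  (forall y, 0 <= F y)%E -> (forall y, F y <= F' y)%E ->
  (lebesgue_int F <= lebesgue_int F')%E.
Proof.
elim: m F F' => [|m IH] F F' F0 FF; first exact: FF.
apply: integral_nonneg_le => t; first by apply: lebesgue_int_ge0 => y; exact: F0.
by apply: IH => y; [exact: F0|exact: FF].
Qed.

Definition box m (a : 'rV[R]_m) (r : R) : set 'rV[R]_m :=
  [set y | forall i, `|y 0 i - a 0 i| < r].

Lemma box_row_mx m (a : 'rV[R]_(1 + m)) r t (y : 'rV[R]_m) :
  box a r (row_mx t%:M y) <-> `|t - lsubmx a 0 0| < r /\ box (rsubmx a) r y.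
Proof.
split=> [h|[h1 h2] i].
  split=> [|i]; first by have := h (lshift m 0); rewrite row_mxEl !mxE eqxx.
  by have := h (rshift 1 i); rewrite row_mxEr !mxE.
case: (split_ordP i) => k ->.
  by rewrite row_mxEl ord1 mxE eqxx; move: h1; rewrite mxE.
by rewrite row_mxEr; have := h2 k; rewrite mxE.
Qed.

(** The factor c carries the indicator of the outer variables in the induction. *)
Lemma lebesgue_int_box m (a : 'rV[R]_m) (c r : R) : 0 <= c -> 0 < r ->
  lebesgue_int (fun y => (c * \1_(box a r) y)%:E) = (c * (2 * r) ^+ m)%:E.
Proof.
elim: m a c => [|m IH] a c c0 r0.
  by rewrite /= indicE mem_set ?mulr1 ?expr0// => -[].
move: (a : 'rV[R]_(1 + m)) => {}a.
pose I : set R := `](lsubmx a 0 0 - r), (lsubmx a 0 0 + r)[%classic.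
have IE t : \1_I t = ((`|t - lsubmx a 0 0| < r)%R : bool)%:R :> R.
  by rewrite indicE /I mem_setE in_itv/= -ltr_distlC distrC.
rewrite /=; transitivity (\int[@lebesgue_measure R]_t ((c * (2 * r) ^+ m)%:E * (\1_I t)%:E))%E.
  apply: eq_integral => t _.
  have -> : (fun y : 'rV[R]_m => (c * \1_(box a r) (row_mx t%:M y))%:E) =
     (fun y => ((c * \1_I t) * \1_(box (rsubmx a) r) y)%:E).
    apply/funext => y; rewrite IE -mulrA !indicE; congr (_ * _)%:E.
    rewrite -natrM mulnb; congr (nat_of_bool _)%:R.
    apply/idP/andP => [/set_mem/box_row_mx[h1 h2]|[h1 /set_mem h2]].
      by split=> //; exact/mem_set.
    by apply/mem_set/box_row_mx.
  rewrite IH//; last by rewrite mulr_ge0.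
  by rewrite -EFinM mulrAC.
rewrite ge0_integralZl_EFin//; last by rewrite mulr_ge0// exprn_ge0// mulr_ge0// ltW.
- rewrite integral_indic//=. rewrite ?setIT lebesgue_measure_itv/= lte_fin ltrD2l gtrN//.
  rewrite -EFinB -EFinM exprSr mulrA; congr (_ * _)%:E; ring.
- exact: measurable_itv.
- by apply/measurable_EFinP; apply: measurable_indic; exact: measurable_itv.
Qed.

End IteratedIntegral.

(** The determinant does not vanish on the segment from the identity, whose
    matrices are all positive definite. *)
Lemma posdef_det_gt0 (R : realType) m (A : 'M[R]_m) : posdef A -> 0 < \det A.
Proof.
move=> pA; rewrite ltNge; apply/negP => d0.
pose B : 'M[{poly R}]_m := map_mx polyC 1%:M + 'X *: map_mx polyC (A - 1%:M).
have BE t : (\det B).[t] = \det (1%:M + t *: (A - 1%:M)).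
  rewrite -horner_evalE -det_map_mx; congr (\det _); apply/matrixP => i j.
  by rewrite !mxE /= horner_evalE !hornerE.
have [||t /andP[t0 t1]] := @poly_ivt R (- \det B) 0 1.
- exact: ler01.
- rewrite !hornerN !BE scale0r addr0 det1 scale1r addrC subrK.
  by rewrite oppr_le0 ler01 oppr_ge0.
rewrite rootN => /rootP; rewrite BE => dt.
have pt : posdef (1%:M + t *: (A - 1%:M)).
  move=> X X0; have -> : ip (1%:M + t *: (A - 1%:M)) X X = (1 - t) * dot X X + t * ip A X X.
    rewrite /ip mulmxDr mulmxDl -scalemxAr -scalemxAl mulmxBr mulmxBl mulmx1 !mxE.
    rewrite (_ : \sum_j X 0 j * X^T j 0 = dot X X); last first.
      by apply: eq_bigr => j _; rewrite mxE.
    by ring.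
  have dX : 0 < dot X X.
    have [i Xi] : exists i, X 0 i != 0.
      by apply/existsP; apply: contraNT X0; rewrite negb_exists => /forallP X0;
         apply/eqP/rowP => i; rewrite mxE; apply/eqP; have := X0 i; rewrite negbK.
    rewrite /dot (bigD1 i)//= ltr_pwDl//; first by rewrite -expr2 exprn_even_gt0.
    by apply: sumr_ge0 => j _; rewrite -expr2 sqr_ge0.
  have [->|tn0] := eqVneq t 0; first by rewrite subr0 mul1r mul0r addr0.
  rewrite ltr_wpDl//; first by rewrite mulr_ge0 ?subr_ge0// ltW.
  by rewrite mulr_gt0 ?pA// lt_neqAle eq_sym tn0.
have := posdef_unit pt.
by rewrite unitmxE dt unitr0.
Qed.

(** * Volumes of open sets *)

Section VolumeMeasure.
Context {R : realType} {M : ptopologicalType} {m : nat}.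
Variable g : riem_atlas R M m.
Hypothesis Hg : riemannian_manifold g.
Variable mu : {measure set (borel M) -> \bar R}.
Hypothesis vol : volume_measure g mu.
Local Notation crd i := (@Defs.coord R M m g i).

Lemma borel_open (A : set M) : open A -> measurable (A : set (borel M)).
Proof. by move=> oA; apply: sub_sigma_algebra. Qed.

Lemma borel_continuous (f : M -> R) :
  continuous f -> measurable_fun setT (f : borel M -> R).
Proof.
move=> /continuousP cf; apply: (measurability _ (RGenOpens.measurableE R)).
move=> _ [_ [a [b ->] <-]]; rewrite setTI; apply: borel_open.
exact/cf/interval_open.
Qed.

Lemma box_ball (a : 'rV[R]_m) r : 0 < r -> box a r = ball a r.
Proof.
move=> r0; apply/seteqP; split=> y.
  by move=> h; split=> // i j; rewrite ord1 -ball_normE /ball_ /= distrC; exact: h.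
by move=> [_ h] i; have := h 0 i; rewrite -ball_normE /ball_ /= distrC.
Qed.

Lemma open_box (a : 'rV[R]_m) r : 0 < r -> open (box a r).
Proof. by move=> r0; rewrite box_ball//; exact: ball_open. Qed.

(** A small cube in a chart, on which the volume density lies between two positive
    constants. *)
Lemma volume_small_cube (x : M) (O : set M) : open O -> O x ->
  exists A : set M, [/\ open A, A x, A `<=` O & (0 < mu A < +oo)%E].
Proof.
move=> oO Ox; set i := chart_at g x; have di : dom i x := rm_chart_at Hg x.
have oc : open (codom_chart i) by exact: open_codom.
set y := crd i x; have cy : codom_chart i y by exact: codom_coord.
pose B := codom_chart i `&` param i @^-1` O.
have oB : open B by exact: open_param_preimage.
have By : B y by split=> //; rewrite /= (rm_coordK Hg).
pose D z := \det (metric i z).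
have sD : smooth_on (codom_chart i) D by apply: (smooth_det oc); exact: (rm_metric_smooth Hg i).
have Dy : 0 < D y by apply: posdef_det_gt0; exact: chart_posdef.
have cD := smooth_continuous sD cy.
have nB : \forall z \near y, B z /\ D y / 2 < D z < D y * 2.
  near=> z; split; first by near: z; exact: open_nbhs_nbhs.
  apply/andP; split; near: z.
    by apply: (cvgr_gt _ cD); rewrite ltr_pdivrMr// ltr_pMr// ltr1n.
  by apply: (cvgr_lt _ cD); rewrite ltr_pMr// ltr1n.
have [r /= r0 rB] := (nbhs_ballP _ _).1 nB.
have boxE z : box y r z -> B z /\ D y / 2 < D z < D y * 2.
  by rewrite box_ball//; exact: rB.
pose A : set M := dom i `&` crd i @^-1` (box y r).
have AE : crd i @` A = box y r.
  apply/seteqP; split=> z; first by move=> [w [_ h] <-].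
  move=> h; have [[cz _] _] := boxE _ h.
  by exists (param i z); rewrite ?param_coord//; split; [exact: dom_param|rewrite /= param_coord].
have oA : open A.
  have od : open (dom i) by exact: open_dom.
  have := rm_coord_continuous Hg (i := i); rewrite continuous_open_subspace//.
  by move=> /(continuous_inP _ od); apply; exact: open_box.
exists A; split => //.
- by split=> // j; rewrite subrr normr0.
- by move=> w [dw /boxE[[_ Ow] _]]; move: Ow; rewrite /= (rm_coordK Hg).
have Adom : A `<=` dom i by move=> w [].
rewrite (vol (borel_open oA) Adom) AE.
have ind01 z : 0 <= \1_(box y r) z :> R by rewrite indicE.
apply/andP; split.
  apply: (@lt_le_trans _ _ (lebesgue_int (fun z => (Num.sqrt (D y / 2) * \1_(box y r) z)%:E))).
    by rewrite lebesgue_int_box ?sqrtr_ge0// lte_fin mulr_gt0 ?sqrtr_gt0 ?divr_gt0// exprn_gt0// mulr_gt0.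
  apply: lebesgue_int_le => z; rewrite lee_fin; first by rewrite mulr_ge0 ?sqrtr_ge0.
  rewrite mulrC indicE; case: (boolP (z \in box y r)) => [/set_mem zb|_]; last by rewrite !mul0r.
  rewrite !mul1r ler_wsqrtr//; have [_ /andP[h _]] := boxE _ zb.
  exact: ltW.
apply: (@le_lt_trans _ _ (lebesgue_int (fun z => (Num.sqrt (D y * 2) * \1_(box y r) z)%:E))).
  apply: lebesgue_int_le => z; rewrite lee_fin; first by rewrite mulr_ge0 ?sqrtr_ge0.
  rewrite [leRHS]mulrC indicE; case: (boolP (z \in box y r)) => [/set_mem zb|_]; last by rewrite !mul0r.
  rewrite !mul1r ler_wsqrtr//; have [_ /andP[_ h]] := boxE _ zb.
  exact: ltW.
by rewrite lebesgue_int_box ?sqrtr_ge0// ltry.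
Unshelve. all: by end_near. Qed.

Lemma volume_finite : compact [set: M] -> (mu setT < +oo)%E.
Proof.
move=> cM.
suff [A [oA TA muA]] : exists A : set M, [/\ open A, [set: M] `<=` A & (mu A < +oo)%E].
  by have -> : [set: borel M] = A by apply/seteqP; split.
apply: (@compact_local_global _ (fun B => exists A : set M,
  [/\ open A, B `<=` A & (mu A < +oo)%E])) => //.
- by exists set0; split=> //; [exact: open0|rewrite measure0].
- move=> B B' [A [oA BA fA]] [A' [oA' BA' fA']]; exists (A `|` A'); split.
  + exact: openU.
  + by move=> x [/BA|/BA']; [left|right].
  + apply: le_lt_trans (measureU2 _ _ _) _; [exact: borel_open|exact: borel_open|].
    exact: lte_add_pinfty.
- by move=> B B' BB' [A [oA BA fA]]; exists A; split=> // x /BB' /BA.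
move=> x; have [A [oA Ax _ /andP[_ fA]]] := volume_small_cube openT (I : [set: M] x).
by exists A; [apply: open_nbhs_nbhs; split|exists A; split].
Qed.

End VolumeMeasure.

(** * Measurability of the densities *)

Lemma measurable_powR_fun (R : realType) d (T : measurableType d) (s e : T -> R) :
  measurable_fun setT s -> measurable_fun setT e ->
  measurable_fun setT (fun x => s x `^ e x).
Proof.
move=> ms me.
have -> : (fun x => s x `^ e x) =
  (fun x => if s x == 0 then (if e x == 0 then 1 else 0) else expR (e x * ln (s x))).
  by apply/funext => x; rewrite /powR; case: (s x == 0) => //; case: (e x == 0).
apply: measurable_fun_ifT.
- by apply: measurable_fun_eqr => //; exact: measurable_cst.
- apply: measurable_fun_ifT; [|exact: measurable_cst|exact: measurable_cst].
  by apply: measurable_fun_eqr => //; exact: measurable_cst.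
- apply: measurableT_comp; first exact: measurable_expR.
  by apply: measurable_funM => //; apply: measurableT_comp => //; exact: measurable_ln.
Qed.

(** Where s is positive, 1 / s is exp (- ln s). *)
Lemma measurable_divide_fun (R : realType) d (T : measurableType d) (s e : T -> R) :
  measurable_fun setT s -> measurable_fun setT e -> (forall x, 0 <= s x) ->
  measurable_fun setT (fun x => e x / s x).
Proof.
move=> ms me s0.
have -> : (fun x => e x / s x) =
  (fun x => if s x == 0 then 0 else e x * expR (- ln (s x))).
  apply/funext => x; case: eqVneq => [->|sn0]; first by rewrite invr0 mulr0.
  have sp : 0 < s x by rewrite lt_neqAle eq_sym sn0 s0.
  by rewrite expRN lnK.
apply: measurable_fun_ifT; [|exact: measurable_cst|].
  by apply: measurable_fun_eqr => //; exact: measurable_cst.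
apply: measurable_funM => //; apply: measurableT_comp; first exact: measurable_expR.
by apply: measurableT_comp => //; apply: measurableT_comp => //; exact: measurable_ln.
Qed.

Lemma measurable_density (R : realType) d (T : measurableType d)
    (S q u gu gqu gSu L : T -> R) : (forall x, 0 <= S x) ->
  measurable_fun setT S -> measurable_fun setT q -> measurable_fun setT u ->
  measurable_fun setT gu -> measurable_fun setT gqu -> measurable_fun setT gSu ->
  measurable_fun setT L ->
  measurable_fun setT (fun x => density (S x) (q x) (u x) 1 (gu x) (gqu x) (gSu x) (L x)).
Proof.
move=> S0 mS mq mu mgu mgqu mgSu mL.
have mc (c : R) : measurable_fun [set: T] (fun=> c) by exact: measurable_cst.
have msub (c : R) : measurable_fun setT (fun x => q x - c) by exact: measurable_funB.
have mu2 : measurable_fun setT (fun x => u x ^+ 2) by exact: measurable_funX.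
have ms : measurable_fun setT (fun x => Num.sqrt (S x)).
  have -> : (fun x => Num.sqrt (S x)) = (fun x => S x `^ 2^-1).
    by apply/funext => x; rewrite powR12_sqrt.
  exact: measurable_powR_fun.
have mln : measurable_fun setT (fun x => ln (S x)).
  by apply: measurableT_comp => //; exact: measurable_ln.
have mdiv := measurable_divide_fun mS mgSu S0.
rewrite /density; apply: measurable_funM; first exact: measurable_powR_fun.
apply: measurable_funD; last exact: measurable_funM.
apply: measurable_funD; first apply: measurable_funD.
- by apply: measurableT_comp => //; apply: measurable_funM => //; exact: measurable_funB.
- exact: measurable_funM.
- apply: measurable_funM; first exact: measurable_funM.
  apply: measurable_funD; last exact: measurable_funM.
  apply: measurable_funD => //; apply: measurable_funM => //.
  by apply: measurable_funD; apply: measurable_funM.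
Qed.

(** * Vanishing of the differential *)

Section RintegralSum.
Context {d} {T : measurableType d} {R : realType}.
Variable mu : {measure set T -> \bar R}.

Lemma integrable_Rsum (I : Type) (r : seq I) (f : I -> T -> R) :
  (forall i, mu.-integrable setT (EFin \o f i)) ->
  mu.-integrable setT (EFin \o (fun x => \sum_(i <- r) f i x)).
Proof.
move=> If; elim: r => [|i r IH].
  rewrite (_ : _ \o _ = cst 0%E); first exact: integrable0.
  by apply/funext => x /=; rewrite big_nil.
rewrite (_ : _ \o _ = (EFin \o f i) \+ (EFin \o (fun x => (\sum_(j <- r) f j x)%R)))%E.
  exact: integrableD.
by apply/funext => x /=; rewrite big_cons EFinD.
Qed.

Lemma Rintegral_Rsum (I : Type) (r : seq I) (f : I -> T -> R) :
  (forall i, mu.-integrable setT (EFin \o f i)) ->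
  \int[mu]_x (\sum_(i <- r) f i x) = \sum_(i <- r) \int[mu]_x f i x.
Proof.
move=> If; elim: r => [|i r IH].
  rewrite big_nil -[RHS]/(fine 0%E) /Rintegral; congr fine.
  by apply: integral0_eq => x _; rewrite big_nil.
rewrite big_cons -IH -RintegralD//; last exact: integrable_Rsum.
by apply: eq_Rintegral => x _; rewrite big_cons.
Qed.

End RintegralSum.

Section Vanishing.
Context {R : realType} {M : ptopologicalType} {m n : nat}.
Variable g : riem_atlas R M m.
Hypothesis Hg : riemannian_manifold g.
Hypothesis cM : compact [set: M].
Variables (mu : {measure set (borel M) -> \bar R}) (p : M -> R) (phi : M -> sphere R n).
Hypothesis vol : volume_measure g mu.
Hypothesis sphi : smooth_map g (sphere_atlas R n) phi.
Hypothesis sp : smooth_function g p.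
Hypothesis pn : forall x, 2 <= p x < n%:R.
Hypothesis stable : forall v, field_along g (h := sphere_atlas R n) phi v ->
  0 <= index_form g (h := sphere_atlas R n) mu p phi v.
Local Notation amb := (amb phi).
Local Notation S := (energy_at g phi).
Local Notation crd i := (@Defs.coord R M m g i).

Let dens c x := density (S x) (p x) (amb c x) 1 (grad_at g (amb c) (amb c) x)
  (grad_at g p (amb c) x) (grad_at g S (amb c) x) (laplacian_at g (amb c) x).

Let sa c := smooth_amb Hg sphi c.
Let sS := smooth_energy_at Hg sphi.

Let meas a : smooth_function g a -> measurable_fun setT (a : borel M -> R).
Proof. by move=> sa'; exact: (borel_continuous (smooth_function_continuous Hg sa')). Qed.

Lemma integrable_dens c : mu.-integrable setT (EFin \o (dens c : borel M -> R)).
Proof.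
apply: measurable_bounded_integrable => //.
- exact (volume_finite Hg vol cM).
- apply: measurable_density.
  + by move=> x; exact: energy_at_ge0.
  + exact: meas.
  + exact: meas.
  + exact: meas.
  + by apply: meas; exact: smooth_grad_at.
  + by apply: meas; exact: smooth_grad_at.
  + by apply: meas; exact: smooth_grad_at.
  + by apply: meas; exact: smooth_laplacian_at.
have pn' x : 2 <= p x <= n%:R by have /andP[-> /ltW] := pn x.
have [C hC] := bdd_density Hg cM sphi sp pn' c.
exists C; split; first exact: num_real.
by move=> D CD x _; exact: le_trans (hC x) (ltW CD).
Qed.

Lemma Rintegral_dens_ge0 c : 0 <= \int[mu]_x dens c x.
Proof.
have := stable (test_field_along sphi c); rewrite /index_form.
rewrite (_ : jacobi_density g (h := sphere_atlas R n) p phi (test_field phi c) = dens c)//.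
apply/funext => x; apply: jacobi_density_test_field => //.
by move=> z; have /andP[] := pn z.
Qed.

(** This is (n - p) |d phi|^p. *)
Let rho x := Num.sqrt (S x) `^ (p x - 2) * ((n%:R - p x) * S x).

Let rho_ge0 x : 0 <= rho x.
Proof.
have /andP[_ /ltW pnx] := pn x.
by rewrite /rho mulr_ge0 ?powR_ge0// mulr_ge0 ?subr_ge0// energy_at_ge0.
Qed.

Let rhoE x : rho x = - \sum_c dens c x.
Proof.
by rewrite /dens (sum_density Hg sphi) /rho -mulrN -mulNr opprB.
Qed.

Let integral_rho : (\int[mu]_x `|(rho x)%:E| = 0)%E.
Proof.
have Id : mu.-integrable setT (EFin \o (fun x : borel M => \sum_c dens c x)).
  by apply: integrable_Rsum => c; exact: integrable_dens.
have rE : EFin \o (rho : borel M -> R) = (fun x => (-1)%:E * ((\sum_c dens c x)%R)%:E)%E.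
  by apply/funext => x /=; rewrite rhoE -EFinM mulN1r.
have Ir : mu.-integrable setT (EFin \o (rho : borel M -> R)).
  by rewrite rE; exact: integrableZl.
have r0 : \int[mu]_x rho x <= 0.
  have -> : \int[mu]_x rho x = -1 * \int[mu]_x (\sum_c dens c x).
    by rewrite -RintegralZl//; apply: eq_Rintegral => x _; rewrite rhoE mulN1r.
  rewrite mulN1r oppr_le0 Rintegral_Rsum; last exact: integrable_dens.
  by apply: sumr_ge0 => c _; exact: Rintegral_dens_ge0.
under eq_integral => x _ do rewrite gee0_abs ?lee_fin//.
have fin := integrable_fin_num measurableT Ir.
apply/eqP; rewrite eq_le; apply/andP; split.
  by rewrite -(fineK fin) lee_fin.
by apply: integral_ge0 => x _; rewrite lee_fin.
Qed.

(** If S were positive at a point, it would be so on an open set, and nonempty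
    open sets are not null. *)
Lemma energy_eq0 x : S x = 0.
Proof.
apply/eqP; rewrite -[_ == _]negbK; apply/negP => Sx0.
have oO : open [set z | 0 < S z].
  have -> : [set z | 0 < S z] = S @^-1` [set t | 0 < t] by [].
  by move/continuousP: (smooth_function_continuous Hg sS); apply; exact: open_gt.
have Ox : [set z | 0 < S z] x.
  by rewrite /= lt_neqAle eq_sym Sx0 energy_at_ge0.
have [A [oA Ax AO /andP[muA _]]] := volume_small_cube Hg vol oO Ox.
have mr : measurable_fun setT (EFin \o (rho : borel M -> R)).
  apply/measurable_EFinP; rewrite (_ : rho = fun x => - \sum_c dens c x); last first.
    by apply/funext => z; exact: rhoE.
  apply: measurableT_comp => //; apply: measurable_sum => c.
  by have /integrableP[/measurable_EFinP] := integrable_dens c.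
have [N [mN muN0 sub]] := (ae_eq_integral_abs mu measurableT mr).1 integral_rho.
have AN : A `<=` N.
  move=> z /AO /= Sz; apply: sub => /= h; have := h I.
  move=> [] /eqP; rewrite /rho mulf_eq0 powR_eq0 sqrtr_eq0 leNgt Sz /=.
  have /andP[_ pnz] := pn z.
  by rewrite mulf_eq0 subr_eq0 !gt_eqF.
have le : (mu A <= mu N)%E := le_measure mu (mem_set (borel_open oA)) (mem_set mN) AN.
have := lt_le_trans muA le.
by rewrite -[mu N]/(_ N) muN0 ltxx.
Qed.

(** The derivatives of the ambient coordinates vanish, and small balls in a chart
    are convex. *)
Lemma amb_locally_constant c x : \forall z \near x, amb c z = amb c x.
Proof.
set i := chart_at g x; have di : dom i x := rm_chart_at Hg x.
have oc : open (codom_chart i) by exact: open_codom.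
have D0 z X : codom_chart i z -> 'D_X (amb c \o param i) z = 0.
  move=> cz; have dz := smooth_differentiable (sa c i) cz.
  apply: (grad_ip_eq0 (@chart_symmetric _ _ _ _ Hg i) (@chart_posdef _ _ _ _ Hg i) X dz cz).
  have := grad_at_chart Hg (sa c) (sa c) (dom_param Hg cz).
  rewrite (param_coord Hg cz) => <-; apply/eqP; rewrite eq_le (grad_at_ge0 Hg _ (sa c)) andbT.
  rewrite -(energy_eq0 (param i z)).
  exact: grad_amb_le.
have cy := codom_coord di; set y := crd i x in cy.
have nc : \forall z \near y, codom_chart i z by exact: open_nbhs_nbhs.
have [r /= r0 rc] := (nbhs_ballP _ _).1 nc.
have const z : ball y r z -> (amb c \o param i) z = (amb c \o param i) y.
  move=> yz; pose F t : R := (amb c \o param i) (y + t *: (z - y)).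
  have inb (t : R) : 0 <= t <= 1 -> codom_chart i (y + t *: (z - y)).
    move=> /andP[t0 t1]; apply: rc; move: yz; rewrite -ball_normE /ball_ /=.
    apply: le_lt_trans; rewrite opprD addrA subrr sub0r normrN normrZ ger0_norm//.
    by rewrite -normrN opprB; apply: ler_piMl.
  have dF (t : R) : 0 <= t <= 1 -> is_derive t 1 F 0.
    move=> t01; rewrite -[X in is_derive _ _ _ X](D0 _ (z - y) (inb _ t01)).
    apply: differentiable_line; exact: smooth_differentiable (sa c i) (inb _ t01).
  have cF : {within `[0, 1], continuous F}.
    apply: derivable_within_continuous => t; rewrite in_itv/= => t01.
    by have [] := dF t t01.
  have dF' (t : R) : t \in `]0, 1[ -> is_derive t 1 F 0.
    by rewrite in_itv/= => /andP[a b]; apply: dF; rewrite !ltW.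
  have [t _] := @MVT R F (fun=> 0) 0 1 ltr01 dF' cF.
  rewrite mul0r /F scale1r scale0r addr0 (addrC y) subrK => /eqP.
  by rewrite subr_eq0 => /eqP.
have nd : \forall z \near x, dom i z.
  by apply: open_nbhs_nbhs; split=> //; exact: open_dom.
have nb : \forall w \near y, ball y r w by exact: nbhsx_ballx.
have nx := coord_continuous_at Hg di nb.
near=> z; have dz : dom i z by near: z.
have bz : ball y r (crd i z) by near: z.
by have := const _ bz; rewrite /= !(rm_coordK Hg).
Unshelve. all: by end_near. Qed.

(** The fibres of phi are open, hence also closed. *)
Lemma constant_map : connected [set: M] -> forall x, phi x = phi point.
Proof.
move=> conM.
have phiE x z : (forall c, amb c x = amb c z) -> phi x = phi z.
  by move=> h; apply: val_inj; apply/rowP => c; exact: h.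
have loc x : \forall z \near x, phi z = phi x.
  have : \forall z \near x, forall c, amb c z = amb c x.
    by apply: filter_forall => c; exact: amb_locally_constant.
  by apply: filterS => z; exact: phiE.
suff AT : [set x | phi x = phi point] = [set: M].
  by move=> x; have : [set: M] x by []; rewrite -AT.
apply: conM; first by exists point.
- exists [set x | phi x = phi point]; last by rewrite setTI.
  rewrite openE => x /= xA; rewrite /interior.
  by apply: filterS (loc x) => z /= ->.
- exists [set x | phi x = phi point]; last by rewrite setTI.
  rewrite -openC openE => x /= xA; rewrite /interior.
  by apply: filterS (loc x) => z /= ->.
Qed.

End Vanishing.

Theorem theorem8 (R : realType) (m n : nat) (M : ptopologicalType)
  (g : riem_atlas R M m) (mu : {measure set (borel M) -> \bar R})
  (p : M -> R) (phi : M -> sphere R n) :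
  riemannian_manifold g ->
  compact [set: M] ->
  connected [set: M] ->
  volume_measure g mu ->
  (2 < n)%N ->
  smooth_function g p ->
  (forall x, 2 <= p x < n%:R) ->
  stable_p_harmonic g (sphere_atlas R n) mu p phi ->
  exists c : sphere R n, forall x, phi x = c.
Proof.
move=> Hg cM conM vol _ sp pn [[sphi _] stable].
exists (phi point); exact (constant_map Hg cM vol sphi sp pn stable conM).
Qed.
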